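(* Let $F$, $L$, $\overline{L}$ and $P=P^F_{m,k}$ be as in the context, and suppose in addition that $F(z,\bar z)=f(|z|^2)\,b(z,\bar z)$ with $f$ and $b$ smooth and $b(0)\neq 0$. Then the following hold. (1) Suppose that for some $s,\rho\in\mathbb{R}$ and some neighborhood $V$ of the origin in $U\times\mathbb{R}$, for every $N>0$ there is a constant $C$ such that for all $v\in C_0^\infty(V)$ $$\|v\|^2_{s-\rho}+\|\overline{L}v\|_s^2+\|\bar z^{\,k}Lv\|_s^2\leq C\left(|(Pv,v)_s|+\|v\|_{-N}^2\right).$$ Then $\rho\geq\frac{k-1}{2m}$. (2) Suppose that for some $s,r\in\mathbb{R}$, for every pair of cut-off functions $\phi,\tilde\phi\in C_0^\infty(U\times\mathbb{R})$ with $\tilde\phi\equiv1$ near $\operatorname{supp}\phi$, every compact $K\subset U\times\mathbb{R}$ and every $N>0$, there is a constant $C$ such that for all $u\in C^\infty$ with support in $K$ $$\|\phi u\|_s^2\leq C\left(\|\tilde\phi Pu\|^2_{s+r}+\|u\|^2_{-N}\right).$$ Then $r\geq\frac{k-1}{m}$.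
   Context: Let $m,k\geq 1$ be integers, and let $U\subset\mathbb{C}$ be an open neighborhood of $0$. Points of $U\times\mathbb{R}$ are written $(z,t)$; $\partial_z,\partial_{\bar z}$ are the usual Wirtinger derivatives, and subscripts on functions denote derivatives. Let $F=F(z,\bar z)$ be a smooth real-valued function on $U$ (independent of $t$) such that $$F_{z\bar z}=|z|^{2(m-1)}g,\qquad F_z=\bar z|z|^{2(m-1)}h,$$ with $g,h$ smooth on $U$ and $g(0)\neq 0$; $U$ is taken small enough that $g$ does not vanish on $U$. Define $$L=\frac{\partial}{\partial z}+iF_z\frac{\partial}{\partial t},\qquad \overline{L}=\frac{\partial}{\partial\bar z}-iF_{\bar z}\frac{\partial}{\partial t},\qquad P=P^F_{m,k}=L\overline{L}+\overline{L}\,|z|^{2k}L .$$ All norms and inner products are those of $L^2$ in $z$ and $H^s$ in $t$: $(v,w)_s=\int_{\mathbb{C}}\int_{\mathbb{R}}(1+\tau^2)^{s}\,\hat v(z,\tau)\overline{\hat w(z,\tau)}\,d\tau\,dA(z)$, where $\hat{\ }$ is the Fourier transform in $t$ only and $dA$ is Lebesgue measure, and $\|v\|_s^2=(v,v)_s$. *)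

(* Defs.v *)
From HB Require Import structures.
From mathcomp Require Import all_boot all_order all_algebra complex.
From mathcomp Require Import all_classical all_reals all_analysis.

Set Implicit Arguments.
Unset Strict Implicit.
Unset Printing Implicit Defensive.
Import Order.TTheory GRing.Theory Num.Theory.
Import numFieldNormedType.Exports.
Import ComplexField.

Local Open Scope classical_set_scope.
Local Open Scope complex_scope.
Local Open Scope ring_scope.

(* R[i] carries no normed-module structure over R, so the plane C is R * R as a
   domain of functions (topology, derivatives, Lebesgue measure) and R[i] as a
   codomain; differentiation and integration of R[i]-valued functions are
   componentwise. Points of C x R are pairs ((x, y), t) with z = x + iy. *)

Section Smoothness.
Variables (R : realType) (V : normedModType R).

Fixpoint iterD (vs : seq V) (f : V -> R) : V -> R :=
  if vs is v :: vs' then 'D_v (iterD vs' f) else f.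

(* C^oo on A, meant for A open: all iterated directional derivatives exist and
   are continuous at every point of A. *)
Definition smooth_on (A : set V) (f : V -> R) : Prop :=
  forall (vs : seq V) (p : V), A p ->
    {for p, continuous (iterD vs f)} /\
    (forall v : V, derivable (iterD vs f) p v).

Definition csmooth_on (A : set V) (f : V -> R[i]) : Prop :=
  smooth_on A (fun p => complex.Re (f p)) /\
  smooth_on A (fun p => complex.Im (f p)).

Definition cderive (v : V) (f : V -> R[i]) (p : V) : R[i] :=
  ('D_v (fun q => complex.Re (f q)) p) +i*
  ('D_v (fun q => complex.Im (f q)) p).

Definition supp (f : V -> R[i]) : set V := closure [set p | f p != 0].

(* Extending by 0, an element of C_0^oo(A) is a function on the whole space. *)
Definition test_function (A : set V) (f : V -> R[i]) : Prop :=
  [/\ csmooth_on setT f, compact (supp f) & supp f `<=` A].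

End Smoothness.

Section Operators.
Variable R : realType.
Implicit Types (z : R * R) (p : R * R * R).

Definition toC z : R[i] := z.1 +i* z.2.

Definition cabs z : R := Normc.normc (toC z).

Definition d_z (f : R * R -> R[i]) z : R[i] :=
  2^-1 * (cderive ((1, 0) : R * R) f z - 'i%C * cderive ((0, 1) : R * R) f z).

Definition d_zbar (f : R * R -> R[i]) z : R[i] :=
  2^-1 * (cderive ((1, 0) : R * R) f z + 'i%C * cderive ((0, 1) : R * R) f z).

Definition d_t (v : R * R * R -> R[i]) p : R[i] :=
  cderive (1 : R) (fun t => v (p.1, t)) p.2.

(* L, Lbar and P are applied only to functions v whose support is a compact
   subset of U x R; F is only constrained on U, but its values outside U do
   not matter since they are multiplied by derivatives of v, which vanish. *)
Definition opL (F : R * R -> R) (v : R * R * R -> R[i]) p : R[i] :=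
  d_z (fun z => v (z, p.2)) p.1
  + 'i%C * d_z (fun z => (F z)%:C) p.1 * d_t v p.

Definition opLbar (F : R * R -> R) (v : R * R * R -> R[i]) p : R[i] :=
  d_zbar (fun z => v (z, p.2)) p.1
  - 'i%C * d_zbar (fun z => (F z)%:C) p.1 * d_t v p.

Definition opP (k : nat) (F : R * R -> R) (v : R * R * R -> R[i]) p : R[i] :=
  opL F (opLbar F v) p
  + opLbar F (fun q => (cabs q.1 ^+ (2 * k))%:C * opL F v q) p.

End Operators.

Section Norms.
Variable R : realType.

Definition cintegral d (T : measurableType d) (mu : {measure set T -> \bar R})
    (f : T -> R[i]) : R[i] :=
  (\int[mu]_x complex.Re (f x)) +i* (\int[mu]_x complex.Im (f x)).

(* Fourier transform in t, without normalising factor: such a factor would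
   multiply all the inner products below by one and the same constant. *)
Definition fourier_t (v : R * R * R -> R[i]) (z : R * R) (tau : R) : R[i] :=
  cintegral (@lebesgue_measure R)
    (fun t => (cos (tau * t) -i* sin (tau * t)) * v (z, t)).

(* (v, w)_s *)
Definition inner (s : R) (v w : R * R * R -> R[i]) : R[i] :=
  cintegral ((@lebesgue_measure R) \x (@lebesgue_measure R))%E (fun z =>
    cintegral (@lebesgue_measure R) (fun tau =>
      ((1 + tau ^+ 2) `^ s)%:C * fourier_t v z tau
      * ((fourier_t w z tau)^*)%C)).

(* ||v||_s^2; (v, v)_s is real *)
Definition sqnorm (s : R) (v : R * R * R -> R[i]) : R :=
  complex.Re (inner s v v).

End Norms.

(* Main.v *)
Require Import Defs.
From HB Require Import structures.
From mathcomp Require Import all_boot all_order all_algebra complex.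
From mathcomp Require Import all_classical all_reals all_analysis.
From mathcomp Require Import measurable_realfun.
From mathcomp Require Import ring lra zify.

Set Implicit Arguments.
Unset Strict Implicit.
Unset Printing Implicit Defensive.
Import Order.TTheory GRing.Theory Num.Theory.
Import numFieldNormedType.Exports.
Import ComplexField.

Local Open Scope classical_set_scope.
Local Open Scope complex_scope.
Local Open Scope ring_scope.

(** The complex vector fields L and Lbar have the first integral t - iF,
respectively t + iF: indeed Lbar (t + iF) = 0, so Lbar annihilates every
function of t + iF. Both exponents are obtained by testing the estimates on
functions that Lbar almost annihilates, concentrated at frequency mu in t and
at scale |mu|^(-1/2m) in z.

The hypotheses on F fix its shape at the origin. Comparing F_z with F_zzbar
gives g(0) = m h(0) ([g0_of_h0]); since F is real, so is F_zzbar, and h(0) is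
a nonzero real number ([Im_h0], [Re_h0]). Hence F - F(0) is comparable with
sigma |z|^2m for a sign sigma ([phase_growth]). Subtracting the constant F(0)
changes neither L nor Lbar; write Phi for the difference.

For large lambda put mu = sigma lambda^2m and

   v(z,t) = chi(z) e^(i mu (t + i Phi)) sum_(j <= k) psi^(j)(t) (i Phi)^j / j!

with cut-offs chi and psi. The factor e^(- mu Phi) is dominated by
exp(- c (lambda |z|)^2m), so that every factor |z|^p costs lambda^(-p)
([damped_family_bound]). The sum is the Taylor polynomial of psi(t + i Phi):
near the origin Lbar reduces v to its remainder, of order |z|^(2m-1) |z|^2mk,
and L Lbar v stays negligible. In the other half of P, the field L costs
mu Phi_z, of size mu |z|^(2m-1), and Lbar then falls on |z|^2k Phi_z; the result
is bounded by mu |z|^(2m+2k-2), that is, by lambda^(-2(k-1)). Thus P v is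
smaller than v by lambda^(-2(k-1)) ([P_probe_bound]).

As v is a finite sum of products of a function of z and a modulated bump in t,
its partial Fourier transform separates the variables, and the inner products
split into plane integrals, of size lambda^(-2), and frequency moments, of size
(1 + mu^2)^s ([inner_tens_upper], [sqnorm_tens_lower]). Consequently, up to
constants, |v|_s^2 is (1 + mu^2)^s / lambda^2, the pairing (P v, v)_s gains
lambda^(-2(k-1)) over it, and |P v|_s^2 gains lambda^(-4(k-1))
([probe_family]). In the first estimate the left side is at least |v|_(s-rho)^2,
whence lambda^(-4 m rho) <= C lambda^(-2(k-1)); the second one gives
lambda^(-4 m r) <= C lambda^(-4(k-1)). Letting lambda tend to infinity yields
the two bounds ([sobolev_comparison]), the error |v|_(-N)^2 being negligible for
large N. *)

(** * Calculus of smooth functions *)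

Section SmoothCalculus.
Variables (R : realType) (V : normedModType R).
Implicit Types (f g : V -> R) (A : set V) (p v : V).

(** Reduces directional derivatives to derivatives on the real line, where the
chain rule and the derivatives of the elementary functions are available. *)
Lemma derive_line f p v : 'D_v f p = 'D_1 (fun h : R => f (h *: v + p)) 0.
Proof.
rewrite /derive; set g1 := fun h => h^-1 *: _; set g2 := fun h => h^-1 *: _.
suff -> : g1 = g2 by [].
by rewrite funeqE /g1 /g2 => h /=; rewrite addr0 scale0r add0r [_%:A]mulr1.
Qed.

Lemma is_derive_comp1 f (phi : R -> R) p v (df dphi : R) :
  is_derive p v f df -> is_derive (f p) 1 phi dphi ->
  is_derive p v (phi \o f) (dphi * df).
Proof.
move=> [/derivable1P fpv <-] hphi.
have fl : is_derive (0 : R) 1 (fun h : R => f (h *: v + p)) ('D_v f p).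
  by apply: DeriveDef => //; rewrite -derive_line.
have hphi' : is_derive (f (0 *: v + p)) 1 phi dphi by rewrite scale0r add0r.
have [d1 d2] := is_derive1_comp hphi' fl.
by apply: DeriveDef; [exact/derivable1P|rewrite derive_line].
Qed.

Lemma near_eq_continuous f g p : {near p, f =1 g} ->
  {for p, continuous f} -> {for p, continuous g}.
Proof.
move=> fg cf; have fgp : f p = g p by exact: nbhs_singleton fg.
change (g @ p --> g p); rewrite -fgp; apply: cvg_trans cf.
exact: near_eq_cvg.
Qed.

(** Smoothness by coinduction: a class of functions that is stable under
directional derivatives up to equality on the open set A consists of smooth
functions as soon as its members are continuous and derivable. *)
Lemma smooth_coind A (cls : (V -> R) -> Prop) : open A ->
  (forall f, cls f -> forall p, A p ->
    {for p, continuous f} /\ forall v, derivable f p v) ->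
  (forall f v, cls f -> exists2 f', cls f' & forall p, A p -> 'D_v f p = f' p) ->
  forall f, cls f -> smooth_on A f.
Proof.
move=> oA reg der f0 clsf0 vs p Ap.
have key : exists2 f', cls f' & forall q, A q -> Defs.iterD vs f0 q = f' q.
  elim: vs => [|v vs [f' clsf' E]] /=; first by exists f0.
  have [f'' clsf'' E'] := der _ v clsf'.
  exists f'' => // q Aq; rewrite -E'//; apply: near_eq_derive.
  by near=> r; apply: E; near: r; exact: open_nbhs_nbhs.
have [f' clsf' E] := key; have [cf' df'] := reg _ clsf' p Ap.
have nE : {near p, f' =1 Defs.iterD vs f0}.
  by near=> r; apply/esym/E; near: r; exact: open_nbhs_nbhs.
split; first exact: near_eq_continuous nE cf'.
by move=> v; exact: near_eq_derivable nE (df' v).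
Unshelve. all: by end_near. Qed.

Section Generated.
Variables (A : set V) (B : set R) (phi : nat -> R -> R).
Hypothesis dphi : forall n x, B x -> is_derive x 1 (phi n) (phi n.+1 x).

(** The derivative of a product or of a composition is not of the same form, so
an induction on the number of derivatives fails for each of them separately.
The class generated by smooth functions under sums, products and composition
with the members of a chain phi of successive derivatives is stable. *)
Inductive smooth_gen : (V -> R) -> Prop :=
| smooth_gen_base f : smooth_on A f -> smooth_gen f
| smooth_gen_add f g : smooth_gen f -> smooth_gen g -> smooth_gen (f + g)
| smooth_gen_mul f g : smooth_gen f -> smooth_gen g -> smooth_gen (f * g)
| smooth_gen_comp n f : smooth_gen f -> (forall p, A p -> B (f p)) ->
    smooth_gen (phi n \o f).

Lemma smooth_on_derive f v : smooth_on A f -> smooth_on A ('D_v f).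
Proof.
move=> sf vs p Ap; have := sf (rcons vs v) p Ap.
suff -> : Defs.iterD (rcons vs v) f = Defs.iterD vs ('D_v f) by [].
by elim: vs => //= w vs ->.
Qed.

Lemma smooth_gen_reg f : smooth_gen f -> forall p, A p ->
  {for p, continuous f} /\ forall v, derivable f p v.
Proof.
elim=> {f}[f sf|f g _ IHf _ IHg|f g _ IHf _ IHg|n f _ IHf fB] p Ap.
- exact: (sf [::] p Ap).
- have [cf df] := IHf p Ap; have [cg dg] := IHg p Ap.
  by split; [exact: continuousD|move=> v; exact: derivableD].
- have [cf df] := IHf p Ap; have [cg dg] := IHg p Ap.
  by split; [exact: continuousM|move=> v; exact: derivableM].
- have [cf df] := IHf p Ap; have hphi := dphi n (fB p Ap); split.
    apply: continuous_comp => //.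
    exact/differentiable_continuous/derivable1_diffP.
  move=> v; have hf : is_derive p v f ('D_v f p) by exact: derivableP.
  by have [] := is_derive_comp1 hf hphi.
Qed.

Lemma smooth_gen_der f v : smooth_gen f ->
  exists2 f', smooth_gen f' & forall p, A p -> 'D_v f p = f' p.
Proof.
elim=> {f}[f sf|f g sf [f' sf' Ef] sg [g' sg' Eg]
  |f g sf [f' sf' Ef] sg [g' sg' Eg]|n f sf [f' sf' Ef] fB].
- by exists ('D_v f) => //; apply: smooth_gen_base; exact: smooth_on_derive.
- exists (f' + g'); first exact: smooth_gen_add.
  move=> p Ap; have [_ df] := smooth_gen_reg sf Ap.
  have [_ dg] := smooth_gen_reg sg Ap.
  by rewrite deriveD// Ef// Eg.
- exists (f * g' + g * f').
    by apply: smooth_gen_add; exact: smooth_gen_mul.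
  move=> p Ap; have [_ df] := smooth_gen_reg sf Ap.
  have [_ dg] := smooth_gen_reg sg Ap.
  by rewrite deriveM// Ef// Eg.
- exists ((phi n.+1 \o f) * f').
    by apply: smooth_gen_mul => //; exact: smooth_gen_comp.
  move=> p Ap; have [_ df] := smooth_gen_reg sf Ap.
  have hf : is_derive p v f ('D_v f p) by exact: derivableP.
  have [_ ->] := is_derive_comp1 hf (dphi n (fB p Ap)).
  by rewrite Ef.
Qed.

Lemma smooth_gen_smooth f : open A -> smooth_gen f -> smooth_on A f.
Proof.
by move=> oA; apply: smooth_coind => //;
  [exact: smooth_gen_reg|exact: smooth_gen_der].
Qed.

Lemma smooth_on_comp n f : open A -> smooth_on A f ->
  (forall p, A p -> B (f p)) -> smooth_on A (phi n \o f).
Proof.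
move=> oA sf fB; apply: smooth_gen_smooth => //.
by apply: smooth_gen_comp => //; exact: smooth_gen_base.
Qed.

End Generated.

(* Sums and products need no outer function: an empty domain B will do. *)
Let zero_family (n : nat) (x : R) : set0 x ->
  is_derive x (1 : R) ((fun _ _ => 0) n : R -> R) ((fun _ _ => 0 : R) n.+1 x).
Proof. by []. Qed.

Lemma smooth_onD A f g : open A ->
  smooth_on A f -> smooth_on A g -> smooth_on A (f + g).
Proof.
move=> oA sf sg; apply: (smooth_gen_smooth zero_family) => //.
by apply: smooth_gen_add; exact: smooth_gen_base.
Qed.

Lemma smooth_onM A f g : open A ->
  smooth_on A f -> smooth_on A g -> smooth_on A (f * g).
Proof.
move=> oA sf sg; apply: (smooth_gen_smooth zero_family) => //.
by apply: smooth_gen_mul; exact: smooth_gen_base.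
Qed.

Lemma smooth_on_cst A (c : R) : open A -> smooth_on A (cst c).
Proof.
move=> oA; apply: (@smooth_coind _ (fun f => exists c, f = cst c)) => //.
- move=> f [d ->] p Ap; split; first exact: cst_continuous.
  by move=> v; exact: derivable_cst.
- move=> f v [d ->]; exists (cst 0); first by exists 0.
  by move=> p _; rewrite derive_cst.
- by exists c.
Qed.

Lemma smooth_on_linear A (l : V -> R) : open A -> continuous l ->
  (forall (h : R) v p, l (h *: v + p) = h * l v + l p) -> smooth_on A l.
Proof.
move=> oA cl ll.
have dl p v : is_derive p v l (l v).
  have E : (fun h : R => l (h *: v + p)) = (id * cst (l v)) + cst (l p).
    by apply/funext => h; rewrite ll.
  have dE : is_derive (0 : R) 1 ((id * cst (l v)) + cst (l p) : R -> R) (l v).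
    have := is_deriveD (is_deriveM (is_derive_id (0 : R) 1)
      (is_derive_cst (l v) (0 : R) 1)) (is_derive_cst (l p) (0 : R) 1).
    by move/is_derive_eq; apply; rewrite addr0 scaler0 add0r [_ *: _]mulr1.
  apply: DeriveDef; first by apply/derivable1P; rewrite E.
  by rewrite derive_line E derive_val.
apply: (@smooth_coind _ (fun f => f = l \/ exists c, f = cst c)) => //.
- move=> f [->|[d ->]] p Ap; split=> //; try exact: cst_continuous.
  exact: cl.
- move=> f v [->|[d ->]].
    exists (cst (l v)); first by right; exists (l v).
    by move=> p _; rewrite derive_val.
  exists (cst 0); first by right; exists 0.
  by move=> p _; rewrite derive_cst.
- by left.
Qed.

Lemma smooth_onU A A' f : smooth_on A f -> smooth_on A' f ->
  smooth_on (A `|` A') f.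
Proof. by move=> sf sf' vs p [] Hp; [exact: sf|exact: sf']. Qed.

Lemma smooth_on_sub A A' f : A `<=` A' -> smooth_on A' f -> smooth_on A f.
Proof. by move=> AA' sf vs p /AA'; exact: sf. Qed.

Lemma smooth_on_ext A f g : open A -> (forall p, A p -> f p = g p) ->
  smooth_on A f -> smooth_on A g.
Proof.
move=> oA fg sf.
apply: (@smooth_coind _ (fun g => exists2 f, smooth_on A f &
   forall p, A p -> f p = g p)) => //; last by exists f.
- move=> {}g [{}f {}sf {}fg] p Ap; have [cf df] := sf [::] p Ap.
  have nE : {near p, f =1 g}.
    by near=> r; apply: fg; near: r; exact: open_nbhs_nbhs.
  split; first exact: near_eq_continuous nE cf.
  by move=> v; exact: near_eq_derivable nE (df v).
- move=> {}g v [{}f {}sf {}fg]; exists ('D_v f).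
    exists ('D_v f) => //; exact: smooth_on_derive.
  move=> p Ap; apply/esym/near_eq_derive.
  by near=> r; apply: fg; near: r; exact: open_nbhs_nbhs.
Unshelve. all: by end_near. Qed.

End SmoothCalculus.

(** * Complex-valued smooth functions *)

Section SmoothPullback.
Variables (R : realType) (V W : normedModType R) (l : V -> W).
Hypothesis cl : continuous l.
Hypothesis ll : forall (h : R) v p, l (h *: v + p) = h *: l v + l p.

Lemma derive_pullback (f : W -> R) p v : 'D_v (f \o l) p = 'D_(l v) f (l p).
Proof.
rewrite [LHS]derive_line [RHS]derive_line.
have -> // : (fun h : R => (f \o l) (h *: v + p)) = fun h => f (h *: l v + l p).
by apply/funext => h /=; rewrite ll.
Qed.

Lemma derivable_pullback (f : W -> R) p v :
  derivable f (l p) (l v) -> derivable (f \o l) p v.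
Proof.
move=> /derivable1P d; apply/derivable1P.
by rewrite (_ : (fun _ => _) = (fun h => f (h *: l v + l p)))//; apply/funext => h /=;
  rewrite ll.
Qed.

Lemma smooth_on_pullback (B : set W) (f : W -> R) : open B ->
  smooth_on B f -> smooth_on (l @^-1` B) (f \o l).
Proof.
move=> oB sf; have oA : open (l @^-1` B) by exact: open_comp.
apply: (@smooth_coind _ _ _ (fun g => exists2 f, smooth_on B f & g = f \o l)) => //.
- move=> g [{}f {}sf ->] p Bp; have [cf df] := sf [::] _ Bp.
  split; first by apply: continuous_comp => //; exact: cl.
  by move=> v; apply: derivable_pullback; exact: df.
- move=> g v [{}f {}sf ->]; exists ('D_(l v) f \o l).
    by exists ('D_(l v) f); [exact: smooth_on_derive|].
  by move=> p _; exact: derive_pullback.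
- by exists f.
Qed.

End SmoothPullback.

Section ComplexParts.
Variable R : realType.
Implicit Types x y : R[i].

Lemma ReD x y : complex.Re (x + y) = complex.Re x + complex.Re y.
Proof. by case: x; case: y. Qed.

Lemma ImD x y : complex.Im (x + y) = complex.Im x + complex.Im y.
Proof. by case: x; case: y. Qed.

Lemma ReM x y : complex.Re (x * y) =
  complex.Re x * complex.Re y - complex.Im x * complex.Im y.
Proof. by case: x; case: y. Qed.

Lemma ImM x y : complex.Im (x * y) =
  complex.Re x * complex.Im y + complex.Im x * complex.Re y.
Proof. by case: x; case: y. Qed.

Lemma ReJ x : complex.Re (x^*)%C = complex.Re x.
Proof. by case: x. Qed.

Lemma ImJ x : complex.Im (x^*)%C = - complex.Im x. Proof. by case: x. Qed.

Lemma complex_eqP x y :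
  complex.Re x = complex.Re y -> complex.Im x = complex.Im y -> x = y.
Proof. by case: x => a b; case: y => c d /= -> ->. Qed.

Lemma conjcM x y : conjc (x * y) = conjc x * conjc y.
Proof. by case: x => a b; case: y => c d; apply: complex_eqP => /=; ring. Qed.

Lemma conjcD x y : conjc (x + y) = conjc x + conjc y.
Proof. by case: x => a b; case: y => c d; apply: complex_eqP => /=; ring. Qed.

Lemma realcM (a b : R) : (a * b)%:C = a%:C * b%:C :> R[i].
Proof. by apply: complex_eqP => /=; ring. Qed.

Lemma realcD (a b : R) : (a + b)%:C = a%:C + b%:C :> R[i].
Proof. by apply: complex_eqP => /=; ring. Qed.

Lemma realcX (a : R) n : (a ^+ n)%:C = a%:C ^+ n :> R[i].
Proof. by elim: n => // n ih; rewrite !exprS realcM ih. Qed.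

(** The real and imaginary parts of the Leibniz rule, in the form in which the
componentwise derivatives of a product produce them. *)
Lemma complex_leibniz (x y : R[i]) (a b c d : R) :
  (complex.Re x *: c + complex.Re y *: a - (complex.Im x *: d + complex.Im y *: b))
  +i* (complex.Re x *: d + complex.Im y *: a + (complex.Im x *: c + complex.Re y *: b))
  = (a +i* b) * y + x * (c +i* d).
Proof.
by case: x => x1 x2; case: y => y1 y2; apply: complex_eqP => /=;
  rewrite /GRing.scale /=; ring.
Qed.

Lemma complex_half : (2^-1 : R[i]) = (2^-1)%:C.
Proof.
have h : (2 : R[i]) = (2 : R)%:C by rewrite -[2 in RHS]natr1 realcD.
apply: (@mulfI _ (2 : R[i])); first by rewrite pnatr_eq0.
by rewrite mulfV ?pnatr_eq0// h -realcM mulfV ?pnatr_eq0.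
Qed.

End ComplexParts.

Section ComplexSmooth.
Variables (R : realType) (V : normedModType R).
Implicit Types (f g : V -> R[i]) (A : set V) (p v : V).

Definition cderivable f p v :=
  derivable (fun q => complex.Re (f q)) p v /\
  derivable (fun q => complex.Im (f q)) p v.

Lemma csmooth_cderivable A f p v : csmooth_on A f -> A p -> cderivable f p v.
Proof.
by move=> [sr si] Ap; split; [have [_] := sr [::] p Ap|have [_] := si [::] p Ap];
  exact.
Qed.

Lemma csmooth_on_cst A (c : R[i]) : open A -> csmooth_on A (fun=> c).
Proof. by move=> oA; split; exact: (smooth_on_cst _ oA). Qed.

Lemma csmooth_on_real A (f : V -> R) : open A ->
  smooth_on A f -> csmooth_on A (fun p => (f p)%:C).
Proof. by move=> oA sf; split; [exact: sf|exact: (smooth_on_cst 0 oA)]. Qed.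

Lemma csmooth_onD A f g : open A -> csmooth_on A f -> csmooth_on A g ->
  csmooth_on A (fun p => f p + g p).
Proof.
move=> oA [fr fi] [gr gi]; split.
  under eq_fun do rewrite ReD.
  exact: (smooth_onD oA fr gr).
under eq_fun do rewrite ImD.
exact: (smooth_onD oA fi gi).
Qed.

Lemma smooth_onN A (f : V -> R) : open A -> smooth_on A f ->
  smooth_on A (fun p => - f p).
Proof.
move=> oA sf; have := smooth_onM oA (smooth_on_cst (-1) oA) sf.
by apply: smooth_on_ext => // p _ /=; rewrite [LHS]mulN1r.
Qed.

Lemma csmooth_onM A f g : open A -> csmooth_on A f -> csmooth_on A g ->
  csmooth_on A (fun p => f p * g p).
Proof.
move=> oA [fr fi] [gr gi]; split.
  under eq_fun do rewrite ReM.
  apply: (smooth_onD oA (smooth_onM oA fr gr)).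
  exact: (smooth_onN oA (smooth_onM oA fi gi)).
under eq_fun do rewrite ImM.
exact: (smooth_onD oA (smooth_onM oA fr gi) (smooth_onM oA fi gr)).
Qed.

Lemma csmooth_onJ A f : open A -> csmooth_on A f ->
  csmooth_on A (fun p => (f p)^*%C).
Proof.
move=> oA [fr fi]; split.
  by under eq_fun do rewrite ReJ; exact: fr.
under eq_fun do rewrite ImJ.
exact: (smooth_onN oA fi).
Qed.

Lemma csmooth_onX A f n : open A -> csmooth_on A f ->
  csmooth_on A (fun p => f p ^+ n).
Proof.
move=> oA sf; elim: n => [|n ih]; first exact: (csmooth_on_cst 1 oA).
by under eq_fun do rewrite exprS; exact: csmooth_onM.
Qed.

Lemma csmooth_on_sum A n (F : nat -> V -> R[i]) : open A ->
  (forall j, csmooth_on A (F j)) ->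
  csmooth_on A (fun p => \sum_(j < n) F j p).
Proof.
move=> oA sF; elim: n => [|n ih].
  under eq_fun do rewrite big_ord0.
  exact: (csmooth_on_cst 0 oA).
under eq_fun do rewrite big_ord_recr /=.
exact: (csmooth_onD oA ih (sF n)).
Qed.

Lemma csmooth_on_cderive A f v : csmooth_on A f -> csmooth_on A (cderive v f).
Proof.
by move=> [fr fi]; split; [exact: (smooth_on_derive v fr)|
  exact: (smooth_on_derive v fi)].
Qed.

Lemma csmooth_on_ext A f g : open A -> (forall p, A p -> f p = g p) ->
  csmooth_on A f -> csmooth_on A g.
Proof.
move=> oA fg [fr fi]; split.
  by apply: smooth_on_ext fr => // p Ap; rewrite fg.
by apply: smooth_on_ext fi => // p Ap; rewrite fg.
Qed.

Lemma near_eq_cderive f g p v : {near p, f =1 g} ->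
  cderive v f p = cderive v g p.
Proof.
by move=> fg; rewrite /cderive; congr (_ +i* _); apply: near_eq_derive;
  near=> q; congr (_ _); near: q.
Unshelve. all: by end_near. Qed.

Lemma cderive_cst (c : R[i]) p v : cderive v (fun=> c) p = 0.
Proof. by rewrite /cderive !derive_cst. Qed.

Lemma cderiveD f g p v : cderivable f p v -> cderivable g p v ->
  cderive v (fun q => f q + g q) p = cderive v f p + cderive v g p.
Proof.
move=> [fr fi] [gr gi]; rewrite /cderive.
under eq_fun do rewrite ReD.
under [X in _ +i* ('D_v X _)]eq_fun do rewrite ImD.
by rewrite (deriveD fr gr) (deriveD fi gi).
Qed.

Lemma cderiveM f g p v : cderivable f p v -> cderivable g p v ->
  cderive v (fun q => f q * g q) p = cderive v f p * g p + f p * cderive v g p.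
Proof.
move=> [fr fi] [gr gi]; rewrite /cderive.
under eq_fun do rewrite ReM.
under [X in _ +i* ('D_v X _)]eq_fun do rewrite ImM.
rewrite (deriveB (derivableM fr gr) (derivableM fi gi)).
rewrite (deriveD (derivableM fr gi) (derivableM fi gr)).
rewrite (deriveM fr gr) (deriveM fi gi) (deriveM fr gi) (deriveM fi gr).
exact: complex_leibniz.
Qed.

Lemma cderivableD f g p v : cderivable f p v -> cderivable g p v ->
  cderivable (fun q => f q + g q) p v.
Proof.
move=> [fr fi] [gr gi]; split.
  under eq_fun do rewrite ReD.
  exact: (derivableD fr gr).
under eq_fun do rewrite ImD.
exact: (derivableD fi gi).
Qed.

Lemma cderivable_cst (c : R[i]) p v : cderivable (fun=> c) p v.
Proof.
by split; [exact: (derivable_cst (complex.Re c) p v)|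
  exact: (derivable_cst (complex.Im c) p v)].
Qed.

Lemma cderivableM f g p v : cderivable f p v -> cderivable g p v ->
  cderivable (fun q => f q * g q) p v.
Proof.
move=> [fr fi] [gr gi]; split.
  under eq_fun do rewrite ReM.
  exact: (derivableB (derivableM fr gr) (derivableM fi gi)).
under eq_fun do rewrite ImM.
exact: (derivableD (derivableM fr gi) (derivableM fi gr)).
Qed.

Lemma cderiveJ f p v : cderivable f p v ->
  cderive v (fun q => (f q)^*%C) p = (cderive v f p)^*%C.
Proof.
move=> [fr fi]; rewrite /cderive.
under eq_fun do rewrite ReJ.
under [X in _ +i* ('D_v X _)]eq_fun do rewrite ImJ.
by rewrite deriveN.
Qed.

Lemma cderive_real (f : V -> R) p v :
  cderive v (fun q => (f q)%:C) p = ('D_v f p)%:C.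
Proof. by rewrite /cderive /= derive_cst. Qed.

End ComplexSmooth.

(** * Wirtinger derivatives *)

Lemma is_derive_affine (R : realType) (a b x : R) :
  is_derive x (1 : R) (fun y : R => a * y + b) a.
Proof.
have := is_deriveD (is_deriveM (is_derive_cst a x (1 : R)) (is_derive_id x (1 : R)))
  (is_derive_cst b x (1 : R)).
by move/is_derive_eq; apply; rewrite addr0 scaler0 addr0 [_ *: _]mulr1.
Qed.

Lemma is_derive_scale (R : realType) (a x : R) :
  is_derive x (1 : R) (fun y : R => a * y) a.
Proof.
have := is_derive_affine a 0 x.
by rewrite (_ : (fun _ => _ + 0) = (fun y => a * y))//; apply/funext => y;
  rewrite addr0.
Qed.

Section Wirtinger.
Variable R : realType.
Implicit Types (f g : R * R -> R[i]) (A : set (R * R)) (z : R * R) (w : R[i]).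

(** Covers both Wirtinger derivatives, d/dz for w = - i and d/dzbar for w = i,
so that each rule is proved once. *)
Definition wirt w f z : R[i] :=
  2^-1 * (cderive ((1, 0) : R * R) f z + w * cderive ((0, 1) : R * R) f z).

Lemma d_zE f z : d_z f z = wirt (- 'i%C) f z.
Proof. by rewrite /d_z /wirt mulNr. Qed.

Lemma d_zbarE f z : d_zbar f z = wirt 'i%C f z. Proof. by []. Qed.

Lemma near_eq_wirt w f g z : {near z, f =1 g} -> wirt w f z = wirt w g z.
Proof. by move=> fg; rewrite /wirt !(near_eq_cderive _ fg). Qed.

Lemma eq_on_wirt A w f g z : open A -> (forall y, A y -> f y = g y) -> A z ->
  wirt w f z = wirt w g z.
Proof.
move=> oA fg Az; apply: near_eq_wirt.
by near=> y; apply: fg; near: y; exact: open_nbhs_nbhs.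
Unshelve. all: by end_near. Qed.

Lemma wirt_cst w (c : R[i]) z : wirt w (fun=> c) z = 0.
Proof. by rewrite /wirt !cderive_cst mulr0 addr0 mulr0. Qed.

Lemma csmooth_on_wirt A w f : open A -> csmooth_on A f -> csmooth_on A (wirt w f).
Proof.
move=> oA sf; apply: (csmooth_onM oA (csmooth_on_cst _ oA)).
apply: (csmooth_onD oA (csmooth_on_cderive _ sf)).
by apply: (csmooth_onM oA (csmooth_on_cst _ oA)); exact: csmooth_on_cderive.
Qed.

Section Rules.
Variables (A : set (R * R)) (w : R[i]) (z : R * R).
Hypothesis Az : A z.

Lemma wirtD f g : csmooth_on A f -> csmooth_on A g ->
  wirt w (fun y => f y + g y) z = wirt w f z + wirt w g z.
Proof.
move=> sf sg; rewrite /wirt !cderiveD; try exact: csmooth_cderivable Az.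
by ring.
Qed.

Lemma wirtM f g : csmooth_on A f -> csmooth_on A g ->
  wirt w (fun y => f y * g y) z = wirt w f z * g z + f z * wirt w g z.
Proof.
move=> sf sg; rewrite /wirt !cderiveM; try exact: csmooth_cderivable Az.
by ring.
Qed.

Hypothesis oA : open A.

Lemma wirtZ (c : R[i]) f : csmooth_on A f ->
  wirt w (fun y => c * f y) z = c * wirt w f z.
Proof.
move=> sf; rewrite (wirtM (csmooth_on_cst c oA) sf) wirt_cst mul0r add0r//.
Qed.

Lemma wirt_sum n (F : nat -> R * R -> R[i]) :
  (forall j, csmooth_on A (F j)) ->
  wirt w (fun y => \sum_(j < n) F j y) z = \sum_(j < n) wirt w (F j) z.
Proof.
move=> sF; elim: n => [|n ih].
  by under eq_fun do rewrite big_ord0; rewrite wirt_cst big_ord0.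
under eq_fun do rewrite big_ord_recr /=.
by rewrite (wirtD (csmooth_on_sum n oA sF) (sF n)) ih big_ord_recr.
Qed.

Lemma wirtX f n : csmooth_on A f ->
  wirt w (fun y => f y ^+ n) z = n%:R * f z ^+ n.-1 * wirt w f z.
Proof.
move=> sf; elim: n => [|n ih].
  by under eq_fun do rewrite expr0; rewrite wirt_cst !mul0r.
under eq_fun do rewrite exprS.
rewrite (wirtM sf (csmooth_onX n oA sf)) ih.
case: n {ih} => [|n]; first by rewrite /= !expr0 !mul0r mulr0 addr0 mulr1 !mul1r.
by rewrite /= exprS; ring.
Qed.

Lemma wirtJ f : csmooth_on A f ->
  wirt w (fun y => (f y)^*%C) z = conjc (wirt (conjc w) f z).
Proof.
move=> sf; rewrite /wirt !cderiveJ; try exact: csmooth_cderivable Az.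
by rewrite !(conjcM, conjcD) conjcK complex_half conjc_real.
Qed.

End Rules.

Lemma continuous_fst_R : continuous (fst : R * R -> R).
Proof. by move=> p; exact: cvg_fst. Qed.

Lemma continuous_snd_R : continuous (snd : R * R -> R).
Proof. by move=> p; exact: cvg_snd. Qed.

Lemma smooth_fst : smooth_on setT (fst : R * R -> R).
Proof. exact: (smooth_on_linear openT continuous_fst_R). Qed.

Lemma smooth_snd : smooth_on setT (snd : R * R -> R).
Proof. exact: (smooth_on_linear openT continuous_snd_R). Qed.

Lemma csmooth_toC : csmooth_on setT (@toC R).
Proof. by split; [exact: smooth_fst|exact: smooth_snd]. Qed.

Lemma derive_coord z (v : R * R) :
  ('D_v (fst : R * R -> R) z = v.1) * ('D_v (snd : R * R -> R) z = v.2).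
Proof.
have der1 (a b : R) : 'D_1 (fun h : R => h * a + b) 0 = a.
  under eq_fun do rewrite mulrC.
  by have [_ ->] := is_derive_affine a b (0 : R).
by split; rewrite derive_line /= der1.
Qed.

Lemma wirt_toC w z : wirt w (@toC R) z = 2^-1 * (1 + w * 'i%C).
Proof.
rewrite /wirt /cderive; under eq_fun do rewrite /=.
by rewrite !derive_coord.
Qed.

Lemma wirt_toC_z z : wirt (- 'i%C) (@toC R) z = 1.
Proof.
rewrite wirt_toC complex_half; apply: complex_eqP => /=; last by ring.
by field.
Qed.

Lemma wirt_toC_zbar z : wirt 'i%C (@toC R) z = 0.
Proof. by rewrite wirt_toC complex_half; apply: complex_eqP => /=; ring. Qed.

Lemma wirt_exp A w (c : R) (Phi : R * R -> R) z :
  open A -> A z -> smooth_on A Phi ->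
  wirt w (fun y => (expR (c * Phi y))%:C) z =
  (c * expR (c * Phi z))%:C * wirt w (fun y => (Phi y)%:C) z.
Proof.
move=> oA Az sP; rewrite /wirt.
have h v : 'D_v (fun y => expR (c * Phi y)) z = c * expR (c * Phi z) * 'D_v Phi z.
  have dP : is_derive z v Phi ('D_v Phi z).
    by apply: derivableP; have [_] := sP [::] z Az; exact.
  have dexp : is_derive (Phi z) (1 : R) (fun x => expR (c * x))
      (expR (c * Phi z) * c).
    exact: (is_derive1_comp (is_derive_expR _) (is_derive_scale c (Phi z))).
  by have [_ E] := is_derive_comp1 dP dexp; apply: (etrans E); ring.
by rewrite !cderive_real !h !realcM; ring.
Qed.

Lemma smooth_on_expR A (c : R) (Phi : R * R -> R) : open A -> smooth_on A Phi ->
  smooth_on A (fun y => expR (c * Phi y)).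
Proof.
move=> oA sP; pose phi (n : nat) (x : R) := c ^+ n * expR (c * x).
have dphi n x : setT x -> is_derive x (1 : R) (phi n) (phi n.+1 x).
  move=> _.
  have he := is_derive1_comp (is_derive_expR (c * x)) (is_derive_scale c x).
  have := is_deriveM (is_derive_cst (c ^+ n) x (1 : R)) he.
  move/is_derive_eq; apply.
  by rewrite scaler0 addr0 /phi exprS /GRing.scale /=; ring.
have := smooth_on_comp dphi 0 oA sP (fun _ _ => I).
apply: smooth_on_ext => // p _.
by rewrite /phi /= expr0 mul1r.
Qed.

End Wirtinger.

(** * Bump functions *)

Section FlatFunction.
Variable R : realType.
Implicit Types (p : {poly R}) (x y : R).

Lemma expr_le_expR n y : 0 <= y -> y ^+ n <= n`!%:R * expR y.
Proof.
move=> y0; case: n => [|n].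
  by rewrite expr0 fact0 mul1r -expR0 ler_expR.
have := expR_ge1Dxn n y0; rewrite -(@ler_pM2l _ n.+1`!%:R) ?ltr0n ?fact_gt0//.
by apply: le_trans; rewrite mulrDr mulr1 mulrCA divff ?mulr1 ?lerDr.
Qed.

Lemma poly_expRN_bounded p :
  exists2 C, 0 <= C & forall y, 0 < y -> `|p.[y] * expR (- y)| <= C.
Proof.
elim/poly_ind: p => [|p c _].
  by exists 0 => // y _; rewrite horner0 mul0r normr0.
pose q := p * 'X + c%:P; exists (\sum_(i < size q) `|q`_i| * i`!%:R).
  by apply: sumr_ge0 => i _; rewrite mulr_ge0.
move=> y y0; rewrite horner_coef mulr_suml (le_trans (ler_norm_sum _ _ _))//.
apply: ler_sum => i _; rewrite -mulrA normrM; apply: ler_wpM2l => //.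
rewrite normrM !ger0_norm ?expR_ge0 ?exprn_ge0 ?(ltW y0)//.
by rewrite expRN ler_pdivrMr ?expR_gt0// expr_le_expR// ltW.
Qed.

(** The functions p(1/x) exp(-1/x), extended by 0 to x <= 0. They form a class
stable under derivation: p becomes (p - p') X^2. *)
Definition flat p x : R := if 0 < x then p.[x^-1] * expR (- x^-1) else 0.

(** The quadratic bound makes the derivative at 0, the only delicate point,
equal to 0. *)
Lemma flat_quadratic p : exists2 C, 0 <= C & forall x, `|flat p x| <= C * x ^+ 2.
Proof.
have [C C0 HC] := poly_expRN_bounded (p * 'X * 'X); exists C => // x.
rewrite /flat; case: ifPn => x0; last by rewrite normr0 mulr_ge0// sqr_ge0.
have := HC x^-1; rewrite invr_gt0 => /(_ x0); rewrite !hornerMX.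
rewrite -ler_pdivrMr ?exprn_gt0//; apply: le_trans.
rewrite le_eqVlt; apply/orP; left; apply/eqP.
rewrite -[X in _ / X]ger0_norm ?sqr_ge0// -normfV -normrM expr2 invfM.
by congr (`|_|); ring.
Qed.

Lemma is_derive_quadratic (f : R -> R) C : (forall x, `|f x| <= C * x ^+ 2) ->
  is_derive (0 : R) (1 : R) f 0.
Proof.
move=> fC.
have f0 : f 0 = 0.
  by apply/eqP; rewrite -normr_le0 (le_trans (fC 0))// expr0n/= mulr0.
have C0 : 0 <= C by have := le_trans (normr_ge0 _) (fC 1); rewrite expr1n mulr1.
have cv : (fun h => h^-1 *: ((f \o shift 0) (h *: 1) - f 0)) @ 0^' --> (0 : R).
  apply/cvgrPdist_le => e e0; near=> h.
  have h0 : h != 0 by near: h; exact: nbhs_dnbhs_neq.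
  rewrite sub0r normrN f0 subr0 /= addr0 [_%:A]mulr1 normrZ normfV.
  rewrite ler_pdivrMl ?normr_gt0// (le_trans (fC h))//.
  rewrite -[h ^+ 2]ger0_norm ?sqr_ge0// normrX expr2 mulrCA ler_wpM2l//.
  have : `|h| < e / (C + 1).
    by near: h; apply: dnbhs0_lt; rewrite divr_gt0// ltr_wpDl.
  rewrite ltr_pdivlMr ?ltr_wpDl// => /ltW; apply: le_trans.
  by rewrite mulrDr mulr1 mulrC lerDl.
by apply: DeriveDef; [apply/cvg_ex; exists 0|exact: cvg_lim cv].
Unshelve. all: by end_near. Qed.

Lemma is_derive_flat p x :
  is_derive x (1 : R) (flat p) (flat ((p - p^`()) * 'X * 'X) x).
Proof.
case: (ltgtP x 0) => [x0|x0|->].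
- rewrite /flat ltNge ltW//=.
  have : is_derive x (1 : R) (cst (0 : R)) 0 by exact: is_derive_cst.
  apply: near_eq_is_derive; near=> y.
  by rewrite /flat ltNge ltW//; near: y; exact: lt_nbhsl.
- have dinv : is_derive x (1 : R) (fun y => y^-1) (- x ^- 2).
    have := is_deriveV (lt0r_neq0 x0 : id x != 0) (is_derive_id x (1 : R)).
    by move/is_derive_eq; apply; rewrite [_ *: _]mulr1.
  have dE : is_derive x^-1 (1 : R) (fun y => expR (- 1 * y))
      (expR (- 1 * x^-1) * - 1).
    exact: is_derive1_comp (is_derive_expR _) (is_derive_scale (- 1) x^-1).
  have := is_derive1_comp (is_deriveM (is_derive_poly p x^-1) dE) dinv.
  rewrite /GRing.scale /= => /is_derive_eq D.
  rewrite {2}/flat x0.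
  have {}D := D (((p - p^`()) * 'X * 'X).[x^-1] * expR (- x^-1)).
  apply: (@near_eq_is_derive _ _ _ (fun y => p.[y^-1] * expR (- 1 * y^-1))).
    near=> y; rewrite /flat.
    have -> : 0 < y by near: y; exact: lt_nbhsr.
    by rewrite mulN1r.
  apply: D; rewrite !hornerMX hornerD hornerN mulN1r -exprVn.
  by ring.
- rewrite {2}/flat ltxx; have [C _ HC] := flat_quadratic p.
  exact: is_derive_quadratic HC.
Unshelve. all: by end_near. Qed.

Lemma smooth_flat p : smooth_on setT (flat p).
Proof.
apply: (@smooth_coind _ _ _ (fun f => exists p, f = flat p)) => //; last first.
- by exists p.
- move=> f v [{}p ->]; exists (flat (v *: ((p - p^`()) * 'X * 'X))).
    by exists (v *: ((p - p^`()) * 'X * 'X)).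
  move=> x _; have [_] := is_derive_comp1 (is_derive_id x v) (is_derive_flat p x).
  rewrite [X in 'D_v X _](_ : _ = flat p)// => ->.
  rewrite /flat; case: ifPn => _; last by rewrite mul0r.
  by rewrite hornerZ; ring.
- move=> f [{}p ->] x _; split.
    apply/differentiable_continuous/derivable1_diffP.
    by have [] := is_derive_flat p x.
  move=> v.
  by have [] := is_derive_comp1 (is_derive_id x v) (is_derive_flat p x).
- exact: openT.
Qed.

(** The successive derivatives of x^-1, for composition with a positive smooth
denominator. *)
Definition inv_family (n : nat) x : R := (- 1) ^+ n * n`!%:R * x^-1 ^+ n.+1.

Lemma is_derive_inv_family n x : 0 < x ->
  is_derive x (1 : R) (inv_family n) (inv_family n.+1 x).
Proof.
move=> x0; have xN0 : x != 0 by rewrite gt_eqF.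
have dinv : is_derive x (1 : R) (fun y => y^-1) (- x ^- 2).
  have := is_deriveV (lt0r_neq0 x0 : id x != 0) (is_derive_id x (1 : R)).
  by move/is_derive_eq; apply; rewrite [_ *: _]mulr1.
have dX := is_deriveX n.+1 dinv.
have := is_deriveM (is_derive_cst ((- 1) ^+ n * n`!%:R : R) x (1 : R)) dX.
rewrite (_ : _ * _ = inv_family n); last first.
  by apply/funext => y; rewrite /inv_family !fctE.
move/is_derive_eq; apply; rewrite scaler0 addr0 /inv_family /GRing.scale /=.
by rewrite -exprVn factS natrM !exprS; ring.
Qed.

Definition flat1 := flat 1.

Lemma flat1_ge0 x : 0 <= flat1 x.
Proof. by rewrite /flat1 /flat; case: ifP => // _; rewrite hornerC mul1r expR_ge0. Qed.

Lemma flat1_gt0 x : 0 < x -> 0 < flat1 x.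
Proof. by rewrite /flat1 /flat => ->; rewrite hornerC mul1r expR_gt0. Qed.

Lemma flat1_le0 x : x <= 0 -> flat1 x = 0.
Proof. by rewrite /flat1 /flat ltNge => ->. Qed.

Lemma flat1D_gt0 x : 0 < flat1 x + flat1 (1 - x).
Proof.
have [x0|x0] := ltP 0 x; first by rewrite ltr_pwDl ?flat1_ge0// flat1_gt0.
by rewrite ltr_wpDl ?flat1_ge0// flat1_gt0//; lra.
Qed.

Definition smooth_step x : R := flat1 x / (flat1 x + flat1 (1 - x)).

(** The argument of the step is at least 1 for |x| <= e and at most 0 for
2 e <= |x|. *)
Definition bump (e x : R) : R := smooth_step ((4 * e ^+ 2 - x ^+ 2) / (3 * e ^+ 2)).

Lemma bump_ge0 e x : 0 <= bump e x.
Proof. by rewrite divr_ge0 ?flat1_ge0// ltW// flat1D_gt0. Qed.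

Lemma bump1 e x : 0 < e -> `|x| <= e -> bump e x = 1.
Proof.
move=> e0 xe; have x2 : x ^+ 2 <= e ^+ 2.
  by rewrite -[x ^+ 2]real_normK ?num_real// lerXn2r ?nnegrE// ltW.
rewrite /bump /smooth_step; set y := (_ - _) / _.
have y1 : 1 <= y by rewrite ler_pdivlMr ?mulr_gt0 ?exprn_gt0//; lra.
rewrite (@flat1_le0 (1 - y)) ?addr0 ?divff//; last by lra.
by rewrite gt_eqF// flat1_gt0//; lra.
Qed.

Lemma bump0 e x : 0 < e -> 2 * e <= `|x| -> bump e x = 0.
Proof.
move=> e0 xe; have x2 : 4 * e ^+ 2 <= x ^+ 2.
  rewrite -[x ^+ 2]real_normK ?num_real// -[4]/(2 ^ 2)%:R natrX -exprMn.
  by rewrite lerXn2r ?nnegrE// mulr_ge0// ltW.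
rewrite /bump /smooth_step flat1_le0 ?mul0r// pmulr_lle0 ?invr_gt0; first lra.
by rewrite mulr_gt0// exprn_gt0.
Qed.

Lemma smooth_bump e : smooth_on setT (bump e).
Proof.
have oT := @openT R.
have sid : smooth_on setT (id : R -> R).
  apply: smooth_on_linear => // x; exact: cvg_id.
have sflat := smooth_flat 1.
have sstep : smooth_on setT smooth_step.
  have s1 : smooth_on setT (fun x : R => 1 - x).
    exact: smooth_onD oT (smooth_on_cst 1 oT) (smooth_onN oT sid).
  have fam (n : nat) (x : R) : setT x ->
      is_derive x (1 : R) ((fun n : nat => flat (iter n (fun p => (p - p^`()) * 'X * 'X) 1)) n)
        (flat (iter n.+1 (fun p => (p - p^`()) * 'X * 'X) 1) x).
    by move=> _; exact: is_derive_flat.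
  have s2 : smooth_on setT (fun x : R => flat1 (1 - x)).
    exact: (smooth_on_comp fam 0 oT s1 (fun _ _ => I)).
  have s3 := smooth_on_comp is_derive_inv_family 0 oT (smooth_onD oT sflat s2)
    (fun x _ => flat1D_gt0 x).
  have := smooth_onM oT sflat s3; apply: smooth_on_ext => // x _.
  by rewrite /smooth_step /inv_family /= expr0 !fctE /= mulr1 mul1r.
have s4 : smooth_on setT (fun x : R => (4 * e ^+ 2 - x ^+ 2) / (3 * e ^+ 2)).
  have := smooth_onM oT (smooth_onD oT (smooth_on_cst (4 * e ^+ 2) oT)
    (smooth_onN oT (smooth_onM oT sid sid))) (smooth_on_cst (3 * e ^+ 2)^-1 oT).
  by apply: smooth_on_ext => // x _; rewrite /= !fctE expr2.
pose fam (n : nat) := iter n (fun f : R -> R => 'D_1 f) smooth_step.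
have sfam n : smooth_on setT (fam n).
  by elim: n => [//|n ih]; exact: smooth_on_derive.
have dfam n (x : R) : setT x -> is_derive x (1 : R) (fam n) (fam n.+1 x).
  by move=> _; apply: derivableP; have [_] := sfam n [::] x I; exact.
exact: (smooth_on_comp dfam 0 oT s4 (fun _ _ => I)).
Qed.

End FlatFunction.

(** * Mean values, mixed derivatives and growth from the gradient *)

Section PlaneModulus.
Variable R : realType.
Implicit Types (z : R * R) (r : R).

Lemma cabsE z : cabs z = Num.sqrt (z.1 ^+ 2 + z.2 ^+ 2).
Proof. by []. Qed.

Lemma cabs_sqr z : cabs z ^+ 2 = z.1 ^+ 2 + z.2 ^+ 2.
Proof. by rewrite cabsE sqr_sqrtr// addr_ge0 ?sqr_ge0. Qed.

Lemma cabs_even z n : cabs z ^+ (2 * n) = (z.1 ^+ 2 + z.2 ^+ 2) ^+ n.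
Proof. by rewrite exprM cabs_sqr. Qed.

Lemma cabs_ge0 z : 0 <= cabs z. Proof. exact: sqrtr_ge0. Qed.

Lemma le_cabs1 z : `|z.1| <= cabs z.
Proof. by rewrite cabsE -sqrtr_sqr ler_sqrt ?lerDl ?addr_ge0 ?sqr_ge0. Qed.

Lemma le_cabs2 z : `|z.2| <= cabs z.
Proof. by rewrite cabsE -sqrtr_sqr ler_sqrt ?lerDr ?addr_ge0 ?sqr_ge0. Qed.

Lemma cabs_le z z' : `|z.1| <= `|z'.1| -> `|z.2| <= `|z'.2| -> cabs z <= cabs z'.
Proof.
move=> h1 h2; rewrite !cabsE ler_wsqrtr//.
by rewrite -!(@real_normK _ _.1) ?num_real// -!(@real_normK _ _.2) ?num_real//
  lerD// lerXn2r ?nnegrE.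
Qed.

Lemma cabs_gt0 z : z != (0, 0) -> 0 < cabs z.
Proof.
case: z => x y; rewrite xpair_eqE negb_and cabsE sqrtr_gt0 /= => xy.
rewrite lt0r addr_ge0 ?sqr_ge0// andbT paddr_eq0 ?sqr_ge0// !sqrf_eq0.
by rewrite negb_and.
Qed.

Lemma cabs_evenC z n : ((cabs z ^+ (2 * n))%:C : R[i]) = toC z ^+ n * (toC z)^*%C ^+ n.
Proof.
rewrite cabs_even -exprMn realcX; congr (_ ^+ _).
by case: z => x y; apply: complex_eqP => /=; ring.
Qed.

Definition in_box r z := `|z.1| <= r /\ `|z.2| <= r.

Lemma nbhs_box (A : set (R * R)) : nbhs ((0, 0) : R * R) A ->
  exists2 r, 0 < r & forall z, in_box r z -> A z.
Proof.
move=> /nbhs_ballP[e /= e0 he]; exists (e / 2); first by rewrite divr_gt0.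
move=> [x y] [/= xe ye]; apply: he; split => /=; rewrite /ball /= sub0r normrN.
  by apply: le_lt_trans xe _; rewrite ltr_pdivrMr// ltr_pMr// ltr1n.
by apply: le_lt_trans ye _; rewrite ltr_pdivrMr// ltr_pMr// ltr1n.
Qed.

End PlaneModulus.

Section Lines.
Variable R : realType.
Implicit Types (F : R * R -> R) (x y : R).

Lemma is_derive_curve F (c : R -> R * R) v t :
  (forall h, c (h *: (1 : R) + t) = h *: v + c t) -> derivable F (c t) v ->
  is_derive t (1 : R) (fun t => F (c t)) ('D_v F (c t)).
Proof.
move=> cE d.
have E : (fun h : R => h^-1 *: (((fun t => F (c t)) \o shift t) (h *: (1 : R)) - F (c t)))
  = (fun h : R => h^-1 *: ((F \o shift (c t)) (h *: v) - F (c t))).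
  by apply/funext => h /=; rewrite cE.
by apply: DeriveDef; rewrite /derivable /derive /= E.
Qed.

Lemma is_derive_horizontal F x y : derivable F (x, y) (1, 0) ->
  is_derive x (1 : R) (fun t => F (t, y)) ('D_(1, 0) F (x, y)).
Proof.
apply: (@is_derive_curve F (fun t => (t, y))) => h.
by apply: injective_projections => /=; rewrite // scaler0 add0r.
Qed.

Lemma is_derive_vertical F x y : derivable F (x, y) (0, 1) ->
  is_derive y (1 : R) (fun t => F (x, t)) ('D_(0, 1) F (x, y)).
Proof.
apply: (@is_derive_curve F (fun t => (x, t))) => h.
by apply: injective_projections => /=; rewrite // scaler0 add0r.
Qed.

Lemma mvt_segment (f df : R -> R) (a b : R) : a < b ->
  (forall t, a <= t <= b -> is_derive t (1 : R) f (df t)) ->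
  exists2 c, a <= c <= b & f b - f a = df c * (b - a).
Proof.
move=> ab d; have := @MVT_segment R f df a b (ltW ab).
case.
- by move=> x /[!in_itv]/= /andP[? ?]; apply: d; rewrite !ltW.
- apply: derivable_within_continuous => x /[!in_itv]/= xab.
  by have [] := d x xab.
- by move=> c /[!in_itv]/= cab E; exists c.
Qed.

Lemma mvt_from0 (f df : R -> R) (a : R) :
  (forall t, `|t| <= `|a| -> is_derive t (1 : R) f (df t)) ->
  exists2 c, `|c| <= `|a| & f a - f 0 = df c * a.
Proof.
move=> d; have [a0|a0|a0] := ltgtP a 0.
- have [|c /andP[c1 c2] E] := @mvt_segment f df a 0 a0.
    move=> t /andP[t1 t2]; apply: d.
    by rewrite !ler0_norm ?lerN2// (le_trans t1).
  exists c; first by rewrite !ler0_norm ?lerN2// (le_trans c1).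
  by rewrite -opprB E sub0r mulrN opprK.
- have [|c /andP[c1 c2] E] := @mvt_segment f df 0 a a0.
    move=> t /andP[t1 t2]; apply: d.
    by rewrite !ger0_norm// (le_trans t1).
  exists c; first by rewrite !ger0_norm// (le_trans c1).
  by rewrite E subr0.
- by exists 0; rewrite a0 ?normr0// subrr mulr0.
Qed.

End Lines.

Section MixedDerivatives.
Variables (R : realType) (U : set (R * R)) (F : R * R -> R).
Hypothesis oU : open U.
Hypothesis sF : smooth_on U F.
Let Fx : R * R -> R := 'D_(1, 0) F.
Let Fy : R * R -> R := 'D_(0, 1) F.

(** The second difference of F on a square equals r^2 times either mixed
derivative at some point, by two applications of the mean value theorem in
either order. *)
Lemma second_difference (r x y : R) : 0 < r ->
  (forall z, x <= z.1 <= x + r -> y <= z.2 <= y + r -> U z) ->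
  exists z z' : R * R, [/\ x <= z.1 <= x + r /\ y <= z.2 <= y + r,
    x <= z'.1 <= x + r /\ y <= z'.2 <= y + r &
    'D_(0, 1) Fx z = 'D_(1, 0) Fy z'].
Proof.
move=> r0 box.
have cancel_sqr (p q s t A B : R) : p - q - (s - t) = A * r * r ->
    p - s - (q - t) = B * r * r -> A = B.
  move=> hA hB; have rN0 : r != 0 by rewrite gt_eqF.
  by apply: (mulIf rN0); apply: (mulIf rN0); rewrite -hA -hB; ring.
have dU (u : R * R -> R) z v : smooth_on U u -> U z -> derivable u z v.
  by move=> su Uz; have [_] := su [::] z Uz; exact.
have sFx : smooth_on U Fx by exact: smooth_on_derive.
have sFy : smooth_on U Fy by exact: smooth_on_derive.
have xr : x < x + r by rewrite ltrDl.
have yr : y < y + r by rewrite ltrDl.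
have x1 : x <= x <= x + r by rewrite lexx ltW.
have x2 : x <= x + r <= x + r by rewrite lexx ltW.
have y1 : y <= y <= y + r by rewrite lexx ltW.
have y2 : y <= y + r <= y + r by rewrite lexx ltW.
have [|a ax E1] := @mvt_segment _ (fun t => F (t, y + r) - F (t, y))
    (fun t => Fx (t, y + r) - Fx (t, y)) _ _ xr.
  by move=> t tx; apply: is_deriveB; apply: is_derive_horizontal;
    apply: dU sF _; exact: box.
have [|b by_ E2] := @mvt_segment _ (fun t => Fx (a, t))
    (fun t => 'D_(0, 1) Fx (a, t)) _ _ yr.
  by move=> t ty; apply: is_derive_vertical; apply: dU sFx _; exact: box.
have [|c cy E3] := @mvt_segment _ (fun t => F (x + r, t) - F (x, t))
    (fun t => Fy (x + r, t) - Fy (x, t)) _ _ yr.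
  by move=> t ty; apply: is_deriveB; apply: is_derive_vertical;
    apply: dU sF _; exact: box.
have [|d dx E4] := @mvt_segment _ (fun t => Fy (t, c))
    (fun t => 'D_(1, 0) Fy (t, c)) _ _ xr.
  by move=> t tx; apply: is_derive_horizontal; apply: dU sFy _; exact: box.
exists (a, b), (d, c); split; [exact: conj ax by_|exact: conj dx cy|].
move: E1 E3; rewrite E2 E4 ![_ + r - _]addrAC !subrr !add0r; exact: cancel_sqr.
Qed.

Lemma mixed_derivatives p : U p -> 'D_(0, 1) Fx p = 'D_(1, 0) Fy p.
Proof.
move=> Up; apply/eqP; rewrite -subr_eq0 -normr_le0; apply/ler_addgt0Pl => e e0.
rewrite addr0.
have e2 : 0 < e / 2 by rewrite divr_gt0.
have near_eq (a b c : R) : `|a - c| <= e / 2 -> `|b - c| <= e / 2 -> `|a - b| <= e.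
  by rewrite !ler_norml; lra.
have near_p (u : R * R -> R) : {for p, continuous u} ->
    \forall z \near p, `|u p - u z| <= e / 2.
  by move=> /cvgrPdist_le; exact.
have cA := near_p ('D_(0, 1) Fx) (sF [:: (0, 1); (1, 0)] Up).1.
have cB := near_p ('D_(1, 0) Fy) (sF [:: (1, 0); (0, 1)] Up).1.
have nU : \forall z \near p, U z by exact: open_nbhs_nbhs.
have near3 := filterS3 _ (fun z a b c => And3 a b c) nU cA cB.
have /nbhs_ballP[d /= d0 H] := near3 (nbhs_filter p).
have d2 : 0 < d / 2 by rewrite divr_gt0.
case: p {Up cA cB nU near_p near3} H => x y H.
have in_ball (z : R * R) : x <= z.1 <= x + d / 2 -> y <= z.2 <= y + d / 2 ->
    ball (x, y) d z.
  by move=> zx zy; split; rewrite /ball /= ltr_norml; apply/andP; split; lra.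
have [z [z' [[z1 z2] [z1' z2'] E]]] := second_difference d2
  (fun z zx zy => let: And3 Uz _ _ := H z (in_ball z zx zy) in Uz).
have [_ A _] := H _ (in_ball _ z1 z2); have [_ _ B] := H _ (in_ball _ z1' z2').
rewrite -E in B; exact: near_eq A B.
Qed.

Lemma wirt_real_parts (f : R * R -> R) z :
  'D_(1, 0) f z = 2 * complex.Re (d_z (fun w => (f w)%:C) z) /\
  'D_(0, 1) f z = - (2 * complex.Im (d_z (fun w => (f w)%:C) z)).
Proof.
rewrite /d_z !cderive_real complex_half /=.
by split; field.
Qed.

(** Up to the factor 1/4 the real part is the Laplacian of F, and the imaginary
part is the difference of the two mixed derivatives. *)
Lemma Im_laplacian z : U z ->
  complex.Im (d_zbar (d_z (fun w => (F w)%:C)) z) = 0.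
Proof.
move=> Uz.
have dU v (u : R * R -> R) : smooth_on U u -> derivable u z v.
  by move=> su; have [_] := su [::] z Uz; exact.
have dx : derivable Fx z (0, 1) by apply: dU; exact: smooth_on_derive.
have dy : derivable Fy z (1, 0) by apply: dU; exact: smooth_on_derive.
have ReE : (fun y => complex.Re (d_z (fun w => (F w)%:C) y)) = 2^-1 *: Fx.
  by apply/funext => y; rewrite fctE /Fx (wirt_real_parts F y).1 [RHS]mulKf.
have ImE : (fun y => complex.Im (d_z (fun w => (F w)%:C) y)) = - 2^-1 *: Fy.
  apply/funext => y; rewrite fctE /Fy (wirt_real_parts F y).2.
  by rewrite [RHS]mulrNN mulKf.
have h1 : complex.Re (cderive ((0, 1) : R * R) (d_z (fun w => (F w)%:C)) z) = 2^-1 * 'D_(0, 1) Fx z.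
  exact: (etrans (congr1 (fun u => 'D_(0, 1) u z) ReE) (deriveZ _ dx)).
have h2 : complex.Im (cderive ((1, 0) : R * R) (d_z (fun w => (F w)%:C)) z) = - 2^-1 * 'D_(1, 0) Fy z.
  exact: (etrans (congr1 (fun u => 'D_(1, 0) u z) ImE) (deriveZ _ dy)).
have E (u v : R[i]) : complex.Im (2^-1 * (u + 'i%C * v)) =
    2^-1 * (complex.Im u + complex.Re v).
  by rewrite complex_half ImM ImD ImM /=; ring.
apply: (etrans (E _ _)); rewrite h1 h2 (mixed_derivatives Uz).
by rewrite mulNr addNr mulr0.
Qed.

End MixedDerivatives.

Section GradientField.
Variables (R : realType) (n : nat) (F p q : R * R -> R) (r : R).
Implicit Types z : R * R.
Let w z := cabs z ^+ (2 * n).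
Hypothesis r0 : 0 < r.
Hypothesis dF : forall z v, in_box r z -> derivable F z v.
Hypothesis dxF : forall z, in_box r z ->
  'D_(1, 0) F z = 2 * w z * (z.1 * p z + z.2 * q z).
Hypothesis dyF : forall z, in_box r z ->
  'D_(0, 1) F z = - (2 * w z * (z.1 * q z - z.2 * p z)).

(** Mean value theorem along a horizontal and then a vertical segment; the
factor 6 comes from the three terms of size 2 eps |z|^(2n+2) that result. *)
Lemma gradient_growth eps :
  (forall z, in_box r z -> `|p z| <= eps /\ `|q z| <= eps) ->
  forall z, in_box r z -> `|F z - F (0, 0)| <= 6 * eps * cabs z ^+ (2 * n.+1).
Proof.
move=> pq [x y] [/= xr yr].
have e0 : 0 <= eps.
  have [] := pq (0, 0); first by split; rewrite /= normr0 ltW.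
  by move/(le_trans (normr_ge0 _)).
have [|c cx E1] := @mvt_from0 _ (fun t => F (t, 0)) (fun t => 'D_(1, 0) F (t, 0)) x.
  move=> t tx; apply: is_derive_horizontal; apply: dF; split => /=.
    exact: le_trans xr.
  by rewrite normr0 ltW.
have [|d dy E2] := @mvt_from0 _ (fun t => F (x, t)) (fun t => 'D_(0, 1) F (x, t)) y.
  move=> t ty; apply: is_derive_vertical; apply: dF; split => //=.
  exact: le_trans yr.
have cb : in_box r (c, 0).
  by split => /=; [exact: le_trans xr|rewrite normr0 ltW].
have db : in_box r (x, d) by split => //=; exact: le_trans yr.
have -> : F (x, y) - F (0, 0) = (F (x, y) - F (x, 0)) + (F (x, 0) - F (0, 0)) by ring.
rewrite E1 E2 dxF// dyF//= (le_trans (ler_normD _ _))//.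
set Z := cabs (x, y).
have Z0 : 0 <= Z by exact: cabs_ge0.
have wle z : `|z.1| <= `|x| -> `|z.2| <= `|y| -> 0 <= w z <= Z ^+ (2 * n).
  move=> h1 h2; rewrite /w exprn_ge0 ?cabs_ge0//=.
  by rewrite lerXn2r ?nnegrE ?cabs_ge0// cabs_le.
have xZ : `|x| <= Z by exact: le_cabs1 (x, y).
have yZ : `|y| <= Z by exact: le_cabs2 (x, y).
have [p1 q1] := pq _ cb; have [p2 q2] := pq _ db.
have term (u s t e : R) : 0 <= u <= Z ^+ (2 * n) -> `|s| <= Z -> `|t| <= Z ->
    `|e| <= eps -> `|2 * u * (s * e) * t| <= 2 * eps * Z ^+ (2 * n.+1).
  move=> /andP[u0 u1] s1 t1 e1.
  have -> : 2 * eps * Z ^+ (2 * n.+1) = 2 * Z ^+ (2 * n) * (Z * eps) * Z.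
    by rewrite mulnS exprD expr2; ring.
  rewrite !normrM (ger0_norm u0) (ger0_norm (_ : 0 <= 2))//.
  by rewrite !ler_pM ?mulr_ge0 ?exprn_ge0.
have := term (w (c, 0)) c x (p (c, 0)).
rewrite wle ?normr0// => /(_ isT (le_trans cx xZ) xZ p1) T1.
have := term (w (x, d)) x y (q (x, d)).
rewrite wle// => /(_ isT xZ yZ q2) T2.
have := term (w (x, d)) d y (p (x, d)).
rewrite wle// => /(_ isT (le_trans dy yZ) yZ p2) T3.
rewrite mul0r addr0.
have -> : - (2 * w (x, d) * (x * q (x, d) - d * p (x, d))) * y =
  2 * w (x, d) * (d * p (x, d)) * y - 2 * w (x, d) * (x * q (x, d)) * y by ring.
have := ler_normB (2 * w (x, d) * (d * p (x, d)) * y) (2 * w (x, d) * (x * q (x, d)) * y).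
lra.
Qed.

End GradientField.

(** * The phase is comparable with a power of the modulus *)

Section NormcFacts.
Variable R : realType.
Implicit Types x y : R[i].
Notation normc := Normc.normc.

Lemma normcE2 x : normc x = Num.sqrt (complex.Re x ^+ 2 + complex.Im x ^+ 2).
Proof. by case: x. Qed.

Lemma normc_ge0 x : 0 <= normc x. Proof. by rewrite normcE2 sqrtr_ge0. Qed.

Lemma normc_real (a : R) : normc a%:C = `|a|.
Proof. by rewrite normcE2 /= expr0n addr0 sqrtr_sqr. Qed.

Lemma ge_Re_normc x : `|complex.Re x| <= normc x.
Proof. by rewrite normcE2 -sqrtr_sqr ler_sqrt ?lerDl ?addr_ge0 ?sqr_ge0. Qed.

Lemma ge_Im_normc x : `|complex.Im x| <= normc x.
Proof. by rewrite normcE2 -sqrtr_sqr ler_sqrt ?lerDr ?addr_ge0 ?sqr_ge0. Qed.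

Lemma normc_le_parts x : normc x <= `|complex.Re x| + `|complex.Im x|.
Proof.
rewrite normcE2 -[leRHS]ger0_norm ?addr_ge0// -sqrtr_sqr ler_wsqrtr//.
rewrite sqrrD !real_normK ?num_real// lerD2r lerDl mulrn_wge0// mulr_ge0//.
Qed.

Lemma normcJ x : normc (conjc x) = normc x.
Proof. by case: x => a b; rewrite !normcE2 /= sqrrN. Qed.

Lemma le_normc_D x y : normc (x + y) <= normc x + normc y.
Proof. exact: le_normcD. Qed.

Lemma le_normc_sum n (F : 'I_n -> R[i]) :
  normc (\sum_i F i) <= \sum_i normc (F i).
Proof.
elim/big_ind2 : _ => [|a b c d h1 h2|//]; first by rewrite Normc.normc0.
by rewrite (le_trans (le_normc_D _ _))// lerD.
Qed.

Lemma realc_neq0 (a : R) : a != 0 -> a%:C != 0 :> R[i].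
Proof. by move=> a0; rewrite eq_complex /= negb_and a0. Qed.

Lemma natrc n : (n%:R : R[i]) = (n%:R)%:C.
Proof. by elim: n => // n ih; rewrite -!natr1 ih realcD. Qed.

End NormcFacts.

Section PhaseEstimates.
Variables (R : realType) (n : nat) (U : set (R * R)) (F : R * R -> R).
Variables (g h : R * R -> R[i]).
Notation normc := Normc.normc.
Hypothesis oU : open U.
Hypothesis U0 : U (0, 0).
Hypothesis sF : smooth_on U F.
Hypothesis sg : csmooth_on U g.
Hypothesis sh : csmooth_on U h.
Hypothesis F_zzbar : forall z, U z ->
  d_zbar (d_z (fun w => (F w)%:C)) z = (cabs z ^+ (2 * n))%:C * g z.
Hypothesis F_z : forall z, U z ->
  d_z (fun w => (F w)%:C) z = ((toC z)^*)%C * (cabs z ^+ (2 * n))%:C * h z.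
Hypothesis g0 : g (0, 0) != 0.

Let cconj (z : R * R) := ((toC z)^*)%C.

Lemma csmooth_sub A (f : R * R -> R[i]) : csmooth_on setT f -> csmooth_on A f.
Proof. by move=> [a b]; split; [exact: smooth_on_sub a|exact: smooth_on_sub b]. Qed.

Lemma wirt_conj_zbar z : wirt 'i%C (fun y => ((toC y)^*)%C) z = 1 :> R[i].
Proof.
rewrite (wirtJ 'i%C (I : setT z) (@csmooth_toC R)).
rewrite (_ : conjc 'i%C = - 'i%C :> R[i]); last by apply: complex_eqP => /=; ring.
by rewrite wirt_toC_z; apply: complex_eqP => /=; ring.
Qed.

(** Since F_z = z^n zbar^(n+1) h, the derivative F_zzbar is
|z|^2n ((n+1) h + zbar h_zbar); the common factor |z|^2n is cancelled away from
the origin. *)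
Lemma g_of_h z : U z -> z != (0, 0) ->
  g z = n.+1%:R * h z + cconj z * wirt 'i%C h z.
Proof.
move=> Uz z0.
have st : csmooth_on U (@toC R) by exact: csmooth_sub (@csmooth_toC R).
have sc : csmooth_on U cconj by exact: csmooth_onJ.
have E y : U y -> d_z (fun w => (F w)%:C) y = cconj y ^+ n.+1 * (toC y ^+ n * h y).
  by move=> Uy; rewrite F_z// cabs_evenC exprS; ring.
have := F_zzbar Uz; rewrite d_zbarE (eq_on_wirt _ oU E Uz).
rewrite (wirtM _ Uz (csmooth_onX n.+1 oU sc) (csmooth_onM oU (csmooth_onX n oU st) sh)).
rewrite (wirtM _ Uz (csmooth_onX n oU st) sh).
rewrite (wirtX _ Uz oU n st) (wirtX _ Uz oU n.+1 sc) wirt_conj_zbar wirt_toC_zbar.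
rewrite mulr0 mul0r add0r mulr1 cabs_evenC -/(cconj z) /= => H.
have nz : toC z ^+ n * cconj z ^+ n != 0.
  rewrite -cabs_evenC; apply: realc_neq0.
  by rewrite expf_neq0// gt_eqF// cabs_gt0.
by apply: (mulfI nz); rewrite -H exprS; ring.
Qed.

Lemma continuous_zero_limit (f : R * R -> R) : {for (0, 0), continuous f} ->
  (\forall z \near ((0, 0) : R * R), z != (0, 0) -> f z = 0) -> f (0, 0) = 0.
Proof.
move=> cf /nbhs_box[r r0 fr]; apply/eqP; apply: contraT => f0.
have /cf : nbhs (f (0, 0)) [set y | y != 0] by exact: open_nbhs_nbhs (conj (@open_neq _ 0) f0).
move=> /nbhs_box[e e0 he]; pose d := Num.min e r.
have d0 : 0 < d by rewrite lt_min e0.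
have db e' : d <= e' -> in_box e' (d, 0).
  by move=> de; split; rewrite /= ?normr0 ?gtr0_norm// (le_trans (ltW d0)).
have fd : f (d, 0) = 0.
  by apply: fr; [apply: db; rewrite ge_min lexx orbT|rewrite xpair_eqE gt_eqF].
have := he (d, 0) (db _ _); rewrite /= fd eqxx; apply.
by rewrite ge_min lexx.
Qed.

(** The identity off the origin extends to the origin by continuity. *)
Lemma g0_of_h0 : g (0, 0) = n.+1%:R * h (0, 0).
Proof.
pose D z := g z + - (n.+1%:R) * h z + - cconj z * wirt 'i%C h z.
have sD : csmooth_on U D.
  apply: (csmooth_onD oU (csmooth_onD oU sg (csmooth_onM oU (csmooth_on_cst _ oU) sh))).
  apply: (csmooth_onM oU); last exact: csmooth_on_wirt.
  have sc : csmooth_on U cconj.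
    have st : csmooth_on U (@toC R) by exact: csmooth_sub (@csmooth_toC R).
    exact: csmooth_onJ.
  have := csmooth_onM oU (csmooth_on_cst (-1) oU) sc.
  by apply: csmooth_on_ext => // p _; rewrite mulN1r.
have D0 z : U z -> z != (0, 0) -> D z = 0.
  by move=> Uz z0; rewrite /D (g_of_h Uz z0); ring.
have nU : \forall z \near ((0, 0) : R * R), U z by exact: open_nbhs_nbhs.
have DE : D (0, 0) = 0.
  have [[cr _] [ci _]] := (sD.1 [::] _ U0, sD.2 [::] _ U0).
  apply: complex_eqP.
    apply: (continuous_zero_limit (f := fun z => complex.Re (D z)) cr).
    by near=> z => z0; rewrite D0//; near: z.
  apply: (continuous_zero_limit (f := fun z => complex.Im (D z)) ci).
  by near=> z => z0; rewrite D0//; near: z.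
move: DE; rewrite /D /cconj /toC /= oppr0.
rewrite (_ : - (0 +i* 0) = 0); last by apply: complex_eqP => /=; rewrite oppr0.
by rewrite mul0r addr0 mulNr => /eqP; rewrite subr_eq0 => /eqP.
Unshelve. all: by end_near. Qed.

Lemma derivable_smooth_on A (f : R * R -> R) z v : smooth_on A f -> A z ->
  derivable f z v.
Proof. by move=> sf Az; have [_] := sf [::] _ Az; exact. Qed.

Let a := complex.Re (h (0, 0)).
Let b := complex.Im (h (0, 0)).
Let p0 z := complex.Re (h z).
Let q0 z := complex.Im (h z).

Lemma partials_F z : U z ->
  'D_(1, 0) F z = 2 * cabs z ^+ (2 * n) * (z.1 * p0 z + z.2 * q0 z) /\
  'D_(0, 1) F z = - (2 * cabs z ^+ (2 * n) * (z.1 * q0 z - z.2 * p0 z)).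
Proof.
move=> Uz; have [-> ->] := wirt_real_parts F z; rewrite F_z//.
rewrite /p0 /q0; case: (h z) => u v; case: z Uz => x y _ /=.
set w := cabs _ ^+ _; by split; ring.
Qed.

Let N z : R := (z.1 ^+ 2 + z.2 ^+ 2) ^+ n.+1.

Lemma derive_N z v :
  is_derive z v N (n.+1%:R * (z.1 ^+ 2 + z.2 ^+ 2) ^+ n * (2 * (z.1 * v.1 + z.2 * v.2))).
Proof.
have d1 : is_derive z v (fst : R * R -> R) v.1.
  have := derivableP (derivable_smooth_on (v := v) (@smooth_fst R) (I : setT z)).
  by rewrite derive_coord.
have d2 : is_derive z v (snd : R * R -> R) v.2.
  have := derivableP (derivable_smooth_on (v := v) (@smooth_snd R) (I : setT z)).
  by rewrite derive_coord.
have := is_deriveX n.+1 (is_deriveD (is_deriveM d1 d1) (is_deriveM d2 d2)).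
rewrite (_ : (_ + _) ^+ n.+1 = N); last first.
  by apply/funext => y; rewrite /N !fctE !expr2.
by move/is_derive_eq; apply; rewrite !fctE /GRing.scale /= !expr2; ring.
Qed.

(* F minus its leading term, which is radial because h(0) will turn out
   to be real. Its gradient has the shape of the gradient of F, with h - a in
   place of h. *)
Let F1 z := F z + - (a / n.+1%:R) * N z.

Lemma is_derive_F1 z v : U z ->
  is_derive z v F1 ('D_v F z - 2 * a * (z.1 ^+ 2 + z.2 ^+ 2) ^+ n * (z.1 * v.1 + z.2 * v.2)).
Proof.
move=> Uz.
have dF : is_derive z v F ('D_v F z).
  by apply: derivableP; exact: derivable_smooth_on Uz.
have := is_deriveD dF (is_deriveM (is_derive_cst (- (a / n.+1%:R) : R) z v) (derive_N z v)).
move/is_derive_eq; apply; rewrite scaler0 addr0 /GRing.scale /=.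
by field; rewrite nat1r pnatr_eq0.
Qed.

Lemma partials_F1 z : U z ->
  'D_(1, 0) F1 z = 2 * cabs z ^+ (2 * n) * (z.1 * (p0 z - a) + z.2 * q0 z) /\
  'D_(0, 1) F1 z = - (2 * cabs z ^+ (2 * n) * (z.1 * q0 z - z.2 * (p0 z - a))).
Proof.
move=> Uz; have [_ ->] := is_derive_F1 (1, 0) Uz; have [_ ->] := is_derive_F1 (0, 1) Uz.
have [-> ->] := partials_F Uz; rewrite cabs_even /=; split; ring.
Qed.

Lemma near_parts eps : 0 < eps -> exists2 r, 0 < r & forall z, in_box r z ->
  [/\ U z, `|p0 z - a| <= eps & `|q0 z - b| <= eps].
Proof.
move=> e0; apply: nbhs_box.
have [[cr _] [ci _]] := (sh.1 [::] _ U0, sh.2 [::] _ U0).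
have /cvgrPdist_le/(_ _ e0) {}cr : p0 @ ((0, 0) : R * R) --> a by exact: cr.
have /cvgrPdist_le/(_ _ e0) {}ci : q0 @ ((0, 0) : R * R) --> b by exact: ci.
near=> z; split.
- by near: z; exact: open_nbhs_nbhs.
- by rewrite distrC; near: z.
- by rewrite distrC; near: z.
Unshelve. all: by end_near. Qed.

(** F being real, so is F_zzbar = |z|^2n g, hence g(0) by continuity, and
g(0) = (n+1) h(0). *)
Lemma Im_h0 : b = 0.
Proof.
have Img z : U z -> z != (0, 0) -> complex.Im (g z) = 0.
  move=> Uz z0; have := Im_laplacian oU sF Uz; rewrite F_zzbar// ImM mul0r addr0.
  move=> /eqP; rewrite mulf_eq0 => /orP[|/eqP//]; rewrite /= expf_eq0 => /andP[_].
  by rewrite gt_eqF// cabs_gt0.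
have [ci _] := sg.2 [::] _ U0.
have nU : \forall z \near ((0, 0) : R * R), U z by exact: open_nbhs_nbhs.
have : complex.Im (g (0, 0)) = 0.
  apply: (continuous_zero_limit (f := fun z => complex.Im (g z)) ci).
  by near=> z => z0; apply: Img z0; near: z.
rewrite g0_of_h0 natrc ImM mul0r addr0 => /eqP.
by rewrite mulf_eq0 pnatr_eq0 => /eqP.
Unshelve. all: by end_near. Qed.

Lemma Re_h0 : a != 0.
Proof.
apply: contra_neq g0 => a0; rewrite g0_of_h0.
rewrite (_ : h (0, 0) = 0) ?mulr0//; apply: complex_eqP; [exact: a0|exact: Im_h0].
Qed.

(** The leading term of F - F(0) is Re h(0) |z|^2m / m, and on a small box the
remainder is at most half of it. *)
Lemma phase_growth : exists (sigma c C r : R),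
  [/\ sigma = 1 \/ sigma = - 1, 0 < c, 0 <= C, 0 < r &
   forall z, in_box r z -> [/\ U z,
     c * cabs z ^+ (2 * n.+1) <= sigma * (F z - F (0, 0)) &
     `|F z - F (0, 0)| <= C * cabs z ^+ (2 * n.+1)]].
Proof.
have a0 : 0 < `|a| by rewrite normr_gt0 Re_h0.
pose K := `|a| / n.+1%:R.
have K0 : 0 < K by rewrite divr_gt0.
have e0 : 0 < K / 12 by rewrite divr_gt0.
have [r r0 Hr] := near_parts e0.
have sgE : Num.sg a = 1 \/ Num.sg a = - 1.
  have := Re_h0; case: (ltgtP a 0) => [an|ap|//] _.
    by right; exact: ltr0_sg.
  by left; exact: gtr0_sg.
exists (Num.sg a), (K / 2), (2 * K), r; split => //.
- by rewrite divr_gt0.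
- by rewrite mulr_ge0// ltW.
move=> z zr; have [Uz _ _] := Hr z zr.
have dF1 y v : in_box r y -> derivable F1 y v.
  by move=> /Hr[Uy _ _]; have [] := is_derive_F1 v Uy.
have dx y : in_box r y -> 'D_(1, 0) F1 y =
    2 * cabs y ^+ (2 * n) * (y.1 * (p0 y - a) + y.2 * q0 y).
  by move=> /Hr[Uy _ _]; exact: (partials_F1 Uy).1.
have dy y : in_box r y -> 'D_(0, 1) F1 y =
    - (2 * cabs y ^+ (2 * n) * (y.1 * q0 y - y.2 * (p0 y - a))).
  by move=> /Hr[Uy _ _]; exact: (partials_F1 Uy).2.
have small y : in_box r y -> `|p0 y - a| <= K / 12 /\ `|q0 y| <= K / 12.
  by move=> /Hr[_ h1]; rewrite Im_h0 subr0.
have := gradient_growth r0 dF1 dx dy small zr.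
have -> : F1 z - F1 (0, 0) = F z - F (0, 0) - a / n.+1%:R * cabs z ^+ (2 * n.+1).
  by rewrite /F1 /N cabs_even /= !expr0n /= addr0 expr0n /= mulr0; ring.
set G := F z - F (0, 0); set Z := cabs z ^+ _.
have Z0 : 0 <= Z by rewrite exprn_ge0// cabs_ge0.
have KE : a / n.+1%:R = Num.sg a * K by rewrite /K {1}(numEsg a) mulrA.
have KZ : 0 <= K * Z by rewrite mulr_ge0// ltW.
rewrite KE ler_norml => /andP[h1 h2]; split => //.
  by case: sgE h1 h2 => ->; lra.
rewrite ler_norml.
by case: sgE h1 h2 => ->; lra.
Qed.

End PhaseEstimates.

(** * Dominated integrals on the line and on the plane *)

Section PlaneMeasurability.
Variable R : realType.
Notation plane := (measurableTypeR R * measurableTypeR R)%type.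

(** An open set of the plane is a countable union of rational boxes, hence
measurable for the product of the Borel structures of the line. *)
Lemma open_measurable_plane (O : set (R * R)) : open O ->
  measurable (O : set plane).
Proof.
move=> oO.
pose box (q : (rat * rat) * (rat * rat)) : set (R * R) :=
  [set` `](ratr q.1.1 : R), ratr q.1.2[] `*` [set` `](ratr q.2.1 : R), ratr q.2.2[].
pose G (n : nat) : set (R * R) :=
  if unpickle n is Some q then (if `[< box q `<=` O >] then box q else set0) else set0.
have -> : O = \bigcup_n G n.
  apply/seteqP; split => [[x y] Oxy|p [n _]]; last first.
    by rewrite /G; case: unpickle => // q; case: asboolP => // h; exact: h.
  have /nbhs_ballP[e /= e0 he] : nbhs (x, y) O by exact: open_nbhs_nbhs.
  have rats (u : R) : exists q : rat * rat, [/\ u - e < ratr q.1, ratr q.1 < u,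
      u < ratr q.2 & ratr q.2 < u + e].
    have [] := @rat_in_itvoo R (u - e) u; first by rewrite ltrBlDr ltrDl.
    move=> q1; rewrite in_itv /= => /andP[a1 a2].
    have [] := @rat_in_itvoo R u (u + e); first by rewrite ltrDl.
    by move=> q2; rewrite in_itv /= => /andP[b1 b2]; exists (q1, q2).
  have [q1 [a1 a2 a3 a4]] := rats x; have [q2 [b1 b2 b3 b4]] := rats y.
  have [k kE] : exists k, unpickle k = Some (q1, q2).
    by exists (pickle (q1, q2)); exact: pickleK.
  exists k; first exact: I.
  rewrite /G kE; case: asboolP.
    by move=> _; split => /=; rewrite in_itv /= ?a2 ?a3 ?b2 ?b3.
  case=> -[u v] [/=]; rewrite !in_itv /= => /andP[u1 u2] /andP[v1 v2].
  apply: he; split; rewrite /ball /= ltr_norml; apply/andP; split; lra.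
apply: bigcupT_measurable => n; rewrite /G; case: unpickle => [q|//].
by case: asboolP => // _; apply: measurableX.
Qed.

Lemma continuous_measurable_plane (f : R * R -> R) : continuous f ->
  measurable_fun (setT : set plane) f.
Proof.
move=> /continuousP cf; apply: (measurability _ (RGenOpens.measurableE R)).
move=> _ [_ [a [b ->] <-]]; rewrite setTI; apply: open_measurable_plane.
exact/cf/interval_open.
Qed.

End PlaneMeasurability.

Section Domination.
Context d (T : measurableType d) (R : realType) (mu : {measure set T -> \bar R}).
Implicit Types f g : T -> R.

(** This lemma and the next one are used with g a Cauchy kernel, whose integral
is known. *)
Lemma dominated_integrable f g (C : R) : measurable_fun setT f -> 0 <= C ->
  (forall x, `|f x| <= C * g x) -> mu.-integrable setT (EFin \o g) ->
  mu.-integrable setT (EFin \o f).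
Proof.
move=> mf C0 fg ig.
apply: (@le_integrable _ _ _ mu setT _ _ (fun x => (C%:E * (g x)%:E)%E)) => //.
- exact/measurable_EFinP.
- by move=> x _ /=; rewrite lee_fin (le_trans (fg x))// ler_norm.
- exact: integrableZl.
Qed.

Lemma dominated_Rintegral f g (C : R) : measurable_fun setT f -> 0 <= C ->
  (forall x, `|f x| <= C * g x) -> mu.-integrable setT (EFin \o g) ->
  `|\int[mu]_x f x| <= C * \int[mu]_x g x.
Proof.
move=> mf C0 fg ig; have if_ := dominated_integrable mf C0 fg ig.
rewrite (le_trans (le_normr_Rintegral measurableT if_))// -RintegralZl//.
apply: le_Rintegral => //.
- exact: integrable_norm.
- by have := integrableZl measurableT C ig.
Qed.

Lemma Rintegral_ge_on f (A : set T) (c : R) : measurable A -> (mu A < +oo)%E ->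
  mu.-integrable setT (EFin \o f) -> (forall x, 0 <= f x) ->
  (forall x, A x -> c <= f x) -> c * fine (mu A) <= \int[mu]_x f x.
Proof.
move=> mA Aoo if_ f0 fc.
have ifA : mu.-integrable A (EFin \o f) by exact: integrableS if_.
rewrite -Rintegral_cst//.
have icA : mu.-integrable A (EFin \o (fun=> c)).
  apply: measurable_bounded_integrable => //.
  by exists `|c|; split; [exact: num_real|move=> M cM x _ /=; exact: ltW].
apply: (@le_trans _ _ (\int[mu]_(x in A) f x)); first exact: le_Rintegral.
apply: fine_le.
- exact: integrable_fin_num.
- exact: integrable_fin_num.
- apply: ge0_subset_integral => //.
  + by case/integrableP: if_.
  + by move=> x _; rewrite lee_fin.
Qed.

End Domination.

Section CauchyKernel.
Variable R : realType.
Notation leb := (@lebesgue_measure R).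

Definition ckernel (a b x : R) : R := (1 + (a * (x - b)) ^+ 2)^-1.

Lemma ckernel_gt0 a b x : 0 < ckernel a b x.
Proof. by rewrite invr_gt0 ltr_wpDr// sqr_ge0. Qed.

Lemma ckernel_ge0 a b x : 0 <= ckernel a b x.
Proof. exact/ltW/ckernel_gt0. Qed.

Lemma continuous_ckernel a b : continuous (ckernel a b).
Proof.
move=> x; apply: cvgV; first by rewrite gt_eqF// ltr_wpDr// sqr_ge0.
apply: cvgD; first exact: cvg_cst.
have c1 : (fun y : R => a * (y - b)) y @[y --> x] --> a * (x - b).
  by apply: cvgM; [exact: cvg_cst|apply: cvgB => //; exact: cvg_cst].
under eq_fun do rewrite expr2.
by rewrite expr2; exact: cvgM.
Qed.

(** The affine change of variable y = a (x - b). *)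
Lemma ckernel_integral_shift a b : 0 < a ->
  (\int[leb]_x (ckernel 1 0 x)%:E = a%:E * \int[leb]_x (ckernel a b x)%:E)%E.
Proof.
move=> a0; pose F x : R := a * x + - (a * b).
have dF x : is_derive x (1 : R) F a by exact: is_derive_affine.
have F' : F^`()%classic = cst a.
  by apply/funext => x; rewrite derive1E; have [_ ->] := dF x.
rewrite (@increasing_ge0_integration_by_substitutionT _ F (ckernel 1 0)).
- rewrite F' -ge0_integralZl//=; last first.
  + by rewrite lee_fin ltW.
  + by move=> x _; rewrite lee_fin ckernel_ge0.
  + apply/measurable_EFinP; apply: continuous_measurable_fun.
    exact: continuous_ckernel.
  apply: eq_integral => x _; rewrite -EFinM; congr EFin.
  rewrite /= fctE /= mulrC; congr (_ * _).
  by rewrite /ckernel /F mul1r subr0 -mulrBr.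
- by move=> x y xy; rewrite /F ltrD2r ltr_pM2l.
- by rewrite F'; exact: cst_continuous.
- by rewrite F'; apply/cvg_ex; exists a; exact: cvg_cst.
- by rewrite F'; apply/cvg_ex; exists a; exact: cvg_cst.
- by move=> x; have [] := dF x.
- apply/cvgrNyPle => A; near=> x; rewrite /F.
  rewrite -lerBrDr -ler_pdivlMl//; near: x; exact: nbhs_ninfty_le.
- apply/cvgryPge => A; near=> x; rewrite /F.
  rewrite -lerBlDr -ler_pdivrMl//; near: x; exact: nbhs_pinfty_ge.
- exact: continuous_ckernel.
- by move=> x; exact: ckernel_ge0.
Unshelve. all: by end_near. Qed.

(** The primitive is the arctangent. *)
Lemma ckernel10_integral : (\int[leb]_x (ckernel 1 0 x)%:E = pi%:E)%E.
Proof.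
rewrite ge0_symfun_integralT.
- rewrite -set_itvcy.
  under eq_integral do rewrite /ckernel mul1r subr0 -/(oneDsqr _).
  by rewrite integral0y_oneDsqr -EFinM mulrCA divff ?mulr1.
- by move=> x; exact: ckernel_ge0.
- exact: continuous_ckernel.
- by move=> x /=; rewrite /ckernel !mul1r !subr0 sqrrN.
Qed.

Lemma ckernel_integral a b : 0 < a ->
  (\int[leb]_x (ckernel a b x)%:E = (pi / a)%:E)%E.
Proof.
move=> a0; have := ckernel_integral_shift b a0.
rewrite ckernel10_integral => /(congr1 (fun e => (a^-1)%:E * e)%E).
rewrite muleA -!EFinM mulVf ?gt_eqF// mul1e => <-.
by rewrite mulrC.
Qed.

Lemma ckernel_integrable a b : 0 < a ->
  leb.-integrable setT (EFin \o ckernel a b).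
Proof.
move=> a0; apply/integrableP; split.
  apply/measurable_EFinP; apply: continuous_measurable_fun.
  exact: continuous_ckernel.
under eq_integral do rewrite /= ger0_norm ?ckernel_ge0//.
by rewrite ckernel_integral// ltry.
Qed.

Lemma ckernel_Rintegral a b : 0 < a -> \int[leb]_x ckernel a b x = pi / a.
Proof. by move=> a0; rewrite /Rintegral ckernel_integral. Qed.

Definition ckernel2 (a : R) (z : R * R) : R := ckernel a 0 z.1 * ckernel a 0 z.2.

Lemma ckernel2_ge0 a z : 0 <= ckernel2 a z.
Proof. by rewrite mulr_ge0 ?ckernel_ge0. Qed.

Lemma measurable_ckernel2 a : 
  measurable_fun (setT : set (measurableTypeR R * measurableTypeR R)) (ckernel2 a).
Proof.
apply: continuous_measurable_plane => z; rewrite /ckernel2.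
apply: cvgM.
  apply: (@continuous_comp _ _ _ (fst : R * R -> R) (ckernel a 0)).
    exact: continuous_fst_R.
  exact: continuous_ckernel.
apply: (@continuous_comp _ _ _ (snd : R * R -> R) (ckernel a 0)).
  exact: continuous_snd_R.
exact: continuous_ckernel.
Qed.

Lemma ckernel2_integral a : 0 < a ->
  (\int[leb \x leb]_z (ckernel2 a z)%:E = ((pi / a) ^+ 2)%:E)%E.
Proof.
move=> a0; rewrite fubini_tonelli1/=.
- under eq_integral => x _.
    rewrite /fubini_F /=; under eq_integral => y _.
      rewrite /ckernel2 /= EFinM; over.
    rewrite ge0_integralZl//=; last first.
      by rewrite lee_fin ckernel_ge0.
      by move=> y _; rewrite lee_fin ckernel_ge0.
      by apply/measurable_EFinP; apply: continuous_measurable_fun; exact: continuous_ckernel.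
    rewrite ckernel_integral// muleC; over.
  rewrite ge0_integralZl//=; last first.
    by rewrite lee_fin divr_ge0 ?ltW// pi_gt0.
    by move=> y _; rewrite lee_fin ckernel_ge0.
    by apply/measurable_EFinP; apply: continuous_measurable_fun; exact: continuous_ckernel.
  by rewrite ckernel_integral// -EFinM expr2.
- exact: (measurable_EFinP _ _).2 (measurable_ckernel2 a).
- by move=> z; rewrite lee_fin ckernel2_ge0.
Qed.

Lemma ckernel2_integrable a : 0 < a ->
  (leb \x leb)%E.-integrable setT (EFin \o ckernel2 a).
Proof.
move=> a0; apply/integrableP; split.
  exact: (measurable_EFinP _ _).2 (measurable_ckernel2 a).
under eq_integral do rewrite /= ger0_norm ?ckernel2_ge0//.
by rewrite ckernel2_integral// ltry.
Qed.

Lemma ckernel2_Rintegral a : 0 < a ->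
  \int[(leb \x leb)%E]_z ckernel2 a z = (pi / a) ^+ 2.
Proof. by move=> a0; rewrite /Rintegral ckernel2_integral. Qed.

End CauchyKernel.

(** * Integrals of complex-valued functions *)

Section ComplexIntegral.
Context d (T : measurableType d) (R : realType) (mu : {measure set T -> \bar R}).
Notation normc := Normc.normc.
Implicit Types f g : T -> R[i].

Definition cintegrable f :=
  mu.-integrable setT (EFin \o (fun x => complex.Re (f x))) /\
  mu.-integrable setT (EFin \o (fun x => complex.Im (f x))).

Definition cmeasurable f :=
  measurable_fun setT (fun x => complex.Re (f x)) /\
  measurable_fun setT (fun x => complex.Im (f x)).

Lemma cmeasurableM f g : cmeasurable f -> cmeasurable g ->
  cmeasurable (fun x => f x * g x).
Proof.
move=> [fr fi] [gr gi]; split.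
  under eq_fun do rewrite ReM.
  by apply: measurable_funB; exact: measurable_funM.
under eq_fun do rewrite ImM.
by apply: measurable_funD; exact: measurable_funM.
Qed.

Lemma cmeasurableJ f : cmeasurable f -> cmeasurable (fun x => conjc (f x)).
Proof.
move=> [fr fi]; split; first by under eq_fun do rewrite ReJ; exact: fr.
under eq_fun do rewrite ImJ.
exact: measurableT_comp fi.
Qed.

Lemma cmeasurable_real (f : T -> R) : measurable_fun setT f ->
  cmeasurable (fun x => (f x)%:C).
Proof. by move=> mf; split => //=; exact: measurable_cst. Qed.

Lemma dominated_cintegrable f (g : T -> R) (C : R) : cmeasurable f -> 0 <= C ->
  (forall x, normc (f x) <= C * g x) -> mu.-integrable setT (EFin \o g) ->
  cintegrable f.
Proof.
move=> [fr fi] C0 fg ig; split; apply: (dominated_integrable _ C0 _ ig) => // x.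
  exact: le_trans (ge_Re_normc _) (fg x).
exact: le_trans (ge_Im_normc _) (fg x).
Qed.

Lemma dominated_cintegral f (g : T -> R) (C : R) : cmeasurable f -> 0 <= C ->
  (forall x, normc (f x) <= C * g x) -> mu.-integrable setT (EFin \o g) ->
  normc (cintegral mu f) <= 2 * (C * \int[mu]_x g x).
Proof.
move=> [fr fi] C0 fg ig; rewrite (le_trans (normc_le_parts _))// mulr_natl mulr2n.
apply: lerD; apply: (dominated_Rintegral _ C0 _ ig) => // x.
  exact: le_trans (ge_Re_normc _) (fg x).
exact: le_trans (ge_Im_normc _) (fg x).
Qed.

Lemma cintegrableD f g : cintegrable f -> cintegrable g ->
  cintegrable (fun x => f x + g x).
Proof.
move=> [fr fi] [gr gi]; split.
  have := integrableD measurableT fr gr.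
  by apply: eq_integrable => // x _ /=; rewrite ReD.
have := integrableD measurableT fi gi.
by apply: eq_integrable => // x _ /=; rewrite ImD.
Qed.

Lemma cintegralD f g : cintegrable f -> cintegrable g ->
  cintegral mu (fun x => f x + g x) = cintegral mu f + cintegral mu g.
Proof.
move=> [fr fi] [gr gi]; rewrite /cintegral; apply: complex_eqP.
  rewrite ReD /= -RintegralD//.
  by congr Rintegral; apply/funext => x; rewrite ReD.
rewrite ImD /= -RintegralD//.
by congr Rintegral; apply/funext => x; rewrite ImD.
Qed.

Lemma cintegrable0 : cintegrable (fun=> 0).
Proof. by split; exact: integrable0. Qed.

Lemma cintegral0 : cintegral mu (fun=> 0) = 0.
Proof.
rewrite /cintegral /= /Rintegral.
by under eq_integral do rewrite /=; rewrite integral0.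
Qed.

Lemma cintegrable_sum n (F : nat -> T -> R[i]) :
  (forall j, (j < n)%N -> cintegrable (F j)) ->
  cintegrable (fun x => \sum_(j < n) F j x).
Proof.
elim: n => [_|n ih iF].
  by under eq_fun do rewrite big_ord0; exact: cintegrable0.
under eq_fun do rewrite big_ord_recr /=.
by apply: cintegrableD; [apply: ih => j jn; apply: iF; exact: ltnW|exact: iF].
Qed.

Lemma cintegral_sum n (F : nat -> T -> R[i]) :
  (forall j, (j < n)%N -> cintegrable (F j)) ->
  cintegral mu (fun x => \sum_(j < n) F j x) = \sum_(j < n) cintegral mu (F j).
Proof.
elim: n => [_|n ih iF].
  by under eq_fun do rewrite big_ord0; rewrite big_ord0 cintegral0.
under eq_fun do rewrite big_ord_recr /=.
rewrite cintegralD.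
- by rewrite big_ord_recr ih// => j jn; apply: iF; exact: ltnW.
- by apply: cintegrable_sum => j jn; apply: iF; exact: ltnW.
- exact: iF.
Qed.

Lemma cintegrableZl (c : R[i]) f : cintegrable f -> cintegrable (fun x => c * f x).
Proof.
move=> [fr fi]; split.
  have := integrableB measurableT (integrableZl measurableT (complex.Re c) fr)
    (integrableZl measurableT (complex.Im c) fi).
  by apply: eq_integrable => // x _ /=; rewrite ReM.
have := integrableD measurableT (integrableZl measurableT (complex.Re c) fi)
  (integrableZl measurableT (complex.Im c) fr).
by apply: eq_integrable => // x _ /=; rewrite ImM.
Qed.

Lemma cintegralZl (c : R[i]) f : cintegrable f ->
  cintegral mu (fun x => c * f x) = c * cintegral mu f.
Proof.
move=> [fr fi].
have iZ (a : R) (u : T -> R) : mu.-integrable setT (EFin \o u) ->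
    mu.-integrable setT (EFin \o (fun x => a * u x)).
  by move=> iu; have := integrableZl measurableT a iu.
rewrite /cintegral; apply: complex_eqP; rewrite ?ReM ?ImM /=.
  rewrite -!RintegralZl// -RintegralB//; [|exact: iZ|exact: iZ].
  by congr Rintegral; apply/funext => x; rewrite ReM.
rewrite -!RintegralZl// -RintegralD//; [|exact: iZ|exact: iZ].
by congr Rintegral; apply/funext => x; rewrite ImM.
Qed.

Lemma cintegral_sum2 n (F : nat -> nat -> T -> R[i]) :
  (forall j l, cintegrable (F j l)) ->
  cintegral mu (fun x => \sum_(j < n) \sum_(l < n) F j l x) =
  \sum_(j < n) \sum_(l < n) cintegral mu (F j l).
Proof.
move=> iF; rewrite (cintegral_sum (F := fun j x => \sum_(l < n) F j l x)).
  by apply: eq_bigr => j _; exact: cintegral_sum.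
by move=> j _; apply: cintegrable_sum => l _.
Qed.

End ComplexIntegral.

Section CompactSupportLine.
Variable R : realType.
Notation leb := (@lebesgue_measure R).
Implicit Types (f : R -> R) (r : R).

Lemma compact_support_bound f r : 0 <= r -> continuous f ->
  (forall t, r < `|t| -> f t = 0) ->
  exists2 M, 0 <= M & forall t, `|f t| <= M * ckernel 1 0 t.
Proof.
move=> r0 cf f0.
have Nr : - r <= r by rewrite (le_trans _ r0)// oppr_le0.
have [|c _ fc] := @EVT_max R (fun t => `|f t|) (- r) r Nr.
  apply: continuous_subspaceT => t; exact: cvg_norm (cf t).
exists (`|f c| * (1 + r ^+ 2)); first by rewrite mulr_ge0// addr_ge0// sqr_ge0.
move=> t; have [tr|tr] := leP `|t| r; last first.
  by rewrite f0// normr0 mulr_ge0 ?ckernel_ge0// mulr_ge0// addr_ge0// sqr_ge0.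
rewrite -mulrA (le_trans (fc t _))//; first by rewrite in_itv /= -ler_norml.
rewrite ler_peMr// /ckernel mul1r subr0 ler_pdivlMr ?ltr_wpDr ?sqr_ge0// mul1r.
by rewrite lerD2l -[t ^+ 2]real_normK ?num_real// lerXn2r ?nnegrE.
Qed.

(** Integration by parts on the line without boundary terms rests on this. *)
Lemma integral_derivative0 f f' r : 0 <= r ->
  (forall t, is_derive t (1 : R) f (f' t)) -> continuous f' ->
  (forall t, r < `|t| -> f t = 0) -> (forall t, r < `|t| -> f' t = 0) ->
  \int[leb]_t f' t = 0.
Proof.
move=> r0 df cf' f0 f'0.
have ab : - (r + 1) < r + 1 by lra.
have E : (fun t => f' t) = f' \_ `[- (r + 1), r + 1].
  apply/funext => t; rewrite patchE; case: ifPn => //; rewrite notin_setE /= => tN.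
  apply: f'0; rewrite ltNge; apply/negP => tr; apply: tN.
  rewrite in_itv /= -ler_norml; lra.
rewrite E -Rintegral_mkcond /Rintegral (@continuous_FTC2 _ f' f)//=.
- by rewrite !f0 ?subrr//; [rewrite ler0_norm; lra|rewrite ger0_norm; lra].
- exact: continuous_subspaceT.
- have cf : continuous f.
    move=> t; apply/differentiable_continuous/derivable1_diffP.
    by have [] := df t.
  split; first by move=> t _; have [] := df t.
  + exact/cvg_at_right_filter/cf.
  + exact/cvg_at_left_filter/cf.
- by move=> t _; rewrite derive1E; have [_ ->] := df t.
Qed.

End CompactSupportLine.

(** * Fourier transform of modulated bump functions *)

Section FourierOfBump.
Variables (R : realType) (psi : nat -> R -> R) (r : R).
Notation leb := (@lebesgue_measure R).
Notation normc := Normc.normc.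
Hypothesis r0 : 0 <= r.
Hypothesis dpsi : forall j t, is_derive t (1 : R) (psi j) (psi j.+1 t).
Hypothesis psi0 : forall j t, r < `|t| -> psi j t = 0.

Lemma continuous_psi j : continuous (psi j).
Proof.
move=> t; apply/differentiable_continuous/derivable1_diffP.
by have [] := dpsi j t.
Qed.

Lemma psi_bound j : exists2 M, 0 <= M & forall t, `|psi j t| <= M * ckernel 1 0 t.
Proof.
by apply: (@compact_support_bound _ _ r); [|exact: continuous_psi|exact: psi0].
Qed.

Lemma continuous_cos_scale (a : R) : continuous (fun t => cos (a * t)).
Proof.
move=> t; apply: (@continuous_comp _ _ _ (fun t => a * t) cos).
  exact: mulrl_continuous.
exact: continuous_cos.
Qed.

Lemma continuous_sin_scale (a : R) : continuous (fun t => sin (a * t)).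
Proof.
move=> t; apply: (@continuous_comp _ _ _ (fun t => a * t) sin).
  exact: mulrl_continuous.
exact: continuous_sin.
Qed.

Lemma is_derive_cos_scale (a t : R) :
  is_derive t (1 : R) (fun t => cos (a * t)) (- sin (a * t) * a).
Proof. exact: (is_derive1_comp (is_derive_cos _) (is_derive_scale a t)). Qed.

Lemma is_derive_sin_scale (a t : R) :
  is_derive t (1 : R) (fun t => sin (a * t)) (cos (a * t) * a).
Proof. exact: (is_derive1_comp (is_derive_sin _) (is_derive_scale a t)). Qed.

Lemma ck1_integrable : leb.-integrable setT (EFin \o @ckernel R 1 0).
Proof. exact: ckernel_integrable. Qed.

Lemma psi_times_integrable j (u : R -> R) : continuous u ->
  (forall t, `|u t| <= 1) -> leb.-integrable setT (EFin \o (fun t => psi j t * u t)).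
Proof.
move=> cu u1; have [M M0 HM] := psi_bound j.
apply: (dominated_integrable _ M0 _ ck1_integrable).
  apply: continuous_measurable_fun => t.
  by apply: cvgM; [exact: continuous_psi|exact: cu].
move=> t; rewrite normrM (le_trans _ (HM t))// ler_piMr//.
Qed.

Lemma norm_cos_le1 (x : R) : `|cos x| <= 1.
Proof. by rewrite ler_norml cos_geN1 cos_le1. Qed.

Lemma norm_sin_le1 (x : R) : `|sin x| <= 1.
Proof. by rewrite ler_norml sin_geN1 sin_le1. Qed.

(** Cosine and sine transforms of the j-th derivative of the bump: the real part
and minus the imaginary part of its Fourier transform. *)
Definition FC j eta : R := \int[leb]_t (psi j t * cos (eta * t)).
Definition FS j eta : R := \int[leb]_t (psi j t * sin (eta * t)).

Lemma FC_integrable j eta :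
  leb.-integrable setT (EFin \o (fun t => psi j t * cos (eta * t))).
Proof.
apply: psi_times_integrable; first exact: continuous_cos_scale.
by move=> t; exact: norm_cos_le1.
Qed.

Lemma FS_integrable j eta :
  leb.-integrable setT (EFin \o (fun t => psi j t * sin (eta * t))).
Proof.
apply: psi_times_integrable; first exact: continuous_sin_scale.
by move=> t; exact: norm_sin_le1.
Qed.

Lemma integrable_scale (a : R) (u : R -> R) :
  leb.-integrable setT (EFin \o u) -> leb.-integrable setT (EFin \o (fun t => a * u t)).
Proof. by move=> iu; have := integrableZl measurableT a iu. Qed.

Lemma FC_step j eta : FC j.+1 eta = eta * FS j eta.
Proof.
have : \int[leb]_t (psi j.+1 t * cos (eta * t) - eta * (psi j t * sin (eta * t))) = 0.
  apply: (@integral_derivative0 _ (fun t => psi j t * cos (eta * t)) _ r r0).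
  - move=> t; have := is_deriveM (dpsi j t) (is_derive_cos_scale eta t).
    by move/is_derive_eq; apply; rewrite /GRing.scale /=; ring.
  - move=> t; apply: cvgB.
      by apply: cvgM; [exact: continuous_psi|exact: continuous_cos_scale].
    apply: cvgM; first exact: cvg_cst.
    by apply: cvgM; [exact: continuous_psi|exact: continuous_sin_scale].
  - by move=> t tr; rewrite psi0// mul0r.
  - by move=> t tr; rewrite !psi0// !mul0r mulr0 subr0.
rewrite RintegralB//; [|exact: FC_integrable|exact/integrable_scale/FS_integrable].
rewrite RintegralZl//; last exact: FS_integrable.
by move/eqP; rewrite subr_eq0 => /eqP.
Qed.

Lemma FS_step j eta : FS j.+1 eta = - (eta * FC j eta).
Proof.
have : \int[leb]_t (psi j.+1 t * sin (eta * t) + eta * (psi j t * cos (eta * t))) = 0.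
  apply: (@integral_derivative0 _ (fun t => psi j t * sin (eta * t)) _ r r0).
  - move=> t; have := is_deriveM (dpsi j t) (is_derive_sin_scale eta t).
    by move/is_derive_eq; apply; rewrite /GRing.scale /=; ring.
  - move=> t; apply: cvgD.
      by apply: cvgM; [exact: continuous_psi|exact: continuous_sin_scale].
    apply: cvgM; first exact: cvg_cst.
    by apply: cvgM; [exact: continuous_psi|exact: continuous_cos_scale].
  - by move=> t tr; rewrite psi0// mul0r.
  - by move=> t tr; rewrite !psi0// !mul0r mulr0 addr0.
rewrite RintegralD//; [|exact: FS_integrable|exact/integrable_scale/FC_integrable].
rewrite RintegralZl//; last exact: FC_integrable.
by move/eqP; rewrite addr_eq0 => /eqP.
Qed.

Lemma FCS_bounded j : exists2 K, 0 <= K & forall eta, `|FC j eta| <= K /\ `|FS j eta| <= K.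
Proof.
have [M M0 HM] := psi_bound j; exists (M * pi).
  by rewrite mulr_ge0// ltW// pi_gt0.
have E : pi = \int[leb]_x ckernel 1 0 x by rewrite ckernel_Rintegral// divr1.
move=> eta; rewrite E; split; apply: (dominated_Rintegral _ M0 _ ck1_integrable).
- apply: continuous_measurable_fun => t.
  by apply: cvgM; [exact: continuous_psi|exact: continuous_cos_scale].
- by move=> t; rewrite normrM (le_trans _ (HM t))// ler_piMr// norm_cos_le1.
- apply: continuous_measurable_fun => t.
  by apply: cvgM; [exact: continuous_psi|exact: continuous_sin_scale].
- by move=> t; rewrite normrM (le_trans _ (HM t))// ler_piMr// norm_sin_le1.
Qed.

(** Multiplication by eta^2 is, up to sign, two derivatives in t. *)
Lemma FCS_shift n : forall j eta, (eta ^+ 2) ^+ n * `|FC j eta| = `|FC (j + 2 * n) eta| /\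
  (eta ^+ 2) ^+ n * `|FS j eta| = `|FS (j + 2 * n) eta|.
Proof.
elim: n => [|n ih] j eta; first by rewrite muln0 addn0 !expr0 !mul1r.
have e2 : eta ^+ 2 = `|eta| * `|eta| by rewrite -expr2 real_normK ?num_real.
have [h1 h2] := ih j eta; rewrite !(exprS (eta ^+ 2) n) -!mulrA h1 h2 mulnS addnCA !addSn add0n.
rewrite !(FC_step, FS_step) !(mulrN, normrN, normrM) !mulrA -e2 expr2.
by split.
Qed.

(** Combines the bounds on the transforms of psi_j and psi_(j+2n), using
(1 + x)^n <= 2^n (1 + x^n) for x >= 0. *)
Lemma FCS_decay j n : exists2 K, 0 <= K & forall eta,
  `|FC j eta| <= K * ckernel 1 0 eta ^+ n /\ `|FS j eta| <= K * ckernel 1 0 eta ^+ n.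
Proof.
have [K1 K10 H1] := FCS_bounded j; have [K2 K20 H2] := FCS_bounded (j + 2 * n).
exists (2 ^+ n * (K1 + K2)); first by rewrite mulr_ge0// addr_ge0.
move=> eta; have [a1 b1] := H1 eta; have [a2 b2] := H2 eta.
have [s1 s2] := FCS_shift n j eta.
rewrite /ckernel mul1r subr0 exprVn.
have p0 : 0 < (1 + eta ^+ 2) ^+ n by rewrite exprn_gt0// ltr_wpDr// sqr_ge0.
have pow : (1 + eta ^+ 2) ^+ n <= 2 ^+ n * (1 + (eta ^+ 2) ^+ n).
  have e0 : 0 <= eta ^+ 2 by exact: sqr_ge0.
  case: (leP (eta ^+ 2) 1) => e1.
    rewrite (@le_trans _ _ (2 ^+ n))//.
      by apply: lerXn2r; rewrite ?nnegrE; lra.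
    by rewrite ler_peMr ?exprn_ge0// lerDl exprn_ge0.
  rewrite mulrDr mulr1 (@le_trans _ _ (2 ^+ n * (eta ^+ 2) ^+ n))//.
    by rewrite -exprMn; apply: lerXn2r; rewrite ?nnegrE; lra.
  by rewrite lerDr exprn_ge0.
have key (x y : R) : `|x| <= K1 -> `|y| <= K2 -> (eta ^+ 2) ^+ n * `|x| = `|y| ->
    `|x| <= 2 ^+ n * (K1 + K2) / (1 + eta ^+ 2) ^+ n.
  move=> x1 y1 xy; rewrite ler_pdivlMr// mulrC (le_trans (ler_wpM2r _ pow))//.
  rewrite -mulrA ler_wpM2l ?exprn_ge0// mulrDl mul1r xy; exact: lerD.
by split; [apply: key s1|apply: key s2].
Qed.

Lemma cos_lipschitz (x y : R) : `|cos x - cos y| <= `|x - y|.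
Proof.
wlog xy : x y / y <= x.
  by move=> H; have [/H//|/ltW/H] := leP y x; rewrite distrC [leRHS]distrC.
have := @MVT_segment R cos (fun x => - sin x) y x xy; case.
- by apply: continuous_subspaceT; exact: continuous_cos.
- by move=> c _ ->; rewrite normrM normrN ler_piMl// norm_sin_le1.
Qed.

Lemma sin_lipschitz (x y : R) : `|sin x - sin y| <= `|x - y|.
Proof.
wlog xy : x y / y <= x.
  by move=> H; have [/H//|/ltW/H] := leP y x; rewrite distrC [leRHS]distrC.
have := @MVT_segment R sin cos y x xy; case.
- by apply: continuous_subspaceT; exact: continuous_sin.
- by move=> c _ ->; rewrite normrM ler_piMl// norm_cos_le1.
Qed.

(** The compact support of psi makes the transforms Lipschitz in the frequency:
continuity is obtained without differentiating under the integral. *)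
Lemma lipschitz_trig_integral (u : R -> R) j : continuous u ->
  (forall x, `|u x| <= 1) -> (forall x y, `|u x - u y| <= `|x - y|) ->
  continuous (fun eta : R => \int[leb]_t (psi j t * u (eta * t))).
Proof.
move=> cu u1 ul; have [M M0 HM] := psi_bound j.
have cus (a : R) : continuous (fun t => u (a * t)).
  move=> t; apply: (@continuous_comp _ _ _ (fun t => a * t) u).
    exact: mulrl_continuous.
  exact: cu.
have ius (a : R) : leb.-integrable setT (EFin \o (fun t => psi j t * u (a * t))).
  by apply: psi_times_integrable.
pose K := r * M * pi.
have K0 : 0 <= K by rewrite !mulr_ge0// ltW// pi_gt0.
have lip (a b : R) : `|\int[leb]_t (psi j t * u (a * t)) - \int[leb]_t (psi j t * u (b * t))|
    <= `|a - b| * K.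
  rewrite -RintegralB//; rewrite /K mulrA.
  have -> : pi = \int[leb]_x ckernel 1 0 x by rewrite ckernel_Rintegral// divr1.
  apply: (dominated_Rintegral _ _ _ ck1_integrable).
  - apply: continuous_measurable_fun => t.
    by apply: cvgB; apply: cvgM; try exact: continuous_psi; exact: cus.
  - by rewrite !mulr_ge0.
  - move=> t; rewrite -mulrBr normrM.
    have [tr|tr] := leP `|t| r; last first.
      by rewrite psi0// normr0 mul0r !mulr_ge0// ckernel_ge0.
    have -> : `|a - b| * (r * M) * ckernel 1 0 t =
        M * ckernel 1 0 t * (`|a - b| * r) by ring.
    apply: ler_pM => //.
    by rewrite (le_trans (ul _ _))// -mulrBl normrM ler_wpM2l.
move=> a; apply/cvgrPdist_le => e e0.
near=> b; rewrite (le_trans (lip _ _))//.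
have : `|a - b| <= e / (K + 1).
  near: b; apply: (@cvgr_dist_le _ _ _ (nbhs a) _ id a) => //.
  by rewrite divr_gt0// ltr_wpDl.
rewrite ler_pdivlMr ?ltr_wpDl//; apply: le_trans.
by rewrite ler_wpM2l// lerDl.
Unshelve. all: by end_near. Qed.

Lemma continuous_FC j : continuous (FC j).
Proof.
exact: (lipschitz_trig_integral (@continuous_cos R) (@norm_cos_le1) cos_lipschitz).
Qed.

Lemma continuous_FS j : continuous (FS j).
Proof.
exact: (lipschitz_trig_integral (@continuous_sin R) (@norm_sin_le1) sin_lipschitz).
Qed.

(** The bump psi_j modulated to the frequency mu, psi_j(t) e^(i mu t), followed
by its Fourier transform, the translate by mu of that of psi_j. *)
Definition theta (mu : R) j t : R[i] := (psi j t)%:C * (cos (mu * t) +i* sin (mu * t)).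

Definition Theta (mu : R) j eta : R[i] := FC j (eta - mu) -i* FS j (eta - mu).

Lemma theta_kernel mu j (eta t : R) :
  (cos (eta * t) -i* sin (eta * t)) * theta mu j t =
  (psi j t * cos ((eta - mu) * t)) -i* (psi j t * sin ((eta - mu) * t)).
Proof.
by rewrite /theta mulrBl cosB sinB; apply: complex_eqP => /=; ring.
Qed.

Lemma fourier_theta_integrable mu j eta :
  cintegrable leb (fun t => (cos (eta * t) -i* sin (eta * t)) * theta mu j t).
Proof.
under eq_fun do rewrite theta_kernel.
split => /=; first exact: FC_integrable.
have := integrable_scale (-1) (FS_integrable j (eta - mu)).
by apply: eq_integrable => // t _ /=; rewrite mulN1r.
Qed.

Lemma fourier_theta mu j eta :
  cintegral leb (fun t => (cos (eta * t) -i* sin (eta * t)) * theta mu j t) =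
  Theta mu j eta.
Proof.
under eq_fun do rewrite theta_kernel.
rewrite /cintegral /Theta /=; congr (_ +i* _).
rewrite /FS -[RHS]mulN1r -RintegralZl//; last exact: FS_integrable.
by congr Rintegral; apply/funext => t; rewrite mulN1r.
Qed.

Lemma cmeasurable_Theta mu j : cmeasurable (Theta mu j : measurableTypeR R -> R[i]).
Proof.
have cs (u : R -> R) : continuous u -> continuous (fun eta : R => u (eta - mu)).
  move=> cu t; apply: (@continuous_comp _ _ _ (fun eta => eta - mu) u); last exact: cu.
  by apply: cvgB => //; exact: cvg_cst.
split.
  exact: (continuous_measurable_fun (cs _ (@continuous_FC j))).
have cN : continuous (fun eta => - FS j eta) by move=> t; apply: cvgN; exact: continuous_FS.
exact: (continuous_measurable_fun (cs _ cN)).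
Qed.

Lemma Theta_decay j n : exists2 K, 0 <= K & forall mu eta,
  normc (Theta mu j eta) <= K * ckernel 1 mu eta ^+ n.
Proof.
have [K K0 HK] := FCS_decay j n; exists (2 * K); first by rewrite mulr_ge0.
move=> mu eta; have [h1 h2] := HK (eta - mu).
have kE : ckernel 1 mu eta = ckernel 1 0 (eta - mu) by rewrite /ckernel subr0.
rewrite kE (le_trans (normc_le_parts _))//= normrN -mulrA mulr_natl mulr2n.
exact: lerD.
Qed.

End FourierOfBump.

(** * Sobolev weights and frequency moments *)

Lemma le_term_sum (R : numDomainType) n (f : 'I_n -> R) i :
  (forall j, 0 <= f j) -> f i <= \sum_j f j.
Proof. by move=> f0; rewrite (bigD1 i)//= lerDl sumr_ge0. Qed.

Section Peetre.
Variable R : realType.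
Implicit Types a b s : R.

Definition weight s a : R := (1 + a ^+ 2) `^ s.

Lemma weight_gt0 s a : 0 < weight s a.
Proof. by rewrite powR_gt0// ltr_wpDr// sqr_ge0. Qed.

Lemma one_le_1Dsqr a : 1 <= 1 + a ^+ 2.
Proof. by rewrite lerDl sqr_ge0. Qed.

Lemma one_sqr_triangle a b :
  1 + a ^+ 2 <= 2 * (1 + b ^+ 2) * (1 + (a - b) ^+ 2).
Proof.
have : 0 <= (a - 2 * b) ^+ 2 by exact: sqr_ge0.
have : 0 <= (b * (a - b)) ^+ 2 by exact: sqr_ge0.
by rewrite exprMn; nra.
Qed.

(** Peetre's inequality, with a natural exponent so that the loss is absorbed by
the rapid decay of the Fourier transforms of the bumps. The case s < 0 is the
case of - s with a and b exchanged. *)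
Lemma peetre s : exists n : nat, forall a b,
  weight s a <= 2 ^+ n * weight s b * (1 + (a - b) ^+ 2) ^+ n.
Proof.
have pos u n : 0 <= u -> u <= n%:R -> forall a b,
    weight u a <= 2 ^+ n * weight u b * (1 + (a - b) ^+ 2) ^+ n.
  move=> u0 un a b.
  have Xn (X : R) : 1 <= X -> X `^ u <= X ^+ n.
    move=> X1; rewrite -powR_mulrn ?(le_trans _ X1)//.
    exact: ler_powR.
  have b1 := one_le_1Dsqr b; have ab1 := one_le_1Dsqr (a - b).
  have h : weight u a <= (2 * (1 + b ^+ 2) * (1 + (a - b) ^+ 2)) `^ u.
    apply: ge0_ler_powR => //; last exact: one_sqr_triangle.
      by rewrite nnegrE (le_trans _ (one_le_1Dsqr a)).
    by rewrite nnegrE !mulr_ge0// (le_trans ler01).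
  have b0 : 0 <= 1 + b ^+ 2 by exact: le_trans ler01 b1.
  have ab0 : 0 <= 1 + (a - b) ^+ 2 by exact: le_trans ler01 ab1.
  rewrite powRM ?mulr_ge0// powRM// in h.
  apply: (le_trans h); rewrite /weight -!mulrA; apply: ler_pM; rewrite ?mulr_ge0 ?powR_ge0//.
    by apply: Xn; lra.
  by rewrite ler_wpM2l ?powR_ge0// Xn.
have [n sn] : exists n : nat, `|s| <= n%:R.
  by exists (Num.truncn `|s|).+1; rewrite ltW// truncnS_gt.
exists n => a b; have [s0|s0] := leP 0 s.
  by apply: pos => //; rewrite (le_trans _ sn)// ler_norm.
have Ns0 : 0 <= - s by rewrite oppr_ge0 ltW.
have Nsn : - s <= n%:R by rewrite -(ltr0_norm s0).
have := pos _ _ Ns0 Nsn b a.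
have E c : weight (- s) c = (weight s c)^-1 by rewrite /weight powRN.
rewrite !E -[(b - a) ^+ 2]sqrrN opprB.
move=> h; have wa := weight_gt0 s a; have wb := weight_gt0 s b.
have AB : 0 <= weight s a * weight s b by rewrite mulr_ge0 ?ltW.
have := ler_wpM2l AB h; set Y := _ ^+ n; set Z := _ ^+ n.
rewrite mulfK ?gt_eqF//; congr (_ <= _).
by field; rewrite gt_eqF.
Qed.

End Peetre.

Lemma Rintegral_ge_itv (R : realType) (f : R -> R) (a b c : R) : a < b ->
  (@lebesgue_measure R).-integrable setT (EFin \o f) -> (forall x, 0 <= f x) ->
  (forall x, a <= x <= b -> c <= f x) ->
  c * (b - a) <= \int[@lebesgue_measure R]_x f x.
Proof.
move=> ab if_ f0 fc.
have muA : @lebesgue_measure R `[a, b]%classic = (b - a)%:E.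
  by rewrite lebesgue_measure_itv /= lte_fin ab -EFinB.
have -> : b - a = fine (@lebesgue_measure R `[a, b]%classic) by rewrite muA.
have mA : measurable (`[a, b]%classic : set (measurableTypeR R)) by exact: measurable_itv.
have Aoo : (@lebesgue_measure R `[a, b]%classic < +oo)%E by rewrite muA ltry.
apply: (Rintegral_ge_on mA Aoo if_ f0) => x /=.
by rewrite in_itv /=; exact: fc.
Qed.

Section Moments.
Variables (R : realType) (psi : nat -> R -> R) (r : R).
Notation leb := (@lebesgue_measure R).
Notation normc := Normc.normc.
Hypothesis r0 : 0 <= r.
Hypothesis dpsi : forall j t, is_derive t (1 : R) (psi j) (psi j.+1 t).
Hypothesis psi0 : forall j t, r < `|t| -> psi j t = 0.
Notation Theta := (Theta psi).

(** What remains of the Sobolev product of two modulated bumps after the plane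
variable has been separated. *)
Definition moment_integrand s mu j l (eta : R) : R[i] :=
  (weight s eta)%:C * Theta mu j eta * conjc (Theta mu l eta).

Definition moment s mu j l := cintegral leb (moment_integrand s mu j l).

Lemma measurable_weight s : measurable_fun (setT : set (measurableTypeR R)) (weight s).
Proof.
apply: (measurableT_comp (@measurable_powR R s)).
apply: continuous_measurable_fun => a; apply: cvgD; first exact: cvg_cst.
exact: exprn_continuous.
Qed.

Lemma cmeasurable_moment_integrand s mu j l :
  cmeasurable (moment_integrand s mu j l : measurableTypeR R -> R[i]).
Proof.
apply: cmeasurableM; last exact/cmeasurableJ/(cmeasurable_Theta r0 dpsi psi0).
apply: cmeasurableM; last exact: (cmeasurable_Theta r0 dpsi psi0).
apply: (cmeasurable_real (T := measurableTypeR R)). exact: measurable_weight.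
Qed.

(** The transforms are concentrated at the frequency mu; by Peetre's inequality
the weight may be evaluated there. *)
Lemma moment_integrand_bound s j l : exists2 C, 0 <= C & forall mu eta,
  normc (moment_integrand s mu j l eta) <= C * weight s mu * ckernel 1 mu eta.
Proof.
have [n Hn] := peetre s.
have [K1 K10 H1] := Theta_decay r0 dpsi psi0 j n.
have [K2 K20 H2] := Theta_decay r0 dpsi psi0 l 1.
exists (2 ^+ n * K1 * K2); first by rewrite !mulr_ge0.
move=> mu eta; rewrite /moment_integrand !Normc.normcM normcJ normc_real.
rewrite gtr0_norm ?weight_gt0//.
set c := ckernel 1 mu eta; have c0 : 0 < c by exact: ckernel_gt0.
have cE : (1 + (eta - mu) ^+ 2) ^+ n = c ^- n.
  by rewrite /c /ckernel mul1r exprVn invrK.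
apply: (@le_trans _ _ ((2 ^+ n * weight s mu * c ^- n) * (K1 * c ^+ n) * (K2 * c))).
  apply: ler_pM; rewrite ?mulr_ge0 ?normc_ge0 ?(ltW (weight_gt0 _ _))//.
    apply: ler_pM; rewrite ?normc_ge0 ?(ltW (weight_gt0 _ _))//.
    by rewrite -cE Hn.
rewrite le_eqVlt; apply/orP; left; apply/eqP.
have cn : c ^+ n != 0 by rewrite expf_neq0// gt_eqF.
by field.
Qed.

Lemma moment_integrable s mu j l : cintegrable leb (moment_integrand s mu j l).
Proof.
have [C C0 HC] := moment_integrand_bound s j l.
apply: (dominated_cintegrable (cmeasurable_moment_integrand s mu j l) _ (HC mu)).
  by rewrite mulr_ge0// ltW// weight_gt0.
exact: ckernel_integrable.
Qed.

Lemma moment_upper s j l : exists2 C, 0 <= C & forall mu,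
  normc (moment s mu j l) <= C * weight s mu.
Proof.
have [C C0 HC] := moment_integrand_bound s j l.
exists (2 * C * pi); first by rewrite !mulr_ge0// ltW// pi_gt0.
move=> mu; have Cw : 0 <= C * weight s mu by rewrite mulr_ge0// ltW// weight_gt0.
have := dominated_cintegral (cmeasurable_moment_integrand s mu j l) Cw (HC mu)
  (ckernel_integrable mu ltr01).
rewrite ckernel_Rintegral// divr1; congr (_ <= _); ring.
Qed.

Lemma moment_upper_uniform s n : exists2 C, 0 <= C & forall mu j l,
  (j < n)%N -> (l < n)%N -> normc (moment s mu j l) <= C * weight s mu.
Proof.
pose K j l := projT1 (cid2 (moment_upper s j l)).
have K0 j l : 0 <= K j l by rewrite /K; case: cid2.
have HK j l mu : normc (moment s mu j l) <= K j l * weight s mu.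
  by rewrite /K; case: cid2.
exists (\sum_(j < n) \sum_(l < n) K j l).
  by apply: sumr_ge0 => j _; apply: sumr_ge0.
move=> mu j l jn ln; rewrite (le_trans (HK _ _ _))// ler_wpM2r ?(ltW (weight_gt0 _ _))//.
have Kl i : K i l <= \sum_(l < n) K i l.
  exact: (le_term_sum (Ordinal ln) (fun x : 'I_n => K0 i x)).
apply: (le_trans (Kl j)).
have S0 (i : 'I_n) : 0 <= \sum_(l < n) K i l by apply: sumr_ge0 => y _.
exact: (le_term_sum (Ordinal jn) S0).
Qed.

Variable e : R.
Hypothesis e0 : 0 < e.
Hypothesis psi_ge0 : forall t, 0 <= psi 0 t.
Hypothesis psi_eq1 : forall t, `|t| <= e -> psi 0 t = 1.

(** The transform of the bump at frequency 0 is its integral. *)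
Lemma FC00_gt0 : 0 < FC psi 0 0.
Proof.
rewrite /FC.
have Nee : - e < e by rewrite gtrN.
have i0 := FC_integrable r0 dpsi psi0 0 0.
have := @Rintegral_ge_itv _ (fun t => psi 0 t * cos (0 * t)) _ _ 1 Nee i0.
move=> H; apply: lt_le_trans (H _ _) => /=.
- by rewrite mul1r opprK addr_gt0.
- by move=> t; rewrite mul0r cos0 mulr1.
- by move=> t; rewrite -ler_norml mul0r cos0 mulr1 => /psi_eq1 ->.
Qed.

(** By continuity the transform of psi_0 stays above half of its value at 0 on
an interval of radius d, independent of mu, where the weight is comparable with
its value at mu. *)
Lemma moment_lower s : exists2 c, 0 < c & forall mu,
  c * weight s mu <= complex.Re (moment s mu 0 0).
Proof.
have k0 := FC00_gt0; set k := FC psi 0 0 in k0.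
have [d d0 Hd] : exists2 d, 0 < d & forall t, `|t| <= d -> k / 2 <= FC psi 0 t.
  have k2 : 0 < k / 2 by rewrite divr_gt0.
  have /cvgrPdist_le/(_ _ k2)/nbhs_ballP[d /= d0 Hd] :
    FC psi 0 t @[t --> 0] --> k by exact: (continuous_FC r0 dpsi psi0).
  exists (d / 2); first by rewrite divr_gt0.
  move=> t td; have : `|k - FC psi 0 t| <= k / 2.
    by apply: Hd; rewrite /ball /= sub0r normrN; lra.
  by rewrite ler_norml; lra.
have [n Hn] := peetre s.
pose D := (1 + d ^+ 2) ^+ n.
have D0 : 0 < D by rewrite exprn_gt0// ltr_wpDr// sqr_ge0.
exists ((2 ^+ n * D)^-1 * (k / 2) ^+ 2 * (d + d)).
  rewrite mulr_gt0 ?addr_gt0// mulr_gt0//; last by rewrite exprn_gt0// divr_gt0.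
  by rewrite invr_gt0 mulr_gt0// exprn_gt0.
move=> mu.
have Ndd : mu - d < mu + d by lra.
have ReE eta : complex.Re (moment_integrand s mu 0 0 eta) =
    weight s eta * (FC psi 0 (eta - mu) ^+ 2 + FS psi 0 (eta - mu) ^+ 2).
  by rewrite /moment_integrand /Theta /=; ring.
have := @Rintegral_ge_itv _ (fun eta => complex.Re (moment_integrand s mu 0 0 eta))
  _ _ ((2 ^+ n * D)^-1 * weight s mu * (k / 2) ^+ 2) Ndd (moment_integrable s mu 0 0).1.
move=> H; apply: le_trans (H _ _).
- by rewrite le_eqVlt; apply/orP; left; apply/eqP; ring.
- by move=> eta; rewrite ReE mulr_ge0 ?addr_ge0 ?sqr_ge0// ltW// weight_gt0.
- move=> eta /andP[h1 h2]; rewrite ReE.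
  have ed : `|eta - mu| <= d by rewrite ler_norml; lra.
  apply: ler_pM; rewrite ?sqr_ge0 ?mulr_ge0 ?invr_ge0 ?(ltW (weight_gt0 _ _))//.
  + by rewrite mulr_ge0// ltW.
  + have nD : 0 < 2 ^+ n * D by rewrite mulr_gt0// exprn_gt0.
    rewrite (ler_pdivrMl _ _ nD); apply: (le_trans (Hn mu eta)).
    rewrite -!mulrA ler_wpM2l ?exprn_ge0// mulrC.
    rewrite ler_wpM2r ?(ltW (weight_gt0 _ _))//.
    rewrite lerXn2r ?nnegrE ?addr_ge0 ?sqr_ge0// lerD2l.
    rewrite -[(mu - eta) ^+ 2]sqrrN opprB -[leLHS]real_normK ?num_real//.
    by rewrite lerXn2r ?nnegrE// ltW.
  + have := Hd _ ed => kF.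
    rewrite ler_wpDr ?sqr_ge0// lerXn2r ?nnegrE//; first by rewrite divr_ge0 ?ltW.
    by rewrite (le_trans _ kF)// divr_ge0// ltW.
Qed.

End Moments.

(** * Sobolev products of sums of tensor products *)

Section TensorInner.
Variables (R : realType) (psi : nat -> R -> R) (r : R).
Notation leb := (@lebesgue_measure R).
Notation leb2 := (leb \x leb)%E.
Notation normc := Normc.normc.
Hypothesis r0 : 0 <= r.
Hypothesis dpsi : forall j t, is_derive t (1 : R) (psi j) (psi j.+1 t).
Hypothesis psi0 : forall j t, r < `|t| -> psi j t = 0.
Implicit Types (al be : nat -> R * R -> R[i]) (la mu A B : R).

(** The form of all test functions below: amplitudes al_j in the plane times
modulated derivatives of one bump in t. *)
Definition tens n al mu (p : R * R * R) : R[i] :=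
  \sum_(j < n) al j p.1 * theta psi mu j p.2.

Lemma fourier_tens n al mu z eta :
  fourier_t (tens n al mu) z eta = \sum_(j < n) al j z * Theta psi mu j eta.
Proof.
have iz (c : R[i]) j : cintegrable leb
    (fun t => c * ((cos (eta * t) -i* sin (eta * t)) * theta psi mu j t)).
  exact/cintegrableZl/(fourier_theta_integrable r0 dpsi psi0).
rewrite /fourier_t.
have -> : (fun t => (cos (eta * t) -i* sin (eta * t)) * tens n al mu (z, t)) =
   (fun t => \sum_(j < n) al j z * ((cos (eta * t) -i* sin (eta * t)) * theta psi mu j t)).
  apply/funext => t; rewrite /tens mulr_sumr; apply: eq_bigr => j _.
  by rewrite mulrCA.
rewrite (@cintegral_sum _ _ _ leb n (fun j t => al j z * ((cos (eta * t) -i* sin (eta * t)) * theta psi mu j t)))//.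
apply: eq_bigr => j _; rewrite cintegralZl.
  by rewrite (fourier_theta r0 dpsi psi0).
exact: (fourier_theta_integrable r0 dpsi psi0).
Qed.

(** Majorant of the amplitudes at scale 1/la. Its square is integrable on the
plane, with integral of order la^(-2), by comparison with a product of two
Cauchy kernels. *)
Definition plane_weight la (z : R * R) : R := (1 + (la * cabs z) ^+ 2)^-1.

Lemma plane_weight_gt0 la z : 0 < plane_weight la z.
Proof. by rewrite invr_gt0 ltr_wpDr// sqr_ge0. Qed.

Lemma plane_weight_sqr la z : plane_weight la z ^+ 2 <= ckernel2 la z.
Proof.
rewrite /plane_weight /ckernel2 /ckernel !subr0 -invfM exprVn.
have h a : 0 < 1 + (a : R) ^+ 2 by rewrite ltr_wpDr// sqr_ge0.
rewrite lef_pV2 ?posrE ?mulr_gt0 ?exprn_gt0//.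
rewrite !exprMn cabs_sqr; set a := la ^+ 2.
have a0 : 0 <= a by exact: sqr_ge0.
set x := z.1 ^+ 2; set y := z.2 ^+ 2.
have x0 : 0 <= x by exact: sqr_ge0.
have y0 : 0 <= y by exact: sqr_ge0.
have -> : (1 + a * (x + y)) ^+ 2 = (1 + a * x) * (1 + a * y) +
  (a * x + a * y + (a * x) ^+ 2 + (a * y) ^+ 2 + (a * x) * (a * y)) by ring.
have ax : 0 <= a * x by rewrite mulr_ge0.
have ay : 0 <= a * y by rewrite mulr_ge0.
have axy : 0 <= a * x * (a * y) by rewrite mulr_ge0.
by rewrite lerDl !addr_ge0// sqr_ge0.
Qed.

Definition plane_continuous (f : R * R -> R[i]) :=
  continuous (fun z => complex.Re (f z)) /\ continuous (fun z => complex.Im (f z)).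

Notation plane := (measurableTypeR R * measurableTypeR R)%type.

Lemma plane_cmeasurable f : plane_continuous f -> cmeasurable (f : plane -> R[i]).
Proof. by move=> [fr fi]; split; exact: continuous_measurable_plane. Qed.

Section Pair.
Variables (n : nat) (al be : nat -> R * R -> R[i]) (la A B : R).
Hypothesis la0 : 0 < la.
Hypothesis A0 : 0 <= A.
Hypothesis B0 : 0 <= B.
Hypothesis cal : forall j, plane_continuous (al j).
Hypothesis cbe : forall j, plane_continuous (be j).
Hypothesis alA : forall j z, normc (al j z) <= A * plane_weight la z.
Hypothesis beB : forall j z, normc (be j z) <= B * plane_weight la z.

Let pair j l (z : R * R) := al j z * conjc (be l z).

Lemma pair_cmeasurable j l : cmeasurable (pair j l : plane -> R[i]).
Proof.
by apply: cmeasurableM; last apply: cmeasurableJ; exact: plane_cmeasurable.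
Qed.

Lemma pair_bound_gen j l a b z : 0 <= a -> 0 <= b ->
  normc (al j z) <= a * plane_weight la z ->
  normc (be l z) <= b * plane_weight la z ->
  normc (pair j l z) <= a * b * ckernel2 la z.
Proof.
move=> a0 b0 ha hb; rewrite /pair Normc.normcM normcJ.
apply: (@le_trans _ _ (a * b * plane_weight la z ^+ 2)).
  have -> : a * b * plane_weight la z ^+ 2 = (a * plane_weight la z) * (b * plane_weight la z) by ring.
  by apply: ler_pM; rewrite ?normc_ge0.
by rewrite ler_wpM2l ?mulr_ge0// plane_weight_sqr.
Qed.

Lemma pair_integrable j l : cintegrable leb2 (pair j l).
Proof.
apply: (dominated_cintegrable (pair_cmeasurable j l) (C := A * B)).
- exact: mulr_ge0.
- by move=> z; exact: pair_bound_gen.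
- exact: ckernel2_integrable.
Qed.

Lemma pair_cintegral j l a b : 0 <= a -> 0 <= b ->
  (forall z, normc (al j z) <= a * plane_weight la z) ->
  (forall z, normc (be l z) <= b * plane_weight la z) ->
  normc (cintegral leb2 (pair j l)) <= 2 * (a * b * (pi / la) ^+ 2).
Proof.
move=> a0 b0 ha hb; rewrite -(ckernel2_Rintegral la0).
apply: (dominated_cintegral (pair_cmeasurable j l)).
- exact: mulr_ge0.
- by move=> z; exact: pair_bound_gen.
- exact: ckernel2_integrable.
Qed.

(** The partial Fourier transform acts on the second factors only, so the
Sobolev product is a double sum of plane integrals times frequency moments. *)
Lemma inner_tens s mu : inner s (tens n al mu) (tens n be mu) =
  \sum_(j < n) \sum_(l < n) cintegral leb2 (pair j l) * moment psi s mu j l.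
Proof.
have im j l := moment_integrable r0 dpsi psi0 s mu j l.
rewrite /inner.
have inE z : cintegral leb (fun eta => ((1 + eta ^+ 2) `^ s)%:C *
    fourier_t (tens n al mu) z eta * ((fourier_t (tens n be mu) z eta)^*)%C) =
    \sum_(j < n) \sum_(l < n) pair j l z * moment psi s mu j l.
  have -> : (fun eta => ((1 + eta ^+ 2) `^ s)%:C *
      fourier_t (tens n al mu) z eta * ((fourier_t (tens n be mu) z eta)^*)%C) =
    (fun eta => \sum_(j < n) \sum_(l < n) pair j l z * moment_integrand psi s mu j l eta).
    apply/funext => eta; rewrite !fourier_tens.
    have cs (F : 'I_n -> R[i]) : conjc (\sum_(l < n) F l) = \sum_(l < n) conjc (F l).
      exact: (rmorph_sum (@conjc R)).
    rewrite cs.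
    rewrite -mulrA mulr_suml mulr_sumr; apply: eq_bigr => j _.
    rewrite !mulr_sumr; apply: eq_bigr => l _.
    by rewrite /pair /moment_integrand /weight conjcM; ring.
  rewrite (@cintegral_sum2 _ _ _ leb n (fun j l eta => pair j l z * moment_integrand psi s mu j l eta)).
    by apply: eq_bigr => j _; apply: eq_bigr => l _; rewrite cintegralZl.
  by move=> j l; exact: cintegrableZl.
have -> : (fun z => cintegral leb (fun eta => ((1 + eta ^+ 2) `^ s)%:C *
    fourier_t (tens n al mu) z eta * ((fourier_t (tens n be mu) z eta)^*)%C)) =
    (fun z => \sum_(j < n) \sum_(l < n) moment psi s mu j l * pair j l z).
  apply/funext => z; rewrite inE; apply: eq_bigr => j _; apply: eq_bigr => l _.
  by rewrite mulrC.
rewrite (@cintegral_sum2 _ _ _ leb2 n (fun j l z => moment psi s mu j l * pair j l z)).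
  apply: eq_bigr => j _; apply: eq_bigr => l _.
  by rewrite cintegralZl; [exact: mulrC|exact: pair_integrable].
by move=> j l; apply: cintegrableZl; exact: pair_integrable.
Qed.

End Pair.

Lemma inner_tens_upper s n : exists2 C, 0 <= C & forall al be la mu A B,
  0 < la -> 0 <= A -> 0 <= B ->
  (forall j, plane_continuous (al j)) -> (forall j, plane_continuous (be j)) ->
  (forall j z, normc (al j z) <= A * plane_weight la z) ->
  (forall j z, normc (be j z) <= B * plane_weight la z) ->
  normc (inner s (tens n al mu) (tens n be mu)) <=
    C * A * B * weight s mu / la ^+ 2.
Proof.
have [K K0 HK] := moment_upper_uniform r0 dpsi psi0 s n.
exists (n%:R * (n%:R * (2 * pi ^+ 2 * K))).
  by rewrite !mulr_ge0 ?pi_ge0 ?ler0n.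
move=> al be la mu A B la0 A0 B0 cal cbe alA beB.
rewrite (inner_tens n la0 A0 B0)//.
have step (F : 'I_n -> R[i]) (c : R) : (forall i, normc (F i) <= c) ->
    normc (\sum_i F i) <= n%:R * c.
  move=> Fc; apply: (le_trans (le_normc_sum _)).
  apply: (@le_trans _ _ (\sum_(i < n) c)); first exact: ler_sum.
  by rewrite sumr_const card_ord mulr_natl.
have -> : n%:R * (n%:R * (2 * pi ^+ 2 * K)) * A * B * weight s mu / la ^+ 2 =
  n%:R * (n%:R * (2 * (A * B * (pi / la) ^+ 2) * (K * weight s mu))).
  by field; rewrite gt_eqF.
apply: (step) => j; apply: (step) => l; rewrite Normc.normcM.
apply: ler_pM; rewrite ?normc_ge0//; last exact: HK.
exact: pair_cintegral.
Qed.

Variable e : R.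
Hypothesis e0 : 0 < e.
Hypothesis psi_ge0 : forall t, 0 <= psi 0 t.
Hypothesis psi_eq1 : forall t, `|t| <= e -> psi 0 t = 1.

Lemma square_Rintegral_ge (f : plane -> R) la c : 0 < la ->
  leb2.-integrable setT (EFin \o f) -> (forall z, 0 <= f z) ->
  (forall z, in_box la^-1 z -> c <= f z) ->
  c * (4 / la ^+ 2) <= \int[leb2]_z f z.
Proof.
move=> la0 if_ f0 fc.
pose S : set (measurableTypeR R) := `[- la^-1, la^-1]%classic.
have mS : measurable S by exact: measurable_itv.
have muS : leb S = (2 / la)%:E.
  rewrite lebesgue_measure_itv /= lte_fin gtrN ?invr_gt0// -EFinB opprK.
  by congr EFin; rewrite mulr_natl mulr2n.
have muSS : leb2 (S `*` S) = (4 / la ^+ 2)%:E.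
  apply: (etrans (product_measure1E _ _ mS mS)).
  apply: (etrans (f_equal2 mule muS muS)); rewrite -EFinM; congr EFin.
  by field; rewrite gt_eqF.
have mSS : measurable (S `*` S) by exact: measurableX.
have SSoo : (leb2 (S `*` S) < +oo)%E by rewrite muSS ltry.
have -> : 4 / la ^+ 2 = fine (leb2 (S `*` S)) by rewrite muSS.
apply: (Rintegral_ge_on mSS SSoo if_ f0) => -[x y] [].
rewrite /S /= !in_itv /= -!ler_norml => hx hy; apply: fc.
by split.
Qed.

(** The (0,0) term of the double sum is bounded below on the square of side
2/la; all other terms contain an amplitude of positive index and are smaller by
a factor 1/la. *)
Lemma sqnorm_tens_lower s n : exists c C, [/\ 0 < c, 0 <= C &
  forall al la mu A b,
  0 < la -> 0 <= A -> 0 <= b ->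
  (forall j, plane_continuous (al j)) ->
  (forall j z, normc (al j z) <= A * plane_weight la z) ->
  (forall j z, normc (al j.+1 z) <= A / la * plane_weight la z) ->
  (forall z, in_box la^-1 z -> b <= normc (al 0%N z)) ->
  (c * b ^+ 2 - C * A ^+ 2 / la) * weight s mu / la ^+ 2 <=
    sqnorm s (tens n.+1 al mu)].
Proof.
have [K K0 HK] := moment_upper_uniform r0 dpsi psi0 s n.+1.
have [k k0 Hk] := moment_lower r0 dpsi psi0 e0 psi_ge0 psi_eq1 s.
pose N : R := (n.+1 * n.+1)%:R.
exists (4 * k), (N * (2 * pi ^+ 2 * K)); split.
- by rewrite mulr_gt0.
- by rewrite !mulr_ge0 ?pi_ge0 ?ler0n.
move=> al la mu A b la0 A0 b0 cal alA alA' alb.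
rewrite /sqnorm (inner_tens n.+1 la0 A0 A0)//.
rewrite (pair_big_dep xpredT (fun _ _ => true)) /=.
rewrite (bigD1 (ord0, ord0))//= ReD.
set main := _ * moment psi s mu 0 0; set rest := \sum_(p | _) _.
have restle : `|complex.Re rest| <= N * (2 * pi ^+ 2 * K) * A ^+ 2 / la * weight s mu / la ^+ 2.
  apply: (le_trans (ge_Re_normc _)).
  have -> : N * (2 * pi ^+ 2 * K) * A ^+ 2 / la * weight s mu / la ^+ 2 =
    N * (2 * (A / la * A * (pi / la) ^+ 2) * (K * weight s mu)).
    by field; rewrite gt_eqF.
  set c := 2 * _ * _.
  have c0 : 0 <= c.
    by rewrite !mulr_ge0 ?exprn_ge0 ?invr_ge0 ?(ltW la0) ?(ltW (weight_gt0 _ _))//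
      ltW// pi_gt0.
  have h (p : 'I_n.+1 * 'I_n.+1) : p != (ord0, ord0) ->
      normc (cintegral leb2 (fun z => al p.1 z * conjc (al p.2 z)) *
        moment psi s mu p.1 p.2) <= c.
    move=> p0; rewrite Normc.normcM /c; apply: ler_pM; rewrite ?normc_ge0//; last exact: HK.
    have Al0 : 0 <= A / la by rewrite divr_ge0// ltW.
    case: p p0 => -[[|j] hj] [l hl] //= p0.
      case: l hl p0 => [|l] hl p0; first by rewrite xpair_eqE -!val_eqE in p0.
      rewrite [A / la * A]mulrC.
      by apply: (pair_cintegral la0 cal cal).
    by apply: (pair_cintegral la0 cal cal).
  apply: (@le_trans _ _ (\sum_(p : 'I_n.+1 * 'I_n.+1 | p != (ord0, ord0)) c)).
    rewrite /rest; elim/big_ind2 : _ => [|x1 x2 y1 y2 hx hy|p /h//].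
      by rewrite Normc.normc0.
    by rewrite (le_trans (le_normc_D _ _))// lerD.
  rewrite big_mkcond /=; apply: (@le_trans _ _ (\sum_(p : 'I_n.+1 * 'I_n.+1) c)).
    by apply: ler_sum => p _; case: ifP.
  by rewrite sumr_const card_prod card_ord /N mulr_natl.
have mainge : 4 * k * b ^+ 2 * weight s mu / la ^+ 2 <= complex.Re main.
  rewrite /main ReM.
  have ReE z : complex.Re (al 0%N z * conjc (al 0%N z)) = normc (al 0%N z) ^+ 2.
    rewrite normcE2 sqr_sqrtr ?addr_ge0 ?sqr_ge0// ReM ReJ ImJ; ring.
  have Im0 : complex.Im (cintegral leb2 (fun z => al 0%N z * conjc (al 0%N z))) = 0.
    rewrite /cintegral /=.
    have -> : (fun z => complex.Im (al 0%N z * conjc (al 0%N z))) = (fun=> 0).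
      by apply/funext => z; rewrite ImM ReJ ImJ; ring.
    by rewrite /Rintegral integral0.
  rewrite Im0 mul0r subr0.
  have -> : 4 * k * b ^+ 2 * weight s mu / la ^+ 2 =
    (b ^+ 2 * (4 / la ^+ 2)) * (k * weight s mu) by ring.
  apply: ler_pM; last exact: Hk.
  - by rewrite !mulr_ge0 ?exprn_ge0 ?invr_ge0 ?exprn_ge0 ?(ltW la0).
  - by rewrite mulr_ge0// ltW// weight_gt0.
  - rewrite /cintegral /=; apply: (square_Rintegral_ge la0).
    + exact: (pair_integrable la0 A0 A0 cal cal alA alA 0 0).1.
    + by move=> z; rewrite ReE sqr_ge0.
    + move=> z /alb bz; rewrite ReE lerXn2r ?nnegrE ?normc_ge0//.
have -> : (4 * k * b ^+ 2 - N * (2 * pi ^+ 2 * K) * A ^+ 2 / la) * weight s mu / la ^+ 2 =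
    4 * k * b ^+ 2 * weight s mu / la ^+ 2 -
    N * (2 * pi ^+ 2 * K) * A ^+ 2 / la * weight s mu / la ^+ 2 by ring.
by apply: lerD => //; move: restle; rewrite ler_norml => /andP[].
Qed.

End TensorInner.

(** * The operators on damped tensor sums *)

Definition realC (R : realType) (Phi : R * R -> R) (z : R * R) : R[i] := (Phi z)%:C.

Section SymbolCalculus.
Variables (R : realType) (psi : nat -> R -> R) (Phi : R * R -> R).
Hypothesis dpsi : forall j t, is_derive t (1 : R) (psi j) (psi j.+1 t).
Hypothesis sPhi : smooth_on setT Phi.
Implicit Types (q al : nat -> R * R -> R[i]) (mu : R) (z : R * R) (w e : R[i]).

Let oT := @openT (R * R)%type.
Notation PhiC := (realC Phi).

Lemma csmooth_PhiC : csmooth_on setT PhiC.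
Proof. exact: csmooth_on_real. Qed.

Lemma theta_cderivable mu j t : cderivable (theta psi mu j) t (1 : R).
Proof.
have dp := dpsi j t.
have [d1 _] := is_deriveM dp (is_derive_cos_scale mu t).
have [d2 _] := is_deriveM dp (is_derive_sin_scale mu t).
split.
  suff -> : (fun y => complex.Re (theta psi mu j y)) =
    psi j * (fun t => cos (mu * t)) by exact: d1.
  by apply/funext => y; rewrite /theta /= mul0r subr0.
suff -> : (fun y => complex.Im (theta psi mu j y)) =
  psi j * (fun t => sin (mu * t)) by exact: d2.
by apply/funext => y; rewrite /theta /= mul0r addr0.
Qed.

Lemma cderive_theta mu j t : cderive (1 : R) (theta psi mu j) t =
  theta psi mu j.+1 t + 'i%C * mu%:C * theta psi mu j t.
Proof.
have dp := dpsi j t.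
have [_ d1] := is_deriveM dp (is_derive_cos_scale mu t).
have [_ d2] := is_deriveM dp (is_derive_sin_scale mu t).
have E1 : (fun y => complex.Re (theta psi mu j y)) = psi j * (fun t => cos (mu * t)).
  by apply/funext => y; rewrite /theta /= mul0r subr0.
have E2 : (fun y => complex.Im (theta psi mu j y)) = psi j * (fun t => sin (mu * t)).
  by apply/funext => y; rewrite /theta /= mul0r addr0.
rewrite /cderive E1 E2 d1 d2 /GRing.scale /=.
by apply: complex_eqP => /=; ring.
Qed.

(** Differentiating psi_j(t) in t contributes to the term of index j + 1. *)
Definition prev q j : R * R -> R[i] := if j is j'.+1 then q j' else fun=> 0.

(** The common form of L, for w = - i and e = 1, and of Lbar, for w = i and
e = - 1. *)
Definition wfield w e (v : R * R * R -> R[i]) (p : R * R * R) : R[i] :=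
  wirt w (fun z => v (z, p.2)) p.1 + e * 'i%C * wirt w PhiC p.1 * d_t v p.

Lemma opL_wfield v p : opL Phi v p = wfield (- 'i%C) 1 v p.
Proof. by rewrite /opL /wfield !d_zE mul1r. Qed.

Lemma opLbar_wfield v p : opLbar Phi v p = wfield 'i%C (- 1) v p.
Proof. by rewrite /opLbar /wfield !d_zbarE mulN1r !mulNr. Qed.

(** Symbols are the sequences of coefficients of the psi_j; each application of
L or Lbar raises the number of nonzero ones by one. *)
Definition symbol_below n q :=
  (forall j, csmooth_on setT (q j)) /\ (forall j, (n <= j)%N -> q j = fun=> 0).

Lemma symbol_belowW n n' q : (n <= n')%N -> symbol_below n q -> symbol_below n' q.
Proof. by move=> nn [sq q0]; split=> // j nj; apply: q0; exact: leq_trans nj. Qed.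

Lemma csmooth_prev q j : (forall j, csmooth_on setT (q j)) ->
  csmooth_on setT (prev q j).
Proof. by move=> sq; case: j => [|j]; [exact: csmooth_on_cst|exact: sq]. Qed.

Lemma d_t_tens n al mu p : d_t (tens psi n al mu) p =
  \sum_(j < n) al j p.1 * (theta psi mu j.+1 p.2 + 'i%C * mu%:C * theta psi mu j p.2).
Proof.
rewrite /d_t /tens /=.
have H m : cderivable (fun t => \sum_(j < m) al j p.1 * theta psi mu j t) p.2 (1 : R) /\
   cderive (1 : R) (fun t => \sum_(j < m) al j p.1 * theta psi mu j t) p.2 =
   \sum_(j < m) al j p.1 * (theta psi mu j.+1 p.2 + 'i%C * mu%:C * theta psi mu j p.2).
  elim: m => [|m [ih1 ih2]].
    under eq_fun do rewrite big_ord0.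
    by rewrite cderive_cst big_ord0; split => //; exact: cderivable_cst.
  have dc : cderivable (fun t => al m p.1 * theta psi mu m t) p.2 (1 : R).
    by apply: cderivableM; [exact: cderivable_cst|exact: theta_cderivable].
  under eq_fun do rewrite big_ord_recr /=.
  split; first exact: (cderivableD ih1 dc).
  rewrite (cderiveD ih1 dc) ih2 big_ord_recr /= cderiveM.
  - by rewrite cderive_cst mul0r add0r cderive_theta.
  - exact: cderivable_cst.
  - exact: theta_cderivable.
by case: (H n).
Qed.

Lemma wfield_tens w e n al mu : symbol_below n al ->
  wfield w e (tens psi n al mu) =
  tens psi n.+1 (fun j z => wirt w (al j) z
     + e * 'i%C * wirt w PhiC z * ('i%C * mu%:C * al j z + prev al j z)) mu.
Proof.
move=> [sal al0]; apply/funext => -[z t]; rewrite /wfield d_t_tens /tens /=.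
set c := e * 'i%C * wirt w PhiC z.
pose G j z0 := theta psi mu j t * al j z0.
have -> : (fun z0 => \sum_(j < n) al j z0 * theta psi mu j t) =
    (fun z0 => \sum_(j < n) G j z0).
  by apply/funext => z0; apply: eq_bigr => j _; rewrite /G mulrC.
have sG j : csmooth_on setT (G j).
  exact: (csmooth_onM oT (csmooth_on_cst _ oT) (sal j)).
rewrite (wirt_sum w (I : setT z) oT n sG).
have wG j : wirt w (G j) z = theta psi mu j t * wirt w (al j) z.
  exact: (wirtZ w (I : setT z) oT).
rewrite (eq_bigr (fun j : 'I_n => theta psi mu j t * wirt w (al j) z)); last first.
  by move=> j _; exact: wG.
rewrite mulr_sumr.
have -> : \sum_(j < n.+1) (wirt w (al j) z + c * ('i%C * mu%:C * al j z + prev al j z)) *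
    theta psi mu j t =
  \sum_(j < n.+1) (wirt w (al j) z + c * ('i%C * mu%:C * al j z)) * theta psi mu j t
  + \sum_(j < n.+1) c * prev al j z * theta psi mu j t.
  by rewrite -big_split /=; apply: eq_bigr => j _; ring.
rewrite [X in _ = X + _]big_ord_recr [X in _ = _ + X]big_ord_recl /=.
rewrite al0// wirt_cst mulr0 !(mul0r, mulr0, addr0, add0r) -!big_split /=.
by apply: eq_bigr => j _; rewrite /bump /=; ring.
Qed.

(** The actions of Lbar and L on the coefficients of e^(i mu (t + i Phi)) psi_j:
for Lbar the contributions of the exponential cancel, for L they add up to a
term - 2 mu Phi_z kept apart from the symbol below. *)
Definition Lbar_symbol q j z : R[i] :=
  wirt 'i%C (q j) z - 'i%C * wirt 'i%C PhiC z * prev q j z.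

Definition L_symbol q j z : R[i] :=
  wirt (- 'i%C) (q j) z + 'i%C * wirt (- 'i%C) PhiC z * prev q j z.

Definition damp mu z : R[i] := (expR (- mu * Phi z))%:C.

(** The factor damp mu is the modulus of e^(i mu (t + i Phi)). *)
Definition damped mu q j z : R[i] := damp mu z * q j z.

Lemma csmooth_damp mu : csmooth_on setT (damp mu).
Proof. exact/csmooth_on_real/smooth_on_expR. Qed.

Lemma wirt_damped w mu (f : R * R -> R[i]) z : csmooth_on setT f ->
  wirt w (fun y => damp mu y * f y) z =
  damp mu z * (wirt w f z - mu%:C * wirt w PhiC z * f z).
Proof.
move=> sf; rewrite (wirtM w (I : setT z) (csmooth_damp mu) sf).
rewrite (wirt_exp w (- mu) oT (I : setT z) sPhi) -/(realC Phi).
rewrite realcM -/(damp mu z) (_ : (- mu)%:C = - mu%:C :> R[i]); first by ring.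
by apply: complex_eqP => /=; rewrite ?oppr0.
Qed.

Lemma prev_damped mu q j z : prev (damped mu q) j z = damp mu z * prev q j z.
Proof. by case: j => //=; rewrite mulr0. Qed.

Lemma symbol_below_damped n mu q : symbol_below n q -> symbol_below n (damped mu q).
Proof.
move=> [sq q0]; split=> [j|j nj]; first exact: csmooth_onM (csmooth_damp mu) (sq j).
by apply/funext => z; rewrite /damped q0// mulr0.
Qed.

Lemma sqr_iC : 'i%C * 'i%C = - 1 :> R[i].
Proof. by apply: complex_eqP => /=; ring. Qed.

Lemma opLbar_tens n mu q : symbol_below n q ->
  opLbar Phi (tens psi n (damped mu q) mu) =
  tens psi n.+1 (damped mu (Lbar_symbol q)) mu.
Proof.
move=> sq; have -> : opLbar Phi (tens psi n (damped mu q) mu) =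
    wfield 'i%C (- 1) (tens psi n (damped mu q) mu).
  by apply/funext => p; exact: opLbar_wfield.
rewrite wfield_tens; last exact: symbol_below_damped.
apply/funext => p; apply: eq_bigr => j _; congr (_ * _).
rewrite prev_damped (wirt_damped _ _ _ (sq.1 j)) /damped /Lbar_symbol.
have i2 := sqr_iC; set W := wirt _ PhiC _.
transitivity (damp mu p.1 * (wirt 'i%C (q j) p.1 - 'i%C * W * prev q j p.1)
  - (1 + 'i%C * 'i%C) * (W * mu%:C * damp mu p.1 * q j p.1)); first by ring.
by rewrite i2 subrr mul0r subr0.
Qed.

Lemma opL_tens n mu q : symbol_below n q ->
  opL Phi (tens psi n (damped mu q) mu) =
  tens psi n.+1 (damped mu (fun j z =>
    L_symbol q j z - 2 * mu%:C * wirt (- 'i%C) PhiC z * q j z)) mu.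
Proof.
move=> sq; have -> : opL Phi (tens psi n (damped mu q) mu) =
    wfield (- 'i%C) 1 (tens psi n (damped mu q) mu).
  by apply/funext => p; exact: opL_wfield.
rewrite wfield_tens; last exact: symbol_below_damped.
apply/funext => p; apply: eq_bigr => j _; congr (_ * _).
rewrite prev_damped (wirt_damped _ _ _ (sq.1 j)) /damped /L_symbol.
have i2 := sqr_iC; set W := wirt _ PhiC _.
transitivity (damp mu p.1 * (wirt (- 'i%C) (q j) p.1 + 'i%C * W * prev q j p.1
   - 2 * mu%:C * W * q j p.1)
  + (1 + 'i%C * 'i%C) * (W * mu%:C * damp mu p.1 * q j p.1)); first by ring.
by rewrite i2 subrr mul0r addr0.
Qed.

Lemma symbol_below_Lbar n q : symbol_below n q -> symbol_below n.+1 (Lbar_symbol q).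
Proof.
move=> [sq q0]; split=> [j|[//|j] nj].
  apply: (csmooth_onD oT); first exact: (csmooth_on_wirt _ oT (sq j)).
  have := csmooth_onM oT (csmooth_onM oT (csmooth_on_cst (- 'i%C) oT)
    (csmooth_on_wirt 'i%C oT csmooth_PhiC)) (csmooth_prev j sq).
  by apply: csmooth_on_ext => // z _; rewrite !mulNr.
apply/funext => z; rewrite /Lbar_symbol /= !q0 ?(ltnW nj)//.
by rewrite wirt_cst mulr0 subr0.
Qed.

Lemma symbol_below_L n q : symbol_below n q -> symbol_below n.+1 (L_symbol q).
Proof.
move=> [sq q0]; split=> [j|[//|j] nj].
  apply: (csmooth_onD oT); first exact: (csmooth_on_wirt _ oT (sq j)).
  exact: (csmooth_onM oT (csmooth_onM oT (csmooth_on_cst 'i%C oT)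
    (csmooth_on_wirt (- 'i%C) oT csmooth_PhiC)) (csmooth_prev j sq)).
apply/funext => z; rewrite /L_symbol /= !q0 ?(ltnW nj)//.
by rewrite wirt_cst mulr0 addr0.
Qed.

Lemma symbol_below_mul n q (f : R * R -> R[i]) : csmooth_on setT f ->
  symbol_below n q -> symbol_below n (fun j z => f z * q j z).
Proof.
move=> sf [sq q0]; split=> [j|j nj]; first exact: csmooth_onM (sq j).
by apply/funext => z; rewrite q0// mulr0.
Qed.

Lemma symbol_belowD n q q' : symbol_below n q -> symbol_below n q' ->
  symbol_below n (fun j z => q j z + q' j z).
Proof.
move=> [sq q0] [sq' q0']; split=> [j|j nj]; first exact: csmooth_onD.
by apply/funext => z; rewrite q0// q0'// addr0.
Qed.

Lemma Lbar_symbolD n q q' j z : symbol_below n q -> symbol_below n q' ->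
  Lbar_symbol (fun j z => q j z + q' j z) j z = Lbar_symbol q j z + Lbar_symbol q' j z.
Proof.
move=> [sq _] [sq' _]; rewrite /Lbar_symbol (wirtD _ (I : setT z) (sq j) (sq' j)).
have -> : prev (fun j z => q j z + q' j z) j z = prev q j z + prev q' j z.
  by case: j => [|j] /=; rewrite ?addr0.
rewrite mulrDr; move: (wirt _ (q j) z) (wirt _ (q' j) z) (_ * prev q j z) (_ * prev q' j z).
by move=> a b c d; ring.
Qed.

Lemma Lbar_symbolZ n q (c : R[i]) j z : symbol_below n q ->
  Lbar_symbol (fun j z => c * q j z) j z = c * Lbar_symbol q j z.
Proof.
move=> [sq _]; rewrite /Lbar_symbol (wirtZ _ (I : setT z) oT c (sq j)).
have -> : prev (fun j z => c * q j z) j z = c * prev q j z.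
  by case: j => [|j] /=; rewrite ?mulr0.
move: (wirt _ (q j) z) (prev q j z) => a b.
by rewrite mulrBr; congr (_ - _); rewrite mulrCA.
Qed.

Variable k : nat.
Definition zeta z : R[i] := (cabs z ^+ (2 * k))%:C.

Lemma csmooth_zeta : csmooth_on setT zeta.
Proof.
have sc : csmooth_on setT (fun z => ((toC z)^*)%C : R[i]).
  exact: (csmooth_onJ oT (@csmooth_toC R)).
have := csmooth_onM oT (csmooth_onX k oT (@csmooth_toC R)) (csmooth_onX k oT sc).
by apply: csmooth_on_ext => // z _; rewrite /zeta cabs_evenC.
Qed.

(** The parts of P of degree 0 and 1 in the frequency mu: mu enters once only,
through the single factor L in each half of P. *)
Definition P_symbol0 q j z : R[i] :=
  L_symbol (Lbar_symbol q) j z + Lbar_symbol (fun j z => zeta z * L_symbol q j z) j z.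

Definition P_symbol1 q j z : R[i] :=
  - 2 * (wirt (- 'i%C) PhiC z * Lbar_symbol q j z +
    Lbar_symbol (fun j z => zeta z * wirt (- 'i%C) PhiC z * q j z) j z).

Lemma csmooth_zeta_dPhi : csmooth_on setT (fun z => zeta z * wirt (- 'i%C) PhiC z).
Proof. exact: (csmooth_onM oT csmooth_zeta (csmooth_on_wirt (- 'i%C) oT csmooth_PhiC)). Qed.

Lemma symbol_below_P0 n q : symbol_below n q -> symbol_below n.+2 (P_symbol0 q).
Proof.
move=> sq; apply: symbol_belowD.
  exact/symbol_below_L/symbol_below_Lbar.
apply: symbol_below_Lbar; apply: symbol_below_mul; first exact: csmooth_zeta.
exact: symbol_below_L.
Qed.

Lemma symbol_below_P1 n q : symbol_below n q -> symbol_below n.+2 (P_symbol1 q).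
Proof.
move=> sq; apply: symbol_below_mul; first exact: csmooth_on_cst.
apply: symbol_belowD.
  apply: symbol_below_mul; first exact: csmooth_on_wirt csmooth_PhiC.
  by apply: (symbol_belowW (leqnSn n.+1)); exact: symbol_below_Lbar.
apply: (symbol_belowW (leqnSn n.+1)); apply: symbol_below_Lbar.
exact: symbol_below_mul csmooth_zeta_dPhi sq.
Qed.

Lemma opP_tens n mu q : symbol_below n q ->
  opP k Phi (tens psi n (damped mu q) mu) =
  tens psi n.+2 (damped mu (fun j z => P_symbol0 q j z + mu%:C * P_symbol1 q j z)) mu.
Proof.
move=> sq; apply/funext => p; rewrite /opP (opLbar_tens mu sq) (opL_tens mu sq).
rewrite (opL_tens mu (symbol_below_Lbar sq)).
pose q1 j z := zeta z * L_symbol q j z.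
pose q2 j z := zeta z * wirt (- 'i%C) PhiC z * q j z.
have sq1 : symbol_below n.+1 q1.
  by apply: symbol_below_mul; [exact: csmooth_zeta|exact: symbol_below_L].
have sq2 : symbol_below n.+1 q2.
  apply: (symbol_belowW (leqnSn n)).
  exact: (symbol_below_mul csmooth_zeta_dPhi sq).
have sq2' : symbol_below n.+1 (fun j z => (- 2 * mu%:C) * q2 j z).
  exact: (symbol_below_mul (csmooth_on_cst _ oT) sq2).
set v := (fun q0 : R * R * R => _).
have -> : v = tens psi n.+1 (damped mu (fun j z => q1 j z + (- 2 * mu%:C) * q2 j z)) mu.
  apply/funext => y; rewrite /v /tens -/(zeta y.1) mulr_sumr; apply: eq_bigr => j _.
  by rewrite /damped /q1 /q2; ring.
rewrite (opLbar_tens mu (symbol_belowD sq1 sq2')) /tens -big_split /=.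
apply: eq_bigr => j _; rewrite /damped (Lbar_symbolD _ _ sq1 sq2').
by rewrite (Lbar_symbolZ _ _ _ sq2) /P_symbol0 /P_symbol1; ring.
Qed.

End SymbolCalculus.

(** * Orders of vanishing at the origin *)

Section VanishingOrder.
Variable R : realType.
Notation normc := Normc.normc.
Implicit Types (f g : R * R -> R[i]) (z : R * R) (p q : nat).

Definition vanishes_to p f := exists C r,
  [/\ 0 <= C, 0 < r & forall z, in_box r z -> normc (f z) <= C * cabs z ^+ p].

Lemma in_boxW r r' z : r <= r' -> in_box r z -> in_box r' z.
Proof. by move=> rr [h1 h2]; split; exact: le_trans rr. Qed.

Lemma cabs_le_box r z : 0 <= r -> in_box r z -> cabs z <= 2 * r.
Proof.
move=> r0 [h1 h2].
have a1 : `|z.1| ^+ 2 <= r ^+ 2 by rewrite lerXn2r ?nnegrE.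
have a2 : `|z.2| ^+ 2 <= r ^+ 2 by rewrite lerXn2r ?nnegrE.
rewrite -[leLHS]ger0_norm ?cabs_ge0// -[leRHS]ger0_norm ?mulr_ge0//.
rewrite -ler_sqr ?nnegrE// !real_normK ?num_real// cabs_sqr exprMn.
rewrite -[z.1 ^+ 2]real_normK ?num_real// -[z.2 ^+ 2]real_normK ?num_real//.
have := sqr_ge0 r; lra.
Qed.

Lemma vanishes_toW p q f : (q <= p)%N -> vanishes_to p f -> vanishes_to q f.
Proof.
move=> qp [C [r [C0 r0 H]]]; exists C, (Num.min r 2^-1); split => //.
  by rewrite lt_min r0 /= invr_gt0 ltr0n.
move=> z zr; have zr1 : in_box r z by apply: in_boxW zr; rewrite ge_min lexx.
have zr2 : in_box 2^-1 z by apply: in_boxW zr; rewrite ge_min lexx orbT.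
rewrite (le_trans (H z zr1))// ler_wpM2l// ler_wiXn2l// ?cabs_ge0//.
by rewrite (le_trans (cabs_le_box _ zr2)) ?invr_ge0// divff.
Qed.

Lemma vanishes_toD p f g : vanishes_to p f -> vanishes_to p g ->
  vanishes_to p (fun z => f z + g z).
Proof.
move=> [C [r [C0 r0 H]]] [C' [r' [C'0 r'0 H']]].
exists (C + C'), (Num.min r r'); split.
- exact: addr_ge0.
- by rewrite lt_min r0.
move=> z zr; have zr1 : in_box r z by apply: in_boxW zr; rewrite ge_min lexx.
have zr2 : in_box r' z by apply: in_boxW zr; rewrite ge_min lexx orbT.
by rewrite (le_trans (le_normc_D _ _))// mulrDl lerD// ?H ?H'.
Qed.

Lemma vanishes_toM p q f g : vanishes_to p f -> vanishes_to q g ->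
  vanishes_to (p + q) (fun z => f z * g z).
Proof.
move=> [C [r [C0 r0 H]]] [C' [r' [C'0 r'0 H']]].
exists (C * C'), (Num.min r r'); split.
- exact: mulr_ge0.
- by rewrite lt_min r0.
move=> z zr; have zr1 : in_box r z by apply: in_boxW zr; rewrite ge_min lexx.
have zr2 : in_box r' z by apply: in_boxW zr; rewrite ge_min lexx orbT.
rewrite Normc.normcM exprD mulrACA.
by apply: ler_pM; rewrite ?normc_ge0 ?H ?H'.
Qed.

Lemma vanishes_to_cst (c : R[i]) : vanishes_to 0 (fun=> c).
Proof.
exists (normc c), 1; split => //; first exact: normc_ge0.
by move=> z _; rewrite expr0 mulr1.
Qed.

Lemma vanishes_to0 p : vanishes_to p (fun=> 0).
Proof.
exists 0, 1; split => // z _.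
by rewrite Normc.normc0 mul0r.
Qed.

Lemma vanishes_toZ p (c : R[i]) f : vanishes_to p f -> vanishes_to p (fun z => c * f z).
Proof. by move=> vf; rewrite -(add0n p); exact: vanishes_toM (vanishes_to_cst c) vf. Qed.

Lemma vanishes_toX p n f : vanishes_to p f -> vanishes_to (p * n) (fun z => f z ^+ n).
Proof.
move=> vf; elim: n => [|n ih].
  by rewrite muln0; under eq_fun do rewrite expr0; exact: vanishes_to_cst.
by rewrite mulnS; under eq_fun do rewrite exprS; exact: vanishes_toM.
Qed.

Lemma vanishes_toJ p f : vanishes_to p f -> vanishes_to p (fun z => conjc (f z)).
Proof.
by move=> [C [r [C0 r0 H]]]; exists C, r; split => // z zr; rewrite normcJ; exact: H.
Qed.

Lemma vanishes_to_near p f g r : 0 < r -> (forall z, in_box r z -> f z = g z) ->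
  vanishes_to p f -> vanishes_to p g.
Proof.
move=> r0 fg [C [r' [C0 r'0 H]]]; exists C, (Num.min r r'); split => //.
  by rewrite lt_min r0.
move=> z zr; rewrite -fg; last by apply: in_boxW zr; rewrite ge_min lexx.
by apply: H; apply: in_boxW zr; rewrite ge_min lexx orbT.
Qed.

Lemma vanishes_to_ext p f g : (forall z, f z = g z) -> vanishes_to p f -> vanishes_to p g.
Proof. by move=> fg; apply: (vanishes_to_near ltr01) => z _; exact: fg. Qed.

Lemma csmooth_continuous f : csmooth_on setT f ->
  continuous (fun z => complex.Re (f z)) /\ continuous (fun z => complex.Im (f z)).
Proof.
move=> [sr si]; split => z.
  by have [] := sr [::] z I.
by have [] := si [::] z I.
Qed.

Lemma csmooth_on_vanishes0 A f : A (0, 0) -> csmooth_on A f -> vanishes_to 0 f.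
Proof.
move=> A0 [sr si].
have bnd (u : R * R -> R) : {for (0, 0), continuous u} -> exists2 r, 0 < r &
    forall z, in_box r z -> `|u z| <= `|u (0, 0)| + 1.
  move=> cu; have /cvgrPdist_le/(_ 1 ltr01)/nbhs_box[r r0 H] := cu.
  exists r => // z /H h; have -> : u z = u (0, 0) - (u (0, 0) - u z) by ring.
  by rewrite (le_trans (ler_normB _ _))// lerD2l.
have [cr _] := sr [::] _ A0; have [ci _] := si [::] _ A0.
have [r r0 Hr] := bnd _ cr; have [r' r'0 Hi] := bnd _ ci.
exists ((`|complex.Re (f (0, 0))| + 1) + (`|complex.Im (f (0, 0))| + 1)), (Num.min r r').
split; [by rewrite !addr_ge0|by rewrite lt_min r0|].
move=> z zr; rewrite expr0 mulr1 (le_trans (normc_le_parts _))// lerD//.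
  by apply: Hr; apply: in_boxW zr; rewrite ge_min lexx.
by apply: Hi; apply: in_boxW zr; rewrite ge_min lexx orbT.
Qed.

Lemma csmooth_vanishes0 f : csmooth_on setT f -> vanishes_to 0 f.
Proof. exact: csmooth_on_vanishes0. Qed.

Lemma vanishes_toMs p f g : vanishes_to p f -> csmooth_on setT g ->
  vanishes_to p (fun z => f z * g z).
Proof.
by move=> vf sg; rewrite -(addn0 p); exact: vanishes_toM vf (csmooth_vanishes0 sg).
Qed.

Lemma vanishes_to_toC : vanishes_to 1 (@toC R).
Proof. by exists 1, 1; split => // z _; rewrite mul1r expr1. Qed.

Lemma compact_box r : compact [set z : R * R | in_box r z].
Proof.
have -> : [set z : R * R | in_box r z] = `[- r, r]%classic `*` `[- r, r]%classic.
  by apply/seteqP; split => z [/=]; rewrite ?in_itv /= -?ler_norml.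
by apply: compact_setX; exact: segment_compact.
Qed.

(** Away from the origin the modulus is bounded below, so compact support turns
the local bound into a global one. *)
Lemma global_vanishing p f r : csmooth_on setT f -> 0 <= r ->
  (forall z, ~ in_box r z -> f z = 0) -> vanishes_to p f ->
  exists2 C, 0 <= C & forall z, normc (f z) <= C * cabs z ^+ p.
Proof.
move=> sf r0 f0 [C [e [C0 e0 H]]].
have [cr ci] := csmooth_continuous sf.
have bnd (u : R * R -> R) : continuous u -> exists2 M, 0 <= M &
    forall z, in_box r z -> `|u z| <= M.
  move=> cu; have [||c _ Hc] := @compact_EVT_max _ R (fun z => `|u z|) _ _ (@compact_box r).
  - by exists (0, 0); split; rewrite /= normr0.
  - by apply: continuous_subspaceT => z; exact: cvg_norm (cu z).
  - by exists `|u c| => // z zr; apply: Hc; rewrite inE.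
have [M M0 HM] := bnd _ cr; have [M' M'0 HM'] := bnd _ ci.
exists (C + (M + M') / e ^+ p).
  by rewrite addr_ge0// divr_ge0 ?addr_ge0// exprn_ge0// ltW.
move=> z; case: (pselect (in_box r z)) => zr; last first.
  rewrite f0// Normc.normc0 mulr_ge0 ?exprn_ge0 ?cabs_ge0//.
  by rewrite addr_ge0// divr_ge0 ?addr_ge0// exprn_ge0// ltW.
case: (pselect (in_box e z)) => ze.
  rewrite (le_trans (H z ze))// ler_wpM2r ?exprn_ge0 ?cabs_ge0// lerDl.
  by rewrite divr_ge0 ?addr_ge0// exprn_ge0// ltW.
have ez : e <= cabs z.
  rewrite leNgt; apply/negP => ze'; apply: ze.
  by split; [apply: (le_trans (le_cabs1 z))|apply: (le_trans (le_cabs2 z))]; exact: ltW.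
rewrite mulrDl (@le_trans _ _ ((M + M') / e ^+ p * cabs z ^+ p))//.
  rewrite -mulrA (@le_trans _ _ (M + M'))//.
    by rewrite (le_trans (normc_le_parts _))// lerD// ?HM ?HM'.
  rewrite ler_peMr ?addr_ge0// ler_pdivlMl ?exprn_gt0// mulr1.
  by rewrite lerXn2r ?nnegrE ?cabs_ge0// ltW.
by rewrite lerDr mulr_ge0// exprn_ge0// cabs_ge0.
Qed.

End VanishingOrder.

Section SymbolOrders.
Variables (R : realType) (Phi : R * R -> R) (n k : nat).
Hypothesis sPhi : smooth_on setT Phi.
Hypothesis k_gt0 : (0 < k)%N.
Notation PhiC := (realC Phi).
Let oT := @openT (R * R)%type.
Hypothesis vPhi : vanishes_to (2 * n.+1) PhiC.
Hypothesis vdPhi : vanishes_to (2 * n).+1 (wirt (- 'i%C) PhiC).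
Hypothesis vddPhi : vanishes_to (2 * n) (wirt 'i%C (wirt (- 'i%C) PhiC)).
Notation ii := ('i%C : R[i]).

Let sPhiC : csmooth_on setT PhiC := csmooth_PhiC sPhi.

Lemma conj_i : conjc ii = - ii. Proof. by apply: complex_eqP => /=; ring. Qed.
Lemma conj_Ni : conjc (- ii) = ii. Proof. by apply: complex_eqP => /=; ring. Qed.

Lemma wirt_i_PhiC z : wirt ii PhiC z = conjc (wirt (- ii) PhiC z).
Proof.
have E : (fun y => conjc (PhiC y)) = PhiC.
  by apply/funext => y; rewrite /realC conjc_real.
by have := wirtJ ii (I : setT z) sPhiC; rewrite E conj_i.
Qed.

Lemma vdbarPhi : vanishes_to (2 * n).+1 (wirt ii PhiC).
Proof.
by apply: vanishes_to_ext (vanishes_toJ vdPhi) => z; rewrite wirt_i_PhiC.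
Qed.

Lemma vddbarPhi : vanishes_to (2 * n) (wirt (- ii) (wirt ii PhiC)).
Proof.
have sd : csmooth_on setT (wirt (- ii) PhiC) by exact: csmooth_on_wirt.
apply: vanishes_to_ext (vanishes_toJ vddPhi) => z.
rewrite (_ : wirt ii PhiC = (fun y => conjc (wirt (- ii) PhiC y))); last first.
  by apply/funext => y; rewrite wirt_i_PhiC.
by rewrite (wirtJ (- ii) (I : setT z) sd) conj_Ni.
Qed.

(** Coefficient of psi^(j)(t) in the Taylor expansion of psi(t + i Phi), truncated
at order k: with them the tensor sum is almost a function of t + i Phi. *)
Definition qt (j : nat) (z : R * R) : R[i] :=
  if (j <= k)%N then (j`!%:R^-1)%:C * ('i%C * PhiC z) ^+ j else 0.

Lemma csmooth_iPhi : csmooth_on setT (fun z => ii * PhiC z).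
Proof. exact: (csmooth_onM oT (csmooth_on_cst _ oT) sPhiC). Qed.

Lemma csmooth_qt j : csmooth_on setT (qt j).
Proof.
rewrite /qt; case: (j <= k)%N; last exact: (csmooth_on_cst 0 oT).
exact: (csmooth_onM oT (csmooth_on_cst _ oT) (csmooth_onX j oT csmooth_iPhi)).
Qed.

Lemma symbol_below_qt : symbol_below k.+1 qt.
Proof.
split; first exact: csmooth_qt.
by move=> j kj; apply/funext => z; rewrite /qt leqNgt kj.
Qed.

Lemma wirt_qt w j z : wirt w (qt j) z =
  if (j <= k)%N then ii * wirt w PhiC z * prev qt j z else 0.
Proof.
rewrite /qt; case: ifPn => jk; last by rewrite wirt_cst.
rewrite (wirtZ w (I : setT z) oT _ (csmooth_onX j oT csmooth_iPhi)).
rewrite (wirtX w (I : setT z) oT j csmooth_iPhi).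
rewrite (wirtZ w (I : setT z) oT ii sPhiC).
case: j jk => [|j] jk /=; first by rewrite !mul0r !mulr0.
rewrite /qt (ltnW jk) natrc.
have -> : ((j.+1)`!%:R^-1)%:C * ((j.+1)%:R%:C * (ii * PhiC z) ^+ j * (ii * wirt w PhiC z)) =
  ((j.+1)`!%:R^-1 * (j.+1)%:R)%:C * ((ii * PhiC z) ^+ j * (ii * wirt w PhiC z)).
  by rewrite realcM; ring.
have -> : (j.+1)`!%:R^-1 * (j.+1)%:R = j`!%:R^-1 :> R.
  by rewrite factS natrM invfM mulrAC mulVf ?mul1r// pnatr_eq0.
by ring.
Qed.

(** The sum telescopes under Lbar, and only the Taylor remainder of index k + 1
survives. *)
Lemma Lbar_qt j z : Lbar_symbol Phi qt j z =
  if (j <= k)%N then 0 else - ii * (wirt ii PhiC z * prev qt j z).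
Proof.
rewrite /Lbar_symbol wirt_qt; case: ifP => _; first by rewrite subrr.
by rewrite sub0r mulNr -mulrA.
Qed.

Lemma vanish_qt j : vanishes_to (2 * n.+1 * j) (qt j).
Proof.
rewrite /qt; case: (j <= k)%N; last exact: vanishes_to0.
by apply: vanishes_toZ; apply: vanishes_toX; exact: vanishes_toZ.
Qed.

(** Only the index k + 1 contributes, with Phi^k. *)
Lemma vanish_prev_qt j : (k < j)%N -> vanishes_to (2 * n.+1 * k) (prev qt j).
Proof.
case: j => // j; rewrite ltnS leq_eqVlt => /predU1P[<-|kj] /=.
  exact: vanish_qt.
rewrite (symbol_below_qt.2 j kj); exact: vanishes_to0.
Qed.

Lemma vanish_Lbar_qt j : vanishes_to ((2 * n).+1 + 2 * n.+1 * k) (Lbar_symbol Phi qt j).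
Proof.
have E := Lbar_qt j; have [jk|kj] := leqP j k.
  by apply: vanishes_to_ext (vanishes_to0 _ _) => z; rewrite E jk.
apply: (@vanishes_to_ext _ _ (fun z => - ii * (wirt ii PhiC z * prev qt j z))).
  by move=> z; rewrite E leqNgt kj.
apply: vanishes_toZ; apply: vanishes_toM; first exact: vdbarPhi.
exact: vanish_prev_qt.
Qed.

(** The order is higher than 2 (k - 1), which is the order that the other half of P
dictates. *)
Lemma vanish_wirt_Lbar_qt j :
  vanishes_to (2 * k.-1) (wirt (- ii) (Lbar_symbol Phi qt j)).
Proof.
have E := Lbar_qt j; have [jk|kj] := leqP j k.
  apply: vanishes_to_ext (vanishes_to0 _ _) => z.
  rewrite (_ : Lbar_symbol Phi qt j = fun=> 0) ?wirt_cst//.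
  by apply/funext => y; rewrite E jk.
have sp : csmooth_on setT (prev qt j) by exact: csmooth_prev csmooth_qt.
have sw : csmooth_on setT (wirt ii PhiC) by exact: csmooth_on_wirt.
apply: (@vanishes_to_ext _ _ (fun z => - ii * (wirt (- ii) (wirt ii PhiC) z * prev qt j z
   + wirt ii PhiC z * wirt (- ii) (prev qt j) z))).
  move=> z; rewrite (_ : Lbar_symbol Phi qt j =
    (fun y => - ii * (wirt ii PhiC y * prev qt j y))); last first.
    by apply/funext => y; rewrite E leqNgt kj.
  by rewrite (wirtZ _ (I : setT z) oT _ (csmooth_onM oT sw sp)) (wirtM _ (I : setT z) sw sp).
apply: vanishes_toZ; apply: vanishes_toD.
  apply: (@vanishes_toW _ (2 * n + 2 * n.+1 * k)); first by nia.
  by apply: vanishes_toM; [exact: vddbarPhi|exact: vanish_prev_qt].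
apply: (@vanishes_toW _ ((2 * n).+1 + ((2 * n).+1 + 2 * n.+1 * k.-1))); first by nia.
apply: vanishes_toM; first exact: vdbarPhi.
case: j kj {E sp} => [//|j] kj; rewrite [prev qt _]/(qt j).
apply: (@vanishes_to_ext _ _ (fun z => if (j <= k)%N then
  ii * wirt (- ii) PhiC z * prev qt j z else 0)).
  by move=> z; rewrite wirt_qt.
case: (leqP j k) => [jk|_]; last exact: vanishes_to0.
have {jk} -> : j = k by apply/eqP; rewrite eqn_leq jk -ltnS.
apply: vanishes_toM; first exact: vanishes_toZ.
by case: k k_gt0 => // k' _ /=; apply: vanish_qt.
Qed.

Lemma vanish_zeta : vanishes_to (2 * k) (@zeta R k).
Proof.
exists 1, 1; split => // z _; rewrite /zeta normc_real mul1r ger0_norm//.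
by rewrite exprn_ge0// cabs_ge0.
Qed.

Lemma csmooth_conj_toC : csmooth_on setT (fun z => conjc (toC z) : R[i]).
Proof. exact: (csmooth_onJ oT (@csmooth_toC R)). Qed.

Lemma vanish_wirt_zeta : vanishes_to (2 * k).-1 (wirt ii (@zeta R k)).
Proof.
apply: (@vanishes_to_ext _ _ (fun z => toC z ^+ k * (k%:R * conjc (toC z) ^+ k.-1))).
  move=> z; rewrite (_ : zeta k = fun y => toC y ^+ k * conjc (toC y) ^+ k); last first.
    by apply/funext => y; rewrite /zeta cabs_evenC.
  rewrite (wirtM ii (I : setT z) (csmooth_onX k oT (@csmooth_toC R))
    (csmooth_onX k oT csmooth_conj_toC)).
  rewrite (wirtX ii (I : setT z) oT k (@csmooth_toC R)) wirt_toC_zbar mulr0 mul0r add0r.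
  rewrite (wirtX ii (I : setT z) oT k csmooth_conj_toC) wirt_conj_zbar mulr1//.
apply: (@vanishes_toW _ (1 * k + 1 * k.-1)); first by lia.
apply: vanishes_toM; first exact/vanishes_toX/vanishes_to_toC.
apply: vanishes_toZ; apply: vanishes_toX; exact/vanishes_toJ/vanishes_to_toC.
Qed.

(** The critical term is the one where Lbar falls on |z|^2k, of order 2 k - 1. *)
Lemma vanish_P_symbol0 j : vanishes_to (2 * k.-1) (P_symbol0 Phi k qt j).
Proof.
have sL := symbol_below_L sPhi symbol_below_qt.
have sLb := symbol_below_Lbar sPhi symbol_below_qt.
have sz := csmooth_zeta R k.
have swi : csmooth_on setT (wirt ii PhiC) by exact: csmooth_on_wirt.
have swn : csmooth_on setT (wirt (- ii) PhiC) by exact: csmooth_on_wirt.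
apply: vanishes_toD; first (apply: vanishes_toD; first exact: vanish_wirt_Lbar_qt).
  case: j => [|j] /=.
    by apply: vanishes_to_ext (vanishes_to0 _ _) => z; rewrite mulr0.
  apply: (@vanishes_toW _ (0 + ((2 * n).+1 + 2 * n.+1 * k))); first by nia.
  apply: vanishes_toM; last exact: vanish_Lbar_qt.
  apply: vanishes_toZ; exact: csmooth_vanishes0.
apply: (@vanishes_to_ext _ _ (fun z =>
   (wirt ii (@zeta R k) z * L_symbol Phi qt j z + zeta k z * wirt ii (L_symbol Phi qt j) z)
   + - ii * (zeta k z * (wirt ii PhiC z * prev (L_symbol Phi qt) j z)))).
  move=> z; rewrite /Lbar_symbol (wirtM ii (I : setT z) sz (sL.1 j)).
  by congr (_ + _); case: j => [|j] /=; ring.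
apply: (@vanishes_toW _ (2 * k).-1); first by lia.
apply: vanishes_toD; first apply: vanishes_toD.
- exact: vanishes_toMs vanish_wirt_zeta (sL.1 j).
- apply: (vanishes_toW (leq_pred _)).
  exact: vanishes_toMs vanish_zeta (csmooth_on_wirt ii oT (sL.1 j)).
- apply: vanishes_toZ; apply: (vanishes_toW (leq_pred _)).
  apply: (vanishes_toMs vanish_zeta (csmooth_onM oT swi _)).
  exact: csmooth_prev sL.1.
Qed.

(** The function |z|^2k Phi_z vanishes to order 2 k + 2 n + 1 and loses one order
when Lbar differentiates it; the other terms vanish to higher order. *)
Lemma vanish_P_symbol1 j : vanishes_to (2 * (k + n)) (P_symbol1 Phi k qt j).
Proof.
have sq := symbol_below_qt.
have sz := csmooth_zeta R k.
have swi : csmooth_on setT (wirt ii PhiC) by exact: csmooth_on_wirt.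
have swn : csmooth_on setT (wirt (- ii) PhiC) by exact: csmooth_on_wirt.
have szn : csmooth_on setT (fun z => zeta k z * wirt (- ii) PhiC z) by exact: csmooth_onM.
apply: vanishes_toZ; apply: vanishes_toD.
  apply: (@vanishes_toW _ ((2 * n).+1 + ((2 * n).+1 + 2 * n.+1 * k))); first by nia.
  by apply: vanishes_toM => //; exact: vanish_Lbar_qt.
apply: (@vanishes_to_ext _ _ (fun z =>
   (((wirt ii (@zeta R k) z * wirt (- ii) PhiC z + zeta k z * wirt ii (wirt (- ii) PhiC) z)
     * qt j z + (zeta k z * wirt (- ii) PhiC z) * wirt ii (qt j) z)
   + - ii * (zeta k z * wirt (- ii) PhiC z * (wirt ii PhiC z * prev qt j z))))).
  move=> z; rewrite /Lbar_symbol.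
  rewrite (wirtM ii (I : setT z) szn (csmooth_qt j)) (wirtM ii (I : setT z) sz swn).
  by congr (_ + _); case: j => [|j] /=; ring.
have vzd : vanishes_to (2 * (k + n)) (fun z => zeta k z * wirt (- ii) PhiC z).
  apply: (@vanishes_toW _ (2 * k + (2 * n).+1)); first by lia.
  by apply: vanishes_toM => //; exact: vanish_zeta.
apply: vanishes_toD; first apply: vanishes_toD.
- apply: (vanishes_toMs _ (csmooth_qt j)); apply: vanishes_toD.
    apply: (@vanishes_toW _ ((2 * k).-1 + (2 * n).+1)); first by lia.
    by apply: vanishes_toM => //; exact: vanish_wirt_zeta.
  apply: (@vanishes_toW _ (2 * k + 2 * n)); first by lia.
  by apply: vanishes_toM => //; exact: vanish_zeta.
- exact: vanishes_toMs vzd (csmooth_on_wirt ii oT (csmooth_qt j)).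
- apply: vanishes_toZ; apply: (vanishes_toMs vzd (csmooth_onM oT swi _)).
  exact: csmooth_prev csmooth_qt.
Qed.

End SymbolOrders.

Section SymbolLocality.
Variables (R : realType) (Phi : R * R -> R) (k : nat) (D : set (R * R)).
Hypothesis oD : open D.
Implicit Types q : nat -> R * R -> R[i].

Definition symbol_eq_on q q' := forall j z, D z -> q j z = q' j z.

(** The symbols of L, Lbar and P depend on their argument locally, so they may be
computed with the pure Taylor coefficients near the origin, where the cut-off is
1, and they vanish outside its support. *)
Lemma Lbar_symbol_local q q' : symbol_eq_on q q' ->
  symbol_eq_on (Lbar_symbol Phi q) (Lbar_symbol Phi q').
Proof.
move=> qq j z Dz; rewrite /Lbar_symbol (eq_on_wirt _ oD (qq j) Dz); congr (_ - _ * _).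
by case: j => //= j; exact: qq.
Qed.

Lemma L_symbol_local q q' : symbol_eq_on q q' ->
  symbol_eq_on (L_symbol Phi q) (L_symbol Phi q').
Proof.
move=> qq j z Dz; rewrite /L_symbol (eq_on_wirt _ oD (qq j) Dz); congr (_ + _ * _).
by case: j => //= j; exact: qq.
Qed.

Lemma P_symbol0_local q q' : symbol_eq_on q q' ->
  symbol_eq_on (P_symbol0 Phi k q) (P_symbol0 Phi k q').
Proof.
move=> qq j z Dz.
have h1 := L_symbol_local (Lbar_symbol_local qq) j Dz.
have qq' : symbol_eq_on (fun i y => zeta k y * L_symbol Phi q i y)
    (fun i y => zeta k y * L_symbol Phi q' i y).
  by move=> i y Dy; rewrite (L_symbol_local qq i Dy).
by rewrite /P_symbol0 h1 (Lbar_symbol_local qq' j Dz).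
Qed.

Lemma P_symbol1_local q q' : symbol_eq_on q q' ->
  symbol_eq_on (P_symbol1 Phi k q) (P_symbol1 Phi k q').
Proof.
move=> qq j z Dz.
have qq' : symbol_eq_on
    (fun i y => zeta k y * wirt (- 'i%C) (realC Phi) y * q i y)
    (fun i y => zeta k y * wirt (- 'i%C) (realC Phi) y * q' i y).
  by move=> i y Dy; rewrite (qq i y Dy).
by rewrite /P_symbol1 (Lbar_symbol_local qq j Dz) (Lbar_symbol_local qq' j Dz).
Qed.

End SymbolLocality.

(** * The probes and their Sobolev norms *)

Section ExponentialDecay.
Variable R : realType.
Notation normc := Normc.normc.

(** Split at u = 1; for u >= 1 the exponential series gives
u^(p+2) <= C exp(c u^2m) because (2 m)(p + 2) >= p + 2. *)
Lemma power_exp_decay (c : R) (m p : nat) : 0 < c -> (0 < m)%N ->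
  exists2 K, 0 <= K & forall u, 0 <= u ->
    u ^+ p * expR (- (c * u ^+ (2 * m))) * (1 + u ^+ 2) <= K.
Proof.
move=> c0 m0; pose N := (p + 2)%N.
exists (2 + 2 * N`!%:R / c ^+ N).
  by rewrite addr_ge0// divr_ge0 ?mulr_ge0// exprn_ge0// ltW.
move=> u u0; set E := expR _.
have E0 : 0 <= E by exact: expR_ge0.
have cu0 : 0 <= c * u ^+ (2 * m) by rewrite mulr_ge0 ?exprn_ge0// ltW.
have E1 : E <= 1 by rewrite -expR0 ler_expR oppr_le0.
have tail0 : 0 <= 2 * N`!%:R / c ^+ N by rewrite divr_ge0 ?mulr_ge0// exprn_ge0// ltW.
have [u1|u1] := leP u 1.
  apply: (@le_trans _ _ 2); last by rewrite lerDl.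
  have h1 : u ^+ p * E <= 1 by rewrite mulr_ile1 ?exprn_ge0 ?exprn_ile1.
  have h2 : 1 + u ^+ 2 <= 2.
    have : u ^+ 2 <= 1 by rewrite exprn_ile1.
    lra.
  rewrite -[leRHS]mul1r; apply: ler_pM => //.
    by rewrite mulr_ge0 ?exprn_ge0.
  by rewrite addr_ge0 ?sqr_ge0.
have u1' := ltW u1.
apply: (@le_trans _ _ (2 * N`!%:R / c ^+ N)); last by rewrite lerDr.
have h1 : 1 + u ^+ 2 <= 2 * u ^+ 2.
  have : 1 <= u ^+ 2 by rewrite exprn_ege1.
  lra.
have h2 : u ^+ N * E <= N`!%:R / c ^+ N.
  rewrite ler_pdivlMr ?exprn_gt0// /E expRN mulrAC ler_pdivrMr ?expR_gt0//.
  apply: le_trans (expr_le_expR N cu0).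
  rewrite exprMn mulrC ler_wpM2l ?exprn_ge0 ?(ltW c0)//.
  by rewrite -exprM ler_weXn2l//; nia.
apply: (@le_trans _ _ (u ^+ p * E * (2 * u ^+ 2))).
  by rewrite ler_wpM2l// mulr_ge0// exprn_ge0.
have -> : u ^+ p * E * (2 * u ^+ 2) = 2 * (u ^+ N * E) by rewrite /N exprD; ring.
by rewrite -mulrA ler_wpM2l.
Qed.

(** Rescaling u = la |z|: against the damping, a factor |z|^p costs la^(-p). *)
Lemma plane_decay (c : R) (m p : nat) : 0 < c -> (0 < m)%N ->
  exists2 K, 0 <= K & forall la (z : R * R), 0 < la ->
    cabs z ^+ p * expR (- (c * (la * cabs z) ^+ (2 * m))) <=
      K / la ^+ p * plane_weight la z.
Proof.
move=> c0 m0; have [K K0 HK] := power_exp_decay p c0 m0; exists K => // la z la0.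
have u0 : 0 <= la * cabs z by rewrite mulr_ge0 ?cabs_ge0// ltW.
have := HK _ u0; set E := expR _; rewrite exprMn => h.
rewrite /plane_weight ler_pdivlMr ?ltr_wpDr ?sqr_ge0//.
rewrite ler_pdivlMr ?exprn_gt0//; apply: le_trans h.
by rewrite le_eqVlt; apply/orP; left; apply/eqP; ring.
Qed.

End ExponentialDecay.

Section PlaneBump.
Variable R : realType.
Implicit Types (e : R) (z : R * R).

Definition bump2 e z : R := bump e z.1 * bump e z.2.

Lemma smooth_bump2 e : smooth_on setT (bump2 e).
Proof.
apply: (smooth_onM openT).
  have l1 (h : R) (v p : R * R) : (h *: v + p).1 = h *: v.1 + p.1 by [].
  have := smooth_on_pullback (@continuous_fst_R R) l1 openT (smooth_bump e).
  by rewrite preimage_setT.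
have l2 (h : R) (v p : R * R) : (h *: v + p).2 = h *: v.2 + p.2 by [].
have := smooth_on_pullback (@continuous_snd_R R) l2 openT (smooth_bump e).
by rewrite preimage_setT.
Qed.

Lemma bump2_eq1 e z : 0 < e -> in_box e z -> bump2 e z = 1.
Proof. by move=> e0 [h1 h2]; rewrite /bump2 !bump1// mulr1. Qed.

Lemma bump2_eq0 e z : 0 < e -> ~ in_box (2 * e) z -> bump2 e z = 0.
Proof.
move=> e0 zN; rewrite /bump2; case: (leP `|z.1| (2 * e)) => h1; last first.
  by rewrite bump0 ?mul0r// ltW.
case: (leP `|z.2| (2 * e)) => h2; last by rewrite (@bump0 _ e z.2)// ?mulr0// ltW.
by case: zN; split.
Qed.

Lemma open_box_interior r : open [set z : R * R | `|z.1| < r /\ `|z.2| < r].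
Proof.
have -> : [set z : R * R | `|z.1| < r /\ `|z.2| < r] =
    (fst : R * R -> R) @^-1` `](- r), r[%classic `&`
    (snd : R * R -> R) @^-1` `](- r), r[%classic.
  by apply/seteqP; split => z [/=]; rewrite ?in_itv /= -?ltr_norml.
apply: openI; apply: open_comp; try exact: interval_open.
  by move=> z _; exact: continuous_fst_R.
by move=> z _; exact: continuous_snd_R.
Qed.

Lemma open_box_exterior r : open [set z : R * R | ~ in_box r z].
Proof.
have -> : [set z : R * R | ~ in_box r z] = ~` [set z | in_box r z] by [].
apply: closed_openC; apply: compact_closed; last exact: compact_box.
exact: norm_hausdorff.
Qed.

End PlaneBump.

Section TestFunction.
Variables (R : realType) (Phi : R * R -> R) (n k : nat) (a sigma c : R).
Notation normc := Normc.normc.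
Notation m := n.+1.
Hypothesis k_gt0 : (0 < k)%N.
Hypothesis a0 : 0 < a.
Hypothesis c0 : 0 < c.
Hypothesis sigma1 : sigma = 1 \/ sigma = - 1.
Hypothesis sPhi : smooth_on setT Phi.
Hypothesis growth : forall z, in_box (2 * a) z ->
  c * cabs z ^+ (2 * m) <= sigma * Phi z.
Hypothesis vPhi : vanishes_to (2 * m) (realC Phi).
Hypothesis vdPhi : vanishes_to (2 * n).+1 (wirt (- 'i%C) (realC Phi)).
Hypothesis vddPhi : vanishes_to (2 * n) (wirt 'i%C (wirt (- 'i%C) (realC Phi))).
Let oT := @openT (R * R)%type.

Definition cutoff (z : R * R) : R[i] := (bump2 a z)%:C.

Lemma csmooth_cutoff : csmooth_on setT cutoff.
Proof. exact: (csmooth_on_real oT (smooth_bump2 a)). Qed.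

Lemma cutoff_eq1 z : in_box a z -> cutoff z = 1.
Proof. by move=> za; rewrite /cutoff bump2_eq1. Qed.

Lemma cutoff_eq0 z : ~ in_box (2 * a) z -> cutoff z = 0.
Proof. by move=> zN; rewrite /cutoff bump2_eq0. Qed.

Definition tpsi (j : nat) : R -> R := iter j (fun f : R -> R => 'D_1 f) (bump a).

Lemma smooth_tpsi j : smooth_on setT (tpsi j).
Proof. by elim: j => [|j ih]; [exact: smooth_bump|exact: smooth_on_derive]. Qed.

Lemma is_derive_tpsi j (t : R) : is_derive t (1 : R) (tpsi j) (tpsi j.+1 t).
Proof. by apply: derivableP; have [_] := smooth_tpsi j [::] (I : setT t); exact. Qed.

Lemma tpsi_eq0 j t : 2 * a < `|t| -> tpsi j t = 0.
Proof.
elim: j t => [|j ih] t ht; first by apply: bump0 => //; exact: ltW.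
rewrite /tpsi /= -/(tpsi j) (@near_eq_derive _ _ _ _ (cst 0)) ?derive_cst//.
near=> u; apply: ih; near: u.
by apply: (@cvgr_gt _ _ (nbhs t) _ (fun u : R => `|u|) `|t|) => //; exact: cvg_norm.
Unshelve. all: by end_near. Qed.

(** The amplitudes of the probe: the Taylor coefficients of psi(t + i Phi), cut
off to the square where the growth of Phi is known. *)
Definition symb j z : R[i] := cutoff z * qt Phi k j z.

Lemma symbol_below_symb : symbol_below k.+1 symb.
Proof. exact: (symbol_below_mul csmooth_cutoff (symbol_below_qt k sPhi)). Qed.

(** The sign makes the damping exp(- mu Phi) decay. *)
Definition freq la : R := sigma * la ^+ (2 * m).

Lemma normr_freq la : 0 < la -> `|freq la| = la ^+ (2 * m).
Proof.
move=> la0; rewrite /freq normrM [`|la ^+ _|]ger0_norm ?exprn_ge0 ?(ltW la0)//.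
by case: sigma1 => ->; rewrite ?normrN normr1 mul1r.
Qed.

Lemma normc_damp (la : R) z : 0 < la -> in_box (2 * a) z ->
  normc (damp Phi (freq la) z) <= expR (- (c * (la * cabs z) ^+ (2 * m))).
Proof.
move=> la0 zr; rewrite /damp normc_real ger0_norm ?expR_ge0// ler_expR.
rewrite /freq mulNr lerN2 exprMn mulrA [c * _]mulrC -mulrA.
rewrite [sigma * _]mulrC -[leRHS]mulrA ler_wpM2l ?exprn_ge0 ?(ltW la0)//.
exact: growth.
Qed.

(** A factor |z|^p is paid by la^(-p), as in [plane_decay]; only finitely many
coefficients are nonzero, so their constants add up to a uniform one. *)
Lemma damped_family_bound (f : nat -> R * R -> R[i]) N p :
  (forall j, csmooth_on setT (f j)) -> (forall j, (N <= j)%N -> f j = fun=> 0) ->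
  (forall j z, ~ in_box (2 * a) z -> f j z = 0) ->
  (forall j, vanishes_to p (f j)) ->
  exists2 A, 0 <= A & forall la j z, 0 < la ->
    normc (damp Phi (freq la) z * f j z) <= A / la ^+ p * plane_weight la z.
Proof.
move=> sf fN f0 vf.
have a20 : 0 <= 2 * a by rewrite mulr_ge0// ltW.
have H j := global_vanishing (sf j) a20 (f0 j) (vf j).
pose C j := projT1 (cid2 (H j)).
have C0 j : 0 <= C j by rewrite /C; case: cid2.
have HC j z : normc (f j z) <= C j * cabs z ^+ p by rewrite /C; case: cid2.
have [K K0 HK] := plane_decay p c0 (ltn0Sn n).
exists ((\sum_(j < N) C j) * K); first by rewrite mulr_ge0// sumr_ge0.
move=> la j z la0.
have w0 := ltW (plane_weight_gt0 la z).
have L0 : 0 <= (la ^+ p)^-1 by rewrite invr_ge0 exprn_ge0// ltW.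
have S0 : 0 <= \sum_(j < N) C j by rewrite sumr_ge0.
have R0 : 0 <= (\sum_(j < N) C j) * K / la ^+ p * plane_weight la z.
  by rewrite mulr_ge0// mulr_ge0// mulr_ge0.
case: (leqP N j) => [Nj|jN]; first by rewrite fN// mulr0 Normc.normc0.
case: (pselect (in_box (2 * a) z)) => zr; last by rewrite f0// mulr0 Normc.normc0.
rewrite Normc.normcM.
apply: (@le_trans _ _ (expR (- (c * (la * cabs z) ^+ (2 * m))) * (C j * cabs z ^+ p))).
  by apply: ler_pM; rewrite ?normc_ge0 ?normc_damp.
have -> : expR (- (c * (la * cabs z) ^+ (2 * m))) * (C j * cabs z ^+ p) =
  C j * (cabs z ^+ p * expR (- (c * (la * cabs z) ^+ (2 * m)))) by ring.
apply: (@le_trans _ _ (C j * (K / la ^+ p * plane_weight la z))).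
  by rewrite ler_wpM2l// HK.
have -> : (\sum_(j < N) C j) * K / la ^+ p * plane_weight la z =
  (\sum_(j < N) C j) * (K / la ^+ p * plane_weight la z) by ring.
rewrite ler_wpM2r//; first by rewrite !mulr_ge0.
exact: (le_term_sum (Ordinal jN) (fun i : 'I_N => C0 i)).
Qed.

Let inside (z : R * R) : Prop := `|z.1| < a /\ `|z.2| < a.

Let open_inside : open [set z | inside z] := @open_box_interior R a.
Let open_outside := @open_box_exterior R (2 * a).

Lemma symb_inside : symbol_eq_on [set z | inside z] symb (qt Phi k).
Proof.
move=> j z [h1 h2]; rewrite /symb cutoff_eq1 ?mul1r//.
by split; exact: ltW.
Qed.

Lemma symb_outside : symbol_eq_on [set z | ~ in_box (2 * a) z] symb (fun _ _ => 0).
Proof. by move=> j z zN; rewrite /symb cutoff_eq0// mul0r. Qed.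

Lemma near_inside p (f g : R * R -> R[i]) :
  (forall z, inside z -> f z = g z) -> vanishes_to p g -> vanishes_to p f.
Proof.
move=> fg; apply: (@vanishes_to_near _ _ _ _ (a / 2)); first by rewrite divr_gt0.
have a2 : a / 2 < a by rewrite ltr_pdivrMr// ltr_pMr// ltr1n.
by move=> z [h1 h2]; rewrite fg//; split; exact: le_lt_trans a2.
Qed.

Lemma symbol_zero_outside (T : (nat -> R * R -> R[i]) -> nat -> R * R -> R[i]) :
  (forall q q', symbol_eq_on [set z | ~ in_box (2 * a) z] q q' ->
     symbol_eq_on [set z | ~ in_box (2 * a) z] (T q) (T q')) ->
  (forall j z, T (fun _ _ => 0) j z = 0) ->
  forall j z, ~ in_box (2 * a) z -> T symb j z = 0.
Proof. by move=> loc T0 j z zN; rewrite (loc _ _ symb_outside) ?T0. Qed.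

Lemma Lbar_symbol0 j z : Lbar_symbol Phi (fun _ _ => 0) j z = 0 :> R[i].
Proof. by rewrite /Lbar_symbol wirt_cst; case: j => [|j] /=; rewrite mulr0 subr0. Qed.

Lemma L_symbol0 j z : L_symbol Phi (fun _ _ => 0) j z = 0 :> R[i].
Proof. by rewrite /L_symbol wirt_cst; case: j => [|j] /=; rewrite mulr0 addr0. Qed.

Lemma P_symbol0_0 j z : P_symbol0 Phi k (fun _ _ => 0) j z = 0.
Proof.
have E1 : Lbar_symbol Phi (fun _ _ => 0) = (fun _ _ => 0 : R[i]).
  by apply/funext => i; apply/funext => y; exact: Lbar_symbol0.
have E2 : (fun j z => zeta k z * L_symbol Phi (fun _ _ => 0) j z) = (fun _ _ => 0 : R[i]).
  by apply/funext => i; apply/funext => y; rewrite L_symbol0 mulr0.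
by rewrite /P_symbol0 E2 E1 L_symbol0 addr0.
Qed.

Lemma P_symbol1_0 j z : P_symbol1 Phi k (fun _ _ => 0) j z = 0.
Proof.
have E1 : Lbar_symbol Phi (fun _ _ => 0) = (fun _ _ => 0 : R[i]).
  by apply/funext => i; apply/funext => y; exact: Lbar_symbol0.
have E2 : (fun (j : nat) z => zeta k z * wirt (- 'i%C) (realC Phi) z * 0) = (fun _ _ => 0 : R[i]).
  by apply/funext => i; apply/funext => y; rewrite mulr0.
by rewrite /P_symbol1 E2 E1 mulr0 addr0 mulr0.
Qed.

Definition probe la := tens tpsi k.+1 (damped Phi (freq la) symb) (freq la).

Definition P_probe_symbol la j z : R[i] :=
  P_symbol0 Phi k symb j z + (freq la)%:C * P_symbol1 Phi k symb j z.

Lemma opP_probe la : opP k Phi (probe la) =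
  tens tpsi k.+3 (damped Phi (freq la) (P_probe_symbol la)) (freq la).
Proof. exact: (opP_tens is_derive_tpsi sPhi k (freq la) symbol_below_symb). Qed.

(** The number of terms must be the same in both arguments of an inner product;
padding with zero amplitudes makes the probe as long as its image under P. *)
Lemma tens_widen N N' al mu : (N <= N')%N -> (forall j, (N <= j)%N -> al j = fun=> 0) ->
  tens tpsi N al mu = tens tpsi N' al mu.
Proof.
move=> NN al0; apply/funext => p; rewrite /tens.
rewrite -(subnK NN) addnC big_split_ord /= [X in _ = _ + X]big1 ?addr0// => i _.
by rewrite al0 ?mul0r// leq_addr.
Qed.

Lemma probe_widen la : probe la = tens tpsi k.+3 (damped Phi (freq la) symb) (freq la).
Proof.
apply: tens_widen; first by rewrite ltnS leqW.
exact: (symbol_below_damped sPhi (freq la) symbol_below_symb).2.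
Qed.

Lemma symb_bound : exists2 A, 0 <= A & forall la j z, 0 < la ->
  normc (damped Phi (freq la) symb j z) <= A * plane_weight la z.
Proof.
have [sq q0] := symbol_below_symb.
have [A A0 HA] := @damped_family_bound symb k.+1 0 sq q0 symb_outside
  (fun j => csmooth_vanishes0 (sq j)).
exists A => // la j z la0; have := HA la j z la0.
by rewrite expr0 divr1.
Qed.

(** The amplitude of index j >= 1 contains the factor Phi^j and gains at least
one power of 1/la, which isolates the index 0 in the lower bound. *)
Lemma symbS_bound : exists2 A, 0 <= A & forall la j z, 0 < la ->
  normc (damped Phi (freq la) symb j.+1 z) <= A / la * plane_weight la z.
Proof.
have [sq q0] := symbol_below_symb.
have [A A0 HA] := @damped_family_bound (fun j => symb j.+1) k.+1 1
  (fun j => sq j.+1) (fun j h => q0 j.+1 (leqW h)) (fun j => symb_outside j.+1)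
  (fun j => near_inside (symb_inside j.+1)
    (vanishes_toW (leq_trans (ltn0Sn _) (leq_pmulr (2 * m) (ltn0Sn j)))
      (vanish_qt k vPhi j.+1))).
by exists A.
Qed.

(** The part of degree 1 in mu, with |mu| = la^2m, vanishes to order
2 (k + n) = 2 (k - 1) + 2 m and the part of degree 0 to order 2 (k - 1), so both
gain la^(-2(k-1)). *)
Lemma P_probe_bound : exists2 A, 0 <= A & forall la j z, 1 <= la ->
  normc (damped Phi (freq la) (P_probe_symbol la) j z) <=
    A / la ^+ (2 * k.-1) * plane_weight la z.
Proof.
have sb := symbol_below_symb.
have [s0 z0] := symbol_below_P0 sPhi k sb.
have [s1 z1] := symbol_below_P1 sPhi k sb.
have [A A0 HA] := @damped_family_bound _ _ (2 * k.-1) s0 z0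
  (symbol_zero_outside (P_symbol0_local Phi k open_outside) P_symbol0_0)
  (fun j => near_inside (P_symbol0_local Phi k open_inside symb_inside j)
    (vanish_P_symbol0 sPhi k_gt0 vPhi vdPhi vddPhi j)).
have [B B0 HB] := @damped_family_bound _ _ (2 * (k + n)) s1 z1
  (symbol_zero_outside (P_symbol1_local Phi k open_outside) P_symbol1_0)
  (fun j => near_inside (P_symbol1_local Phi k open_inside symb_inside j)
    (vanish_P_symbol1 sPhi k_gt0 vPhi vdPhi vddPhi j)).
exists (A + B); first exact: addr_ge0.
move=> la j z la1; have la0 : 0 < la by exact: lt_le_trans la1.
have w0 := ltW (plane_weight_gt0 la z).
rewrite /damped /P_probe_symbol mulrDr mulrCA (le_trans (le_normc_D _ _))//.
rewrite [in leRHS]mulrDl [in leRHS]mulrDl lerD ?HA//.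
rewrite Normc.normcM normc_real.
rewrite (normr_freq la0).
apply: (@le_trans _ _ (la ^+ (2 * m) * (B / la ^+ (2 * (k + n)) * plane_weight la z))).
  by rewrite ler_wpM2l ?exprn_ge0 ?(ltW la0)// HB.
rewrite mulrA ler_wpM2r// le_eqVlt; apply/orP; left; apply/eqP.
have -> : (2 * (k + n) = 2 * k.-1 + 2 * m)%N by lia.
have nz : la ^+ (2 * k.-1) != 0 by rewrite expf_neq0// gt_eqF.
have nz' : la ^+ (2 * m) != 0 by rewrite expf_neq0// gt_eqF.
by rewrite exprD; field; rewrite nz nz'.
Qed.

(** On the square of side 2/la the exponent mu Phi stays bounded. *)
Lemma probe_center : exists b la0, [/\ 0 < b, 1 <= la0 & forall la z, la0 <= la ->
  in_box la^-1 z -> b <= normc (damped Phi (freq la) symb 0 z)].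
Proof.
have [C [r [C0 r0 HC]]] := vPhi.
exists (expR (- (C * 2 ^+ (2 * m)))), (1 + a^-1 + r^-1); split.
- exact: expR_gt0.
- by rewrite -addrA lerDl addr_ge0// invr_ge0 ltW.
move=> la z lale zla.
have ar0 : 0 < a^-1 by rewrite invr_gt0.
have rr0 : 0 < r^-1 by rewrite invr_gt0.
have la0 : 0 < la by lra.
have za : in_box a z.
  by apply: in_boxW zla; rewrite -[a]invrK lef_pV2 ?posrE//; lra.
have zr : in_box r z.
  by apply: in_boxW zla; rewrite -[r]invrK lef_pV2 ?posrE//; lra.
rewrite /damped /symb cutoff_eq1// mul1r /qt leq0n fact0 invr1 expr0 mul1r mulr1.
rewrite /damp normc_real ger0_norm ?expR_ge0// ler_expR mulNr lerN2.
apply: (le_trans (ler_norm _)); rewrite normrM.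
rewrite (normr_freq la0).
have Pz : `|Phi z| <= C * cabs z ^+ (2 * m).
  by have := HC z zr; rewrite /realC normc_real.
rewrite (le_trans (ler_wpM2l _ Pz)) ?exprn_ge0 ?(ltW la0)//.
rewrite mulrCA ler_wpM2l// -exprMn lerXn2r ?nnegrE ?mulr_ge0 ?cabs_ge0 ?(ltW la0)//.
rewrite mulrC -ler_pdivlMr//; apply: cabs_le_box => //.
by rewrite invr_ge0 ltW.
Qed.

Lemma plane_continuous_damped q : (forall j, csmooth_on setT (q j)) -> forall la j,
  plane_continuous (damped Phi (freq la) q j).
Proof.
move=> sq la j; apply: csmooth_continuous.
exact: (csmooth_onM oT (csmooth_damp sPhi _) (sq j)).
Qed.

Lemma csmooth_P_probe la j : csmooth_on setT (P_probe_symbol la j).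
Proof.
have [s0 _] := symbol_below_P0 sPhi k symbol_below_symb.
have [s1 _] := symbol_below_P1 sPhi k symbol_below_symb.
exact: (csmooth_onD oT (s0 j) (csmooth_onM oT (csmooth_on_cst _ oT) (s1 j))).
Qed.

Let a20 : 0 <= 2 * a. Proof. by rewrite mulr_ge0// ltW. Qed.

Lemma probe_upper s : exists2 C, 0 <= C & forall la, 1 <= la ->
  [/\ sqnorm s (probe la) <= C * weight s (freq la) / la ^+ 2,
   normc (inner s (opP k Phi (probe la)) (probe la)) <=
     C / la ^+ (2 * k.-1) * weight s (freq la) / la ^+ 2 &
   sqnorm s (opP k Phi (probe la)) <=
     C / la ^+ (2 * k.-1) / la ^+ (2 * k.-1) * weight s (freq la) / la ^+ 2].
Proof.
have [K K0 HK] := inner_tens_upper a20 is_derive_tpsi tpsi_eq0 s k.+3.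
have [A A0 HA] := symb_bound; have [B B0 HB] := P_probe_bound.
have cq := plane_continuous_damped symbol_below_symb.1.
have cP la := plane_continuous_damped (csmooth_P_probe la).
pose M := A + B.
have M0 : 0 <= M by exact: addr_ge0.
exists (K * M * M); first by rewrite !mulr_ge0.
move=> la la1; have la0 : 0 < la by exact: lt_le_trans la1.
have w0 z := ltW (plane_weight_gt0 la z).
have HA' j z : normc (damped Phi (freq la) symb j z) <= M * plane_weight la z.
  by rewrite (le_trans (HA _ _ _ la0))// ler_wpM2r// /M lerDl.
pose D := M / la ^+ (2 * k.-1).
have D0 : 0 <= D by rewrite divr_ge0// exprn_ge0// ltW.
have HB' j z : normc (damped Phi (freq la) (P_probe_symbol la) j z) <= D * plane_weight la z.
  rewrite (le_trans (HB _ _ _ la1))// ler_wpM2r// ler_wpM2r ?invr_ge0 ?exprn_ge0 ?(ltW la0)//.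
  by rewrite /M lerDr.
rewrite opP_probe probe_widen; split.
- rewrite (le_trans (ler_norm _))// (le_trans (ge_Re_normc _))//.
  by rewrite (le_trans (HK _ _ la (freq la) M M la0 M0 M0 (cq la) (cq la) HA' HA')).
- rewrite (le_trans (HK _ _ la (freq la) D M la0 D0 M0 (cP la la) (cq la) HB' HA'))//.
  by rewrite le_eqVlt /D; apply/orP; left; apply/eqP; ring.
- rewrite (le_trans (ler_norm _))// (le_trans (ge_Re_normc _))//.
  rewrite (le_trans (HK _ _ la (freq la) D D la0 D0 D0 (cP la la) (cP la la) HB' HB'))//.
  by rewrite le_eqVlt /D; apply/orP; left; apply/eqP; ring.
Qed.

Lemma probe_lower s : exists c1 la1, [/\ 0 < c1, 1 <= la1 & forall la, la1 <= la ->
  c1 * weight s (freq la) / la ^+ 2 <= sqnorm s (probe la)].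
Proof.
have psi_ge0 t : 0 <= tpsi 0 t by exact: bump_ge0.
have psi_eq1 t : `|t| <= a -> tpsi 0 t = 1 by move=> ta; exact: bump1.
have [k1 [K [k10 K0 HK]]] :=
  sqnorm_tens_lower a20 is_derive_tpsi tpsi_eq0 a0 psi_ge0 psi_eq1 s k.
have [A A0 HA] := symb_bound; have [B B0 HB] := symbS_bound.
have [b [la1 [b0 la11 Hb]]] := probe_center.
pose M := A + B.
have M0 : 0 <= M by exact: addr_ge0.
have kb : 0 < k1 * b ^+ 2 by rewrite mulr_gt0// exprn_gt0.
have KM : 0 <= K * M ^+ 2 by rewrite mulr_ge0// sqr_ge0.
exists (k1 * b ^+ 2 / 2), (la1 + 2 * (K * M ^+ 2) / (k1 * b ^+ 2)); split.
- by rewrite divr_gt0.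
- by rewrite (le_trans la11)// lerDl divr_ge0 ?mulr_ge0 ?sqr_ge0// ltW// exprn_gt0.
move=> la lale.
have tail : 0 <= 2 * (K * M ^+ 2) / (k1 * b ^+ 2) by rewrite divr_ge0 ?(ltW kb)// mulr_ge0.
have la1le : la1 <= la by lra.
have la0 : 0 < la by lra.
have w0 z := ltW (plane_weight_gt0 la z).
have HA' j z : normc (damped Phi (freq la) symb j z) <= M * plane_weight la z.
  by rewrite (le_trans (HA _ _ _ la0))// ler_wpM2r// /M lerDl.
have HB' j z : normc (damped Phi (freq la) symb j.+1 z) <= M / la * plane_weight la z.
  rewrite (le_trans (HB _ _ _ la0))// ler_wpM2r// ler_wpM2r ?invr_ge0 ?(ltW la0)//.
  by rewrite /M lerDr.
have := HK (damped Phi (freq la) symb) la (freq la) M b la0 M0 (ltW b0)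
  (plane_continuous_damped symbol_below_symb.1 la) HA' HB' (fun z => Hb la z la1le).
apply: le_trans; rewrite ler_wpM2r ?invr_ge0 ?exprn_ge0 ?(ltW la0)//.
rewrite ler_wpM2r ?(ltW (weight_gt0 _ _))//.
have : K * M ^+ 2 / la <= k1 * b ^+ 2 / 2.
  rewrite ler_pdivrMr// mulrAC ler_pdivlMr// mulrC -ler_pdivrMl//.
  by rewrite mulrC; lra.
lra.
Qed.

End TestFunction.

(** * Comparison of Sobolev exponents *)

Section ExponentComparison.
Variable R : realType.

(** If e were smaller, la^(d - 4 m e) would tend to infinity; the witness la makes
it exceed the constant. *)
Lemma exponent_bound (m d : nat) (e K la1 : R) : (0 < m)%N ->
  (forall la, la1 <= la -> (1 + (la ^+ (2 * m)) ^+ 2) `^ (- e) <= K / la ^+ d) ->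
  d%:R / (4 * m%:R) <= e.
Proof.
move=> m0 H; rewrite leNgt; apply/negP => ed.
have m4 : 0 < 4 * m%:R :> R by rewrite mulr_gt0// ltr0n.
pose x : R := d%:R - 4 * m%:R * e.
have x0 : 0 < x by rewrite subr_gt0 mulrC -ltr_pdivlMr.
pose B := `|K| * 2 `^ `|e| + 1.
have B0 : 0 < B by rewrite ltr_wpDl// mulr_ge0// powR_ge0.
pose la := `|la1| + 1 + B `^ x^-1.
have p0 : 0 <= B `^ x^-1 by exact: powR_ge0.
have la_ge1 : 1 <= la by rewrite /la; have := normr_ge0 la1; lra.
have la0 : 0 < la by exact: lt_le_trans la_ge1.
have la_la1 : la1 <= la by rewrite /la; have := ler_norm la1; lra.
have Bla : B <= la `^ x.
  have -> : B = (B `^ x^-1) `^ x.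
    by rewrite -powRrM mulVf ?gt_eqF// powRr1// ltW.
  apply: ge0_ler_powR; rewrite ?nnegrE ?(ltW x0) ?(ltW la0)//.
  by rewrite /la; have := normr_ge0 la1; lra.
have /(_ la la_la1) := H; set T := 1 + _ => h.
pose L := (la ^+ (2 * m)) ^+ 2.
have L1 : 1 <= L by rewrite /L !exprn_ege1.
have L0 : 0 < L by exact: lt_le_trans L1.
have TL : L <= T by rewrite /T -/L lerDr.
have TL2 : T <= 2 * L by rewrite /T -/L; lra.
have T0 : 0 < T by exact: lt_le_trans TL.
have LE : L = la `^ (4 * m%:R).
  rewrite /L -exprM -powR_mulrn ?(ltW la0)//; congr (_ `^ _).
  by rewrite !natrM; ring.
have low : (2 `^ `|e|)^-1 * L `^ (- e) <= T `^ (- e).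
  have [e0|e0] := leP 0 e.
    rewrite ger0_norm// !powRN -invfM lef_pV2 ?posrE ?mulr_gt0 ?powR_gt0//.
    rewrite -powRM ?(ltW L0)//; apply: ge0_ler_powR; rewrite ?nnegrE ?(ltW T0)//.
    by rewrite mulr_ge0// ltW.
  have Ne : 0 <= - e by rewrite oppr_ge0 ltW.
  apply: (@le_trans _ _ (L `^ (- e))).
    rewrite ler_piMl ?powR_ge0// invf_le1 ?powR_gt0//.
    by rewrite -[X in X <= _](powRr0 2) ler_powR// ler1n.
  by apply: ge0_ler_powR; rewrite ?nnegrE ?(ltW T0) ?(ltW L0).
have : la `^ x <= `|K| * 2 `^ `|e|.
  have E : la `^ x = la ^+ d * L `^ (- e).
    rewrite -powR_mulrn ?(ltW la0)// LE -powRrM -powRD; last first.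
      by rewrite (gt_eqF la0) implybT.
    by congr (_ `^ _); rewrite /x; ring.
  have lad : 0 < la ^+ d by rewrite exprn_gt0.
  have g2 : 0 < 2 `^ `|e| :> R by rewrite powR_gt0.
  have h1 : (2 `^ `|e|)^-1 * L `^ (- e) <= `|K| / la ^+ d.
    apply: (le_trans low); apply: (le_trans h).
    by rewrite ler_wpM2r ?invr_ge0 ?(ltW lad)// ler_norm.
  rewrite E -(ler_pM2l (_ : 0 < (2 `^ `|e|)^-1 * (la ^+ d)^-1)); last first.
    by rewrite mulr_gt0 ?invr_gt0.
  have -> : (2 `^ `|e|)^-1 * (la ^+ d)^-1 * (la ^+ d * L `^ (- e)) = (2 `^ `|e|)^-1 * L `^ (- e).
    by field; rewrite !gt_eqF.
  apply: (le_trans h1); rewrite le_eqVlt; apply/orP; left; apply/eqP.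
  by field; rewrite !gt_eqF.
by move=> h2; have := le_trans Bla h2; rewrite /B; lra.
Qed.

(** A loss of e derivatives at frequency la^2m costs (1 + la^4m)^e, to be paid by a
gain of la^(-d). The term of order - N is absorbed: it is at most la^(-d) times
the weight of order s once d <= N + s. *)
Lemma sobolev_comparison (m d : nat) (s e N A C C' c1 la1 : R) (mu : R -> R) :
  (0 < m)%N -> 0 < c1 -> 0 <= A -> 0 <= C -> 0 <= C' ->
  (forall la, mu la ^+ 2 = (la ^+ (2 * m)) ^+ 2) ->
  d%:R <= N + s ->
  (forall la, la1 <= la -> c1 * weight (s - e) (mu la) / la ^+ 2 <=
     A * (C / la ^+ d * weight s (mu la) / la ^+ 2 + C' * weight (- N) (mu la) / la ^+ 2)) ->
  d%:R / (4 * m%:R) <= e.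
Proof.
move=> m0 c10 A0 C0 C'0 muE Nd H.
apply: (@exponent_bound m d e (A * (C + C') / c1) (`|la1| + 1)) => // la lale.
have la_ge1 : 1 <= la by have := normr_ge0 la1; lra.
have la0 : 0 < la by exact: lt_le_trans la_ge1.
have la_la1 : la1 <= la by have := ler_norm la1; lra.
have := H la la_la1; rewrite /weight muE.
set T := 1 + _ => h.
have T1 : 1 <= T by rewrite /T lerDl sqr_ge0.
have T0 : 0 < T by exact: lt_le_trans T1.
have Tn0 : T != 0 by rewrite gt_eqF.
have l2 : 0 < la ^+ 2 by rewrite exprn_gt0.
have lad : 0 < la ^+ d by rewrite exprn_gt0.
have Ts : 0 < T `^ s by rewrite powR_gt0.
have tail : T `^ (- N) <= T `^ s / la ^+ d.
  have -> : - N = s - (N + s) by ring.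
  rewrite powRB; last by rewrite Tn0 implybT.
  rewrite ler_wpM2l ?(ltW Ts)// lef_pV2 ?posrE ?powR_gt0//.
  apply: (@le_trans _ _ (T `^ d%:R)); last exact: ler_powR.
  rewrite powR_mulrn ?(ltW T0)// lerXn2r ?nnegrE ?(ltW T0) ?(ltW la0)//.
  rewrite /T -exprM.
  apply: (@le_trans _ _ (la ^+ (2 * m * 2))); last by rewrite lerDr.
  rewrite -[X in X <= _]expr1; apply: (ler_weXn2l la_ge1).
  by rewrite !muln_gt0 m0.
have h1 : c1 * (T `^ s * T `^ (- e)) <= A * ((C + C') * (T `^ s / la ^+ d)).
  have -> : T `^ s * T `^ (- e) = T `^ (s - e).
    by rewrite -powRD// Tn0 implybT.
  rewrite -(ler_pM2r (_ : 0 < (la ^+ 2)^-1)) ?invr_gt0//.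
  apply: (le_trans h); rewrite -mulrDl mulrA ler_wpM2r ?invr_ge0 ?(ltW l2)//.
  rewrite ler_wpM2l// mulrDl lerD//.
    by rewrite le_eqVlt; apply/orP; left; apply/eqP; ring.
  by rewrite ler_wpM2l.
rewrite -(ler_pM2l (_ : 0 < c1 * T `^ s)) ?mulr_gt0//.
rewrite -[leLHS]mulrA; apply: (le_trans h1); rewrite le_eqVlt; apply/orP; left; apply/eqP.
by field; rewrite !gt_eqF.
Qed.

End ExponentComparison.

(** * Cut-offs in space-time and locality *)

Section SmoothTrig.
Variable R : realType.

(** Linear combinations of cos (mu t) and sin (mu t) form a class stable under
derivation, contrary to the cosines alone. *)
Lemma smooth_trig (mu al be : R) :
  smooth_on setT (fun t : R => al * cos (mu * t) + be * sin (mu * t)).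
Proof.
pose T (al be : R) := fun t : R => al * cos (mu * t) + be * sin (mu * t).
have dT al' be' t : is_derive t (1 : R) (T al' be') (T (be' * mu) (- al' * mu) t).
  have := is_deriveD
    (is_deriveM (is_derive_cst al' t (1 : R)) (is_derive_cos_scale mu t))
    (is_deriveM (is_derive_cst be' t (1 : R)) (is_derive_sin_scale mu t)).
  by move/is_derive_eq; apply; rewrite !scaler0 !addr0 /T /GRing.scale /=; ring.
apply: (@smooth_coind _ _ _ (fun f => exists al be, f = T al be)) => //.
- exact: openT.
- move=> f [al' [be' ->]] t _; split.
    apply/differentiable_continuous/derivable1_diffP.
    by have [] := dT al' be' t.
  by move=> v; have [] := is_derive_comp1 (is_derive_id t v) (dT al' be' t).
- move=> f v [al' [be' ->]].
  exists (T (v * (be' * mu)) (v * (- al' * mu))).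
    by exists (v * (be' * mu)), (v * (- al' * mu)).
  move=> t _; have [_] := is_derive_comp1 (is_derive_id t v) (dT al' be' t).
  rewrite [X in 'D_v X _](_ : _ = T al' be')// => ->.
  by rewrite /T; ring.
- by exists al, be.
Qed.

Lemma smooth_cos (mu : R) : smooth_on setT (fun t : R => cos (mu * t)).
Proof.
apply: smooth_on_ext (smooth_trig mu 1 0); first exact: openT.
by move=> t _; rewrite mul1r mul0r addr0.
Qed.

Lemma smooth_sin (mu : R) : smooth_on setT (fun t : R => sin (mu * t)).
Proof.
apply: smooth_on_ext (smooth_trig mu 0 1); first exact: openT.
by move=> t _; rewrite mul1r mul0r add0r.
Qed.

End SmoothTrig.

Section SpaceTimeBoxes.
Variable R : realType.
Implicit Types (p : R * R * R) (r e : R).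

Definition box3 r : set (R * R * R) := [set p | in_box r p.1 /\ `|p.2| <= r].

Lemma compact_box3 r : compact (box3 r).
Proof.
have -> : box3 r = [set z | in_box r z] `*` `[- r, r]%classic.
  by apply/seteqP; split => p [h1 h2]; split => //; move: h2;
    rewrite /= in_itv /= -ler_norml.
by apply: compact_setX; [exact: compact_box|exact: segment_compact].
Qed.

Lemma closed_box3 r : closed (box3 r).
Proof. by apply: compact_closed; [exact: norm_hausdorff|exact: compact_box3]. Qed.

Lemma supp_box3 (f : R * R * R -> R[i]) r : (forall p, ~ box3 r p -> f p = 0) ->
  supp f `<=` box3 r.
Proof.
move=> f0; rewrite /supp closureE; apply: bigcap_inf => /=; split.
  exact: closed_box3.
by move=> p /= /eqP fp; apply: contrapT => /f0.
Qed.

Lemma compact_supp_box3 (f : R * R * R -> R[i]) r : (forall p, ~ box3 r p -> f p = 0) ->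
  compact (supp f).
Proof.
move=> f0; apply: (subclosed_compact _ (@compact_box3 r)); last exact: supp_box3.
exact: closed_closure.
Qed.

Lemma nbhs_box3 (V : set (R * R * R)) : nbhs ((0, 0, 0) : R * R * R) V ->
  exists2 r, 0 < r & box3 r `<=` V.
Proof.
move=> /nbhs_ballP[e /= e0 he]; exists (e / 2); first by rewrite divr_gt0.
have e2 : e / 2 < e by rewrite ltr_pdivrMr// ltr_pMr// ltr1n.
move=> [[x y] t] [/= [/= hx hy] ht]; apply: he.
by split; [split|]; rewrite /ball /= sub0r normrN; exact: le_lt_trans e2.
Qed.

Lemma box3W r e : r <= e -> box3 r `<=` box3 e.
Proof. by move=> re p [h1 h2]; split; [exact: in_boxW re h1|exact: le_trans re]. Qed.

Definition bump3 e p : R := bump2 e p.1 * bump e p.2.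

Lemma continuous_fst3 : continuous (fst : R * R * R -> R * R).
Proof. by move=> p; exact: cvg_fst. Qed.

Lemma continuous_snd3 : continuous (snd : R * R * R -> R).
Proof. by move=> p; exact: cvg_snd. Qed.

Lemma smooth_on_fst3 (f : R * R -> R) : smooth_on setT f ->
  smooth_on setT (fun p : R * R * R => f p.1).
Proof.
move=> sf.
have l1 (h : R) (v p : R * R * R) : (h *: v + p).1 = h *: v.1 + p.1 by [].
have := smooth_on_pullback continuous_fst3 l1 openT sf.
by rewrite preimage_setT.
Qed.

Lemma smooth_on_snd3 (f : R -> R) : smooth_on setT f ->
  smooth_on setT (fun p : R * R * R => f p.2).
Proof.
move=> sf.
have l1 (h : R) (v p : R * R * R) : (h *: v + p).2 = h *: v.2 + p.2 by [].
have := smooth_on_pullback continuous_snd3 l1 openT sf.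
by rewrite preimage_setT.
Qed.

Lemma smooth_bump3 e : smooth_on setT (bump3 e).
Proof.
apply: (smooth_onM openT); first exact: smooth_on_fst3 (smooth_bump2 e).
exact: smooth_on_snd3 (smooth_bump e).
Qed.

Lemma bump3_eq1 e p : 0 < e -> box3 e p -> bump3 e p = 1.
Proof. by move=> e0 [h1 h2]; rewrite /bump3 bump2_eq1// bump1// mulr1. Qed.

Lemma bump3_eq0 e p : 0 < e -> ~ box3 (2 * e) p -> bump3 e p = 0.
Proof.
move=> e0 pN; rewrite /bump3; case: (pselect (in_box (2 * e) p.1)) => h1; last first.
  by rewrite bump2_eq0// mul0r.
case: (leP `|p.2| (2 * e)) => h2; last by rewrite bump0 ?mulr0// ltW.
by case: pN.
Qed.

Lemma near_box3 r e p : r < e -> box3 r p -> \forall q \near p, box3 e q.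
Proof.
move=> re [[h1 h2] h3].
have lt (u : R * R * R -> R) : continuous u -> `|u p| <= r -> \forall q \near p, `|u q| <= e.
  move=> cu up; near=> q'; apply: ltW.
  near: q'; apply: (@cvgr_lt _ _ (nbhs p) _ (fun q => `|u q|) `|u p|).
    exact: cvg_norm (cu p).
  exact: le_lt_trans re.
have n1 : \forall q \near p, `|q.1.1| <= e.
  apply: (lt (fun q => q.1.1)) => // q.
  by apply: (continuous_comp (@continuous_fst3 q)); exact: continuous_fst_R.
have n2 : \forall q \near p, `|q.1.2| <= e.
  apply: (lt (fun q => q.1.2)) => // q.
  by apply: (continuous_comp (@continuous_fst3 q)); exact: continuous_snd_R.
have n3 : \forall q \near p, `|q.2| <= e.
  by apply: (lt (fun q => q.2)) => //; exact: continuous_snd3.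
by near=> q; split; [split|]; near: q.
Unshelve. all: by end_near. Qed.

Lemma test_function_bump3 e (A : set (R * R * R)) : 0 < e -> box3 (2 * e) `<=` A ->
  test_function A (fun p => (bump3 e p)%:C).
Proof.
move=> e0 eA.
have z p : ~ box3 (2 * e) p -> (bump3 e p)%:C = 0 :> R[i] by move=> /bump3_eq0 ->.
split; first exact: (csmooth_on_real openT (smooth_bump3 e)).
  exact: compact_supp_box3 z.
exact: subset_trans (supp_box3 z) eA.
Qed.

Lemma csmooth_tens psi n (al : nat -> R * R -> R[i]) mu :
  (forall j, smooth_on setT (psi j)) -> (forall j, csmooth_on setT (al j)) ->
  csmooth_on setT (tens psi n al mu).
Proof.
move=> spsi sal; apply: (csmooth_on_sum (F := fun j p => al j p.1 * theta psi mu j p.2) n openT).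
move=> j; apply: (csmooth_onM openT).
  by split; [exact: smooth_on_fst3 (sal j).1|exact: smooth_on_fst3 (sal j).2].
have sR : smooth_on setT (fun t => psi j t * cos (mu * t)).
  exact: (smooth_onM openT (spsi j) (smooth_cos mu)).
have sI : smooth_on setT (fun t => psi j t * sin (mu * t)).
  exact: (smooth_onM openT (spsi j) (smooth_sin mu)).
split.
  apply: smooth_on_ext (smooth_on_snd3 sR); first exact: openT.
  by move=> p _; rewrite /theta /= mul0r subr0.
apply: smooth_on_ext (smooth_on_snd3 sI); first exact: openT.
by move=> p _; rewrite /theta /= mul0r addr0.
Qed.

Lemma sqnorm_ge0 s (v : R * R * R -> R[i]) : 0 <= sqnorm s v.
Proof.
have ReE d (T : measurableType d) (mu : {measure set T -> \bar R}) (f : T -> R[i]) :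
  complex.Re (cintegral mu f) = \int[mu]_x complex.Re (f x) by [].
rewrite /sqnorm /inner ReE; apply: Rintegral_ge0 => z _; rewrite ReE.
apply: Rintegral_ge0 => eta _; rewrite -mulrA.
set a := fourier_t v z eta; set w := _ `^ s.
have -> : complex.Re (w%:C * (a * conjc a)) =
    w * (complex.Re a ^+ 2 + complex.Im a ^+ 2).
  by case: a => x y /=; ring.
by rewrite mulr_ge0 ?powR_ge0// addr_ge0 ?sqr_ge0.
Qed.

End SpaceTimeBoxes.

Section OperatorLocality.
Variables (R : realType) (F Phi : R * R -> R) (C0 r : R) (D : set (R * R)).
Hypothesis oD : open D.
Hypothesis sPhi : smooth_on setT Phi.
Hypothesis box_D : forall z, in_box r z -> D z.
Hypothesis F_Phi : forall z, D z -> F z = Phi z + C0.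

(** Only the derivatives of the phase enter L and Lbar, and they do not see the
constant C0. *)
Lemma wirt_shift w z : D z -> wirt w (realC F) z = wirt w (realC Phi) z.
Proof.
move=> Dz; have oT := @openT (R * R)%type.
have E y : D y -> realC F y = realC Phi y + C0%:C.
  by move=> Dy; rewrite /realC F_Phi// realcD.
rewrite (eq_on_wirt w oD E Dz).
rewrite (wirtD w (I : setT z) (csmooth_PhiC sPhi) (csmooth_on_cst C0%:C oT)).
by rewrite wirt_cst addr0.
Qed.

Lemma wfield_outside w e (G : R * R -> R) (v : R * R * R -> R[i]) :
  (forall z t, ~ in_box r z -> v (z, t) = 0) ->
  forall z t, ~ in_box r z -> wfield G w e v (z, t) = 0.
Proof.
move=> v0 z t zN; rewrite /wfield /d_t /=.
have -> : (fun t0 => v (z, t0)) = (fun=> 0) by apply/funext => t'; exact: v0.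
rewrite cderive_cst mulr0 addr0.
rewrite (eq_on_wirt w (@open_box_exterior R r) (fun y yN => v0 y t yN) zN).
by rewrite wirt_cst.
Qed.

Lemma wfield_local w e (v : R * R * R -> R[i]) :
  (forall z t, ~ in_box r z -> v (z, t) = 0) -> wfield F w e v = wfield Phi w e v.
Proof.
move=> v0; apply/funext => -[z t]; case: (pselect (in_box r z)) => zr; last first.
  by rewrite !wfield_outside.
by rewrite /wfield (wirt_shift w (box_D zr)).
Qed.

(** On functions supported over a box where F and Phi differ by a constant the two
operators agree; outside the box both give 0. *)
Lemma opP_local k (v : R * R * R -> R[i]) :
  (forall z t, ~ in_box r z -> v (z, t) = 0) -> opP k F v = opP k Phi v.
Proof.
have LE (G : R * R -> R) u : opL G u = wfield G (- 'i%C) 1 u.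
  by apply/funext => p; exact: opL_wfield.
have LbE (G : R * R -> R) u : opLbar G u = wfield G 'i%C (- 1) u.
  by apply/funext => p; exact: opLbar_wfield.
move=> v0; apply/funext => p; rewrite /opP !LbE !LE.
rewrite (wfield_local 'i%C (- 1) v0) (wfield_local (- 'i%C) 1 v0).
rewrite (wfield_local (- 'i%C) 1 (wfield_outside 'i%C (- 1) Phi v0)).
rewrite (@wfield_local 'i%C (- 1) (fun q => _ * _))//.
by move=> z t zN; rewrite (wfield_outside (- 'i%C) 1 Phi v0)// mulr0.
Qed.

End OperatorLocality.

Section GlobalPhase.
Variables (R : realType) (n : nat) (U : set (R * R)) (F : R * R -> R).
Variables (g h : R * R -> R[i]).
Notation normc := Normc.normc.
Notation m := n.+1.
Hypothesis oU : open U.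
Hypothesis U0 : U (0, 0).
Hypothesis sF : smooth_on U F.
Hypothesis sg : csmooth_on U g.
Hypothesis sh : csmooth_on U h.
Hypothesis F_zzbar : forall z, U z ->
  d_zbar (d_z (fun w => (F w)%:C)) z = (cabs z ^+ (2 * n))%:C * g z.
Hypothesis F_z : forall z, U z ->
  d_z (fun w => (F w)%:C) z = ((toC z)^*)%C * (cabs z ^+ (2 * n))%:C * h z.
Hypothesis g0 : g (0, 0) != 0.

(** Cutting off F - F(0) provides a phase that is smooth on the whole plane and
retains the growth and the orders of vanishing on the boxes where the probes
live. *)
Lemma global_phase : exists sigma c r : R,
  [/\ sigma = 1 \/ sigma = - 1, 0 < c, 0 < r,
   forall z, in_box r z -> U z &
   forall a, 0 < a -> 6 * a <= r -> exists Phi : R * R -> R,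
     [/\ smooth_on setT Phi,
      forall z, `|z.1| < 3 * a /\ `|z.2| < 3 * a -> F z = Phi z + F (0, 0),
      forall z, in_box (2 * a) z -> c * cabs z ^+ (2 * m) <= sigma * Phi z,
      vanishes_to (2 * m) (realC Phi) &
      vanishes_to (2 * n).+1 (wirt (- 'i%C) (realC Phi)) /\
      vanishes_to (2 * n) (wirt 'i%C (wirt (- 'i%C) (realC Phi)))]].
Proof.
have [sigma [c [C [r [s1 c0 C0 r0 H]]]]] := phase_growth oU U0 sF sg sh F_zzbar F_z g0.
exists sigma, c, r; split => //; first by move=> z /H[].
move=> a a0 ar.
have a30 : 0 < 3 * a by rewrite mulr_gt0.
pose D : set (R * R) := [set z | `|z.1| < 3 * a /\ `|z.2| < 3 * a].
have oD : open D by exact: open_box_interior.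
have Dbox z : D z -> in_box (3 * a) z by move=> [h1 h2]; split; exact: ltW.
have DU z : D z -> U z.
  move=> /Dbox zr; have /H[//] : in_box r z by apply: in_boxW zr; lra.
pose G z := F z + - F (0, 0).
pose Phi z := bump2 (3 * a) z * G z.
have oT := @openT (R * R)%type.
have sG : smooth_on U G by exact: (smooth_onD oU sF (smooth_on_cst (- F (0, 0)) oU)).
have sPhi : smooth_on setT Phi.
  have e63 : 2 * (3 * a) = 6 * a by ring.
  have oX := @open_box_exterior R (6 * a).
  have -> : setT = U `|` [set z : R * R | ~ in_box (6 * a) z].
    apply/esym/seteqP; split => // z _; case: (pselect (in_box (6 * a) z)) => zr.
      by left; have /H[] : in_box r z by exact: in_boxW zr.
    by right.
  apply: smooth_onU.
    exact: (smooth_onM oU (smooth_on_sub (subsetT _) (smooth_bump2 (3 * a))) sG).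
  apply: smooth_on_ext (smooth_on_cst 0 oX) => // z zN.
  by rewrite /Phi bump2_eq0 ?mul0r// e63.
have PhiD z : D z -> Phi z = G z.
  by move=> /Dbox zr; rewrite /Phi bump2_eq1// mul1r.
have dPhi w z : D z -> wirt w (realC Phi) z = wirt w (realC F) z.
  move=> Dz; apply/esym; apply: (wirt_shift oD sPhi (C0 := F (0, 0))) => // y Dy.
  by rewrite PhiD// /G subrK.
have D3 : 3 * a / 2 < 3 * a by lra.
have near_D p f f' : (forall z, D z -> f z = f' z) -> vanishes_to p f' ->
    vanishes_to p (f : R * R -> R[i]).
  move=> ff; apply: (@vanishes_to_near _ _ _ _ (3 * a / 2)); first by rewrite divr_gt0.
  by move=> z [h1 h2]; rewrite ff//; split; exact: le_lt_trans D3.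
have vz p : vanishes_to p (fun z : R * R => (cabs z ^+ p)%:C : R[i]).
  exists 1, 1; split => // z _; rewrite normc_real mul1r ger0_norm//.
  by rewrite exprn_ge0// cabs_ge0.
exists Phi; split => //.
- by move=> z Dz; rewrite PhiD// /G subrK.
- move=> z zr; have Dz : D z.
    by case: zr => h1 h2; split; [apply: le_lt_trans h1 _|apply: le_lt_trans h2 _]; lra.
  by rewrite PhiD//; have /H[] : in_box r z by apply: in_boxW zr; lra.
- exists C, (3 * a / 2); split => //; first by rewrite divr_gt0.
  move=> z zr; have Dz : D z.
    by case: zr => h1 h2; split; exact: le_lt_trans D3.
  rewrite /realC normc_real PhiD//.
  by have /H[] : in_box r z by apply: in_boxW zr; lra.
split.
  apply: near_D (_ : vanishes_to _ (fun z => conjc (toC z) * (cabs z ^+ (2 * n))%:C * h z)).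
    by move=> z Dz; rewrite dPhi// -d_zE F_z//; exact: DU.
  have -> : (2 * n).+1 = (1 + 2 * n + 0)%N by rewrite addn0.
  apply: vanishes_toM; last exact: csmooth_on_vanishes0 U0 sh.
  by apply: vanishes_toM; [apply: vanishes_toJ; exact: vanishes_to_toC|exact: vz].
apply: near_D (_ : vanishes_to _ (fun z => (cabs z ^+ (2 * n))%:C * g z)).
  move=> z Dz; rewrite -F_zzbar; last exact: DU.
  rewrite d_zbarE; apply: (eq_on_wirt _ oD _ Dz) => y Dy.
  by rewrite dPhi// -d_zE.
rewrite -[(2 * n)%N]addn0; apply: vanishes_toM; last exact: csmooth_on_vanishes0 U0 sg.
by rewrite addn0; exact: vz.
Qed.

End GlobalPhase.

(** * The two necessary conditions *)

Section ProbeFamily.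
Variables (R : realType) (m k : nat) (U : set (R * R)) (F : R * R -> R).
Variables (g h : R * R -> R[i]).
Notation normc := Normc.normc.
Hypothesis m_ge1 : (1 <= m)%N.
Hypothesis k_ge1 : (1 <= k)%N.
Hypothesis U_open : open U.
Hypothesis U0 : U (0, 0).
Hypothesis F_smooth : smooth_on U F.
Hypothesis g_smooth : csmooth_on U g.
Hypothesis h_smooth : csmooth_on U h.
Hypothesis F_zzbar : forall z, U z ->
  d_zbar (d_z (fun w => (F w)%:C)) z = (cabs z ^+ (2 * (m - 1)))%:C * g z.
Hypothesis F_z : forall z, U z ->
  d_z (fun w => (F w)%:C) z = ((toC z)^*)%C * (cabs z ^+ (2 * (m - 1)))%:C * h z.
Hypothesis g_neq0 : forall z, U z -> g z != 0.

Lemma tens_supp (psi : nat -> R -> R) n (al : nat -> R * R -> R[i]) mu a :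
  (forall j z, ~ in_box a z -> al j z = 0) ->
  (forall j t, a < `|t| -> psi j t = 0) ->
  forall p, ~ box3 a p -> tens psi n al mu p = 0.
Proof.
move=> al0 psi0 p pN; rewrite /tens big1// => j _.
case: (pselect (in_box a p.1)) => p1; last by rewrite al0// mul0r.
case: (leP `|p.2| a) => p2; first by case: pN.
by rewrite /theta psi0// mul0r mulr0.
Qed.

(** The properties of the probes that the necessary conditions use: they are
supported in an arbitrarily small box, as are their images under P, and their
norms are governed by the frequency and the power of la gained by P. *)
Lemma probe_family : exists2 r0, 0 < r0 & (forall z, in_box r0 z -> U z) /\
  forall e, 0 < e -> e <= r0 ->
  exists (v : R -> R * R * R -> R[i]) (mu : R -> R),
  [/\ forall la, mu la ^+ 2 = (la ^+ (2 * m)) ^+ 2,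
      forall la, csmooth_on setT (v la),
      forall la p, ~ box3 e p -> v la p = 0,
      forall la p, ~ box3 e p -> opP k F (v la) p = 0 &
      forall s, (exists2 C, 0 <= C & forall la, 1 <= la ->
          [/\ sqnorm s (v la) <= C * weight s (mu la) / la ^+ 2,
              normc (inner s (opP k F (v la)) (v la)) <=
                C / la ^+ (2 * k.-1) * weight s (mu la) / la ^+ 2 &
              sqnorm s (opP k F (v la)) <=
                C / la ^+ (2 * k.-1 + 2 * k.-1) * weight s (mu la) / la ^+ 2]) /\
        exists c1 la1, [/\ 0 < c1, 1 <= la1 & forall la, la1 <= la ->
          c1 * weight s (mu la) / la ^+ 2 <= sqnorm s (v la)]].
Proof.
case: m m_ge1 F_zzbar F_z => [//|n] _; rewrite subn1 [n.+1.-1]/= => Fzz Fz.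
have [sigma [c [r [s1 c0 r0 rU H]]]] :=
  global_phase U_open U0 F_smooth g_smooth h_smooth Fzz Fz (g_neq0 U0).
exists (r / 3); first by rewrite divr_gt0.
split=> [z zr|e e0 er]; first by apply: rU; apply: in_boxW zr; lra.
pose a := e / 2; have a0 : 0 < a by rewrite divr_gt0.
have ea : 2 * a = e by rewrite /a; field.
have ar : 6 * a <= r by lra.
have [Phi [sPhi F_Phi growth vPhi [vdPhi vddPhi]]] := H a a0 ar.
have P0 la j z : ~ in_box (2 * a) z -> P_probe_symbol Phi n k a sigma la j z = 0.
  move=> zN; have oX := @open_box_exterior R (2 * a).
  rewrite /P_probe_symbol.
  rewrite (symbol_zero_outside Phi k a0 (P_symbol0_local Phi k oX) (P_symbol0_0 Phi k) j zN).
  rewrite (symbol_zero_outside Phi k a0 (P_symbol1_local Phi k oX) (P_symbol1_0 Phi k) j zN).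
  by rewrite mulr0 addr0.
have v0 la p : ~ box3 e p -> probe Phi n k a sigma la p = 0.
  rewrite -ea; apply: tens_supp => [j z zN|j t]; last exact: tpsi_eq0.
  by rewrite /damped (symb_outside Phi k a0 j zN) mulr0.
have Pv la : opP k F (probe Phi n k a sigma la) = opP k Phi (probe Phi n k a sigma la).
  apply: (opP_local (@open_box_interior R (3 * a)) sPhi _ F_Phi k (r := e)).
    by move=> z [h1 h2]; split; [apply: le_lt_trans h1 _|apply: le_lt_trans h2 _]; lra.
  by move=> z t zN; apply: v0 => -[].
exists (probe Phi n k a sigma), (freq n sigma); split.
- move=> la; rewrite /freq exprMn.
  by case: s1 => ->; rewrite ?sqrrN expr1n mul1r.
- move=> la; apply: csmooth_tens; first exact: smooth_tpsi.
  exact: (symbol_below_damped sPhi _ (symbol_below_symb k a sPhi)).1.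
- exact: v0.
- move=> la p; rewrite Pv opP_probe// -ea.
  apply: tens_supp => [j z zN|j t]; last exact: tpsi_eq0.
  by rewrite /damped P0// mulr0.
move=> s; split; last exact: (probe_lower k a0 c0 s1 sPhi growth vPhi s).
have [C C0 HC] := probe_upper k_ge1 a0 c0 s1 sPhi growth vPhi vdPhi vddPhi s.
exists C => // la la1; have [u1 u2 u3] := HC la la1; rewrite !Pv; split => //.
by rewrite exprD invfM mulrA.
Qed.

End ProbeFamily.

Theorem proposition1p3 (R : realType) (m k : nat) (U : set (R * R))
    (F : R * R -> R) (g h b : R * R -> R[i]) (W : set R) (f : R -> R[i])
    (m_ge1 : (1 <= m)%N) (k_ge1 : (1 <= k)%N)
    (U_open : open U) (U0 : U (0, 0))
    (F_smooth : smooth_on U F)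
    (g_smooth : csmooth_on U g) (h_smooth : csmooth_on U h)
    (F_zzbar : forall z, U z ->
      d_zbar (d_z (fun w => (F w)%:C)) z
      = (cabs z ^+ (2 * (m - 1)))%:C * g z)
    (F_z : forall z, U z ->
      d_z (fun w => (F w)%:C) z
      = ((toC z)^*)%C * (cabs z ^+ (2 * (m - 1)))%:C * h z)
    (g_neq0 : forall z, U z -> g z != 0)
    (W_open : open W) (W_dom : forall z, U z -> W (cabs z ^+ 2))
    (f_smooth : csmooth_on W f) (b_smooth : csmooth_on U b)
    (F_fb : forall z, U z -> (F z)%:C = f (cabs z ^+ 2) * b z)
    (b0_neq0 : b (0, 0) != 0) :
  (forall (s rho : R) (V : set (R * R * R)),
    nbhs ((0, 0, 0) : R * R * R) V -> V `<=` [set p | U p.1] ->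
    (forall N : R, 0 < N -> exists C : R,
      forall v : R * R * R -> R[i], test_function V v ->
        sqnorm (s - rho) v + sqnorm s (opLbar F v)
          + sqnorm s (fun p => ((toC p.1)^*)%C ^+ k * opL F v p)
        <= C * (Normc.normc (inner s (opP k F v) v) + sqnorm (- N) v)) ->
    (k%:R - 1) / (2 * m%:R) <= rho)
  /\
  (forall s r : R,
    (forall phi phit : R * R * R -> R,
      test_function [set p | U p.1] (fun p => (phi p)%:C) ->
      test_function [set p | U p.1] (fun p => (phit p)%:C) ->
      (forall p, supp (fun q => (phi q)%:C) p ->
        \forall q \near p, phit q = 1) ->
      forall K : set (R * R * R), compact K -> K `<=` [set p | U p.1] ->
      forall N : R, 0 < N -> exists C : R,
        forall u : R * R * R -> R[i], csmooth_on setT u -> supp u `<=` K ->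
          sqnorm s (fun p => (phi p)%:C * u p)
          <= C * (sqnorm (s + r) (fun p => (phit p)%:C * opP k F u p)
                  + sqnorm (- N) u)) ->
    (k%:R - 1) / m%:R <= r).
Proof.
have [r0 r00 [r0U H]] := probe_family m_ge1 k_ge1 U_open U0 F_smooth g_smooth
  h_smooth F_zzbar F_z g_neq0.
have mR : 0 < m%:R :> R by rewrite ltr0n.
have kR : (k.-1)%:R = k%:R - 1 :> R by rewrite -[in RHS](prednK k_ge1) -natr1 addrK.
have const (C A B : R) : A <= C * B -> 0 <= B -> A <= `|C| * B.
  by move=> AB B0; apply: le_trans AB _; rewrite ler_wpM2r// ler_norm.
split=> [s rho V V0 VU est | s r est].
- have [r1 r10 r1V] := nbhs_box3 V0.
  pose e := Num.min r0 r1.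
  have e0 : 0 < e by rewrite lt_min r00.
  have er0 : e <= r0 by rewrite ge_min lexx.
  have er1 : e <= r1 by rewrite ge_min lexx orbT.
  have [v [mu [muE sv v0 Pv0 bounds]]] := H e e0 er0.
  have v_test la : test_function V (v la).
    split; [exact: sv|exact: compact_supp_box3 (v0 la)|].
    apply: subset_trans (supp_box3 (v0 la)) _.
    exact: subset_trans (box3W er1) r1V.
  (* The error of order - N is then at most la^(-2(k-1)) times the weight of
     order s. *)
  pose N : R := `|s| + (2 * k.-1)%:R + 1.
  have N0 : 0 < N by rewrite ltr_wpDl// addr_ge0// ler0n.
  have Ns : (2 * k.-1)%:R <= N + s.
    have := ler_norm (- s); rewrite normrN /N; lra.
  have [A HA] := est N N0.
  have [[C C0 HC] _] := bounds s.
  have [[C' C'0 HC'] _] := bounds (- N).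
  have [_ [c1 [la1 [c10 la11 low]]]] := bounds (s - rho).
  have -> : (k%:R - 1) / (2 * m%:R) = (2 * k.-1)%:R / (4 * m%:R) :> R.
    by rewrite natrM kR; field; rewrite gt_eqF.
  apply: (@sobolev_comparison _ m _ s rho N `|A| C C' c1 la1 mu) => // la lale.
  have la1' : 1 <= la by exact: le_trans lale.
  have [_ u2 _] := HC la la1'; have [w1 _ _] := HC' la la1'.
  apply: le_trans (low la lale) _.
  have HAv := HA (v la) (v_test la).
  have B0 : 0 <= Normc.normc (inner s (opP k F (v la)) (v la)) + sqnorm (- N) (v la).
    by rewrite addr_ge0 ?normc_ge0 ?sqnorm_ge0.
  apply: le_trans (le_trans (const _ _ _ HAv B0) _); last first.
    by rewrite ler_wpM2l// lerD.
  by rewrite -addrA lerDl addr_ge0// sqnorm_ge0.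
pose e := r0 / 10.
have e0 : 0 < e by rewrite divr_gt0.
have er0 : e <= r0 by rewrite /e; lra.
have boxU d : d <= r0 -> box3 d `<=` [set p | U p.1].
  by move=> dr p [p1 _]; apply: r0U; exact: in_boxW p1.
have [v [mu [muE sv v0 Pv0 bounds]]] := H e e0 er0.
have e3 : e <= 3 * e by lra.
(* Both cut-offs are 1 on the support of the probe and disappear from the
   estimate; phit is 1 on a box that is larger than the one containing the
   support of phi. *)
pose phi := @bump3 R e; pose phit := @bump3 R (3 * e).
have phi_test : test_function [set p | U p.1] (fun p => (phi p)%:C).
  by apply: test_function_bump3 => //; apply: boxU; rewrite /e; lra.
have phit_test : test_function [set p | U p.1] (fun p => (phit p)%:C).
  by apply: test_function_bump3; [rewrite mulr_gt0|apply: boxU; rewrite /e; lra].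
have phit1 p : supp (fun q => (phi q)%:C) p -> \forall q \near p, phit q = 1.
  move=> sp; have pb : box3 (2 * e) p.
    by apply: (@supp_box3 _ (fun q => (phi q)%:C)) sp => q qN; rewrite /phi bump3_eq0.
  have lt23 : 2 * e < 3 * e by lra.
  apply: filterS (near_box3 lt23 pb) => q qb.
  by rewrite /phit bump3_eq1// mulr_gt0.
have fix_by d (w : R * R * R -> R[i]) : e <= d -> (forall p, ~ box3 e p -> w p = 0) ->
    (fun p => (bump3 d p)%:C * w p) = w.
  move=> ed w0; apply/funext => p; case: (pselect (box3 e p)) => pe; last first.
    by rewrite w0// mulr0.
  rewrite bump3_eq1 ?mul1r//; first exact: lt_le_trans ed.
  exact: box3W ed p pe.
pose d := (2 * k.-1 + 2 * k.-1)%N.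
pose N : R := `|s + r| + d%:R + 1.
have N0 : 0 < N by rewrite ltr_wpDl// addr_ge0// ler0n.
have Ns : d%:R <= N + (s + r).
  have := ler_norm (- (s + r)); rewrite normrN /N; lra.
have [A HA] := est phi phit phi_test phit_test phit1 (box3 e) (@compact_box3 R e)
  (boxU e er0) N N0.
have [[C C0 HC] _] := bounds (s + r).
have [[C' C'0 HC'] _] := bounds (- N).
have [_ [c1 [la1 [c10 la11 low]]]] := bounds s.
have -> : (k%:R - 1) / m%:R = d%:R / (4 * m%:R) :> R.
  by rewrite /d natrD natrM kR; field; rewrite gt_eqF.
apply: (@sobolev_comparison _ m _ (s + r) r N `|A| C C' c1 la1 mu) => // la lale.
have la1' : 1 <= la by exact: le_trans lale.
have [_ _ u3] := HC la la1'; have [w1 _ _] := HC' la la1'.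
rewrite addrK; apply: le_trans (low la lale) _.
have := HA (v la) (sv la) (supp_box3 (v0 la)).
rewrite /phi /phit (fix_by _ _ (lexx e) (v0 la)) (fix_by _ _ e3 (Pv0 la)).
move=> HAv; apply: le_trans (const _ _ _ HAv _) _.
  by rewrite addr_ge0 ?sqnorm_ge0.
by rewrite ler_wpM2l// lerD.
Qed.
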